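(* Let $G$ be a simple labeled graph and let $\widetilde G$ be a labeled graph obtained from $G$ by one of the Reidemeister moves $\Omega_1,\Omega_2,\Omega_3,\Omega_4,\Omega_4'$. Then the reduced (odd) Khovanov homologies of $G$ and $\widetilde G$ are isomorphic: $\overline{\mathrm{Kh}}(\widetilde G)\cong\overline{\mathrm{Kh}}(G)$ as (ungraded) $\mathbb Z_2$-vector spaces.
   Context: $\mathbb Z_2$ is the field with two elements. A (simple) labeled graph $G$ is a finite undirected graph without loops and multiple edges, each vertex $v$ of which carries a pair (label) $(\mathrm{fr}(v),\mathrm{sgn}(v))$ with framing $\mathrm{fr}(v)\in\{0,1\}$ and sign $\mathrm{sgn}(v)\in\{-1,1\}$. $\mathcal V=\mathcal V(G)=\{v_1,\dots,v_n\}$ is the set of vertices with a fixed enumeration. $N(v)$ is the set of vertices adjacent to $v$. The adjacency matrix $A(G)=(a_{ij})$ over $\mathbb Z_2$ has, for $i\ne j$, $a_{ij}=1$ iff $v_i,v_j$ are adjacent (and $0$ otherwise), and $a_{ii}=\mathrm{fr}(v_i)$. Khovanov complex. A state is a subset $s\subset\mathcal V$. Put $V(s)=\mathbb Z_2\langle x_1,\dots,x_n\mid r_1^s,\dots,r_n^s\rangle$ (the vector space with generators $x_1,\dots,x_n$ modulo the relations $r^s_i=0$), where $r_i^s=x_i+\sum_{j:\,v_j\in s}a_{ij}x_j$ if $v_i\notin s$ and $r_i^s=\sum_{j:\,v_j\in s}a_{ij}x_j$ if $v_i\in s$. Let $s\oplus i$ denote $s\cup\{v_i\}$ if $v_i\notin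 s$ and $s\setminus\{v_i\}$ if $v_i\in s$. There is an arrow $s\to s\oplus i$ iff either $v_i\notin s$ and $\mathrm{sgn}(v_i)=-1$, or $v_i\in s$ and $\mathrm{sgn}(v_i)=1$. To an arrow $s\to s\oplus i$ assign the linear map $\partial^s_{s\oplus i}:\bigwedge^*V(s)\to\bigwedge^*V(s\oplus i)$ given by $u\mapsto x_i\wedge u$ if $x_i=0$ in $V(s)$, and $u\mapsto u$ if $x_i\neq0$ in $V(s)$ (here $u$ is represented by an exterior polynomial in the generators $x_1,\dots,x_n$, and the result is read in $\bigwedge^*V(s\oplus i)$; this is well defined). Let $C(G)=\bigoplus_{s\subset\mathcal V}\bigwedge^*V(s)$ with $\partial(u)=\sum_{s\to s'}\partial^s_{s'}(u)$ for $u\in\bigwedge^*V(s)$; then $\partial^2=0$. The reduced (odd) Khovanov homology $\overline{\mathrm{Kh}}(G)$ is the homology $\ker\partial/\operatorname{im}\partial$ of $(C(G),\partial)$. Reidemeister moves on labeled graphs. $\Omega_1$: addition/removal of an isolated vertex labeled $(0,1)$ or $(0,-1)$. $\Omega_2$: addition/removal of two adjacent (resp. nonadjacent) vertices with labels $(1,-1)$ and $(1,1)$ (resp. $(0,-1)$ and $(0,1)$) having the same neighbours among the other vertices. $\Omega_3$: let $u,v,w$ be three distinct vertices all labeled $(0,-1)$ such that $u$ is adjacent to $v$ and $w$ and to no other vertices. Change the adjacencies of $u$ so that the new neighbourhood of $u$ is $(N(v)\setminus N(w))\cup(N(w)\setminus N(v))$ (neighbourhoods taken in the original graph; adjacency of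 pairs of vertices not involving $u$ is unchanged), and change the signs of $v$ and $w$ to $+1$. The inverse operation is also called $\Omega_3$. $\Omega_4$: take two adjacent vertices $u$ labeled $(0,\alpha)$ and $v$ labeled $(0,\beta)$. Change the label of $u$ to $(0,-\beta)$ and the label of $v$ to $(0,-\alpha)$, and change (toggle) the adjacency of each pair $\{t,w\}$ of vertices different from $u,v$ such that $t\in N(u)$ and $w\in N(v)\setminus N(u)$, or $t\in N(v)$ and $w\in N(u)\setminus N(v)$. $\Omega_4'$: take a vertex $v$ with label $(1,\alpha)$. Change (toggle) the adjacency of each pair of distinct vertices $t,w\in N(v)$, change the sign of $v$, and change the framing of each $w\in N(v)$. *)

(* Defs.v *)
From HB Require Import structures.
From mathcomp Require Import all_boot all_order all_algebra.

Set Implicit Arguments.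
Unset Strict Implicit.
Unset Printing Implicit Defensive.

Import GRing.Theory VectorInternalTheory.
Local Open Scope ring_scope.

Section QuotientSpace.
Variables (K : fieldType) (vT : vectType K) (W : {vspace vT}).

(* The quotient space vT / W, with canonical projection quo. *)
Definition quotv : Type := Quotient.quot W.

HB.instance Definition _ := GRing.Zmodule.on quotv.

(* Locked: conversion problems between distinct quotients diverge otherwise. *)
Fact quo_key : unit. Proof. by []. Qed.
Definition quo : vT -> quotv :=
  locked_with quo_key (fun v => \pi_(Quotient.quot W) v)%qT.
Definition quo_repr : quotv -> vT :=
  locked_with quo_key (fun q : Quotient.quot W => repr q).
Let quoE v : quo v = (\pi_(Quotient.quot W) v)%qT.
Proof. by rewrite /quo unlock. Qed.

Lemma quo_reprK : cancel quo_repr quo.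
Proof.
move=> q; have -> : quo_repr q = repr (q : Quotient.quot W).
  by rewrite /quo_repr unlock.
by rewrite quoE; apply: (@reprK _ (Quotient.quot W)).
Qed.

Lemma eq_quo u v : (quo u == quo v) = (u - v \in W).
Proof. by rewrite !quoE Quotient.idealrBE. Qed.

Lemma quo_eq0 v : (quo v == 0) = (v \in W).
Proof.
have <- : quo 0 = 0 by rewrite quoE; apply: (raddf0 (\pi_(Quotient.quot W))%qT).
by rewrite eq_quo subr0.
Qed.

Let quoD : {morph quo : u v / u + v}.
Proof.
by move=> u v; rewrite !quoE; apply: (raddfD (\pi_(Quotient.quot W))%qT).
Qed.

Definition quo_scale (a : K) (q : quotv) : quotv := quo (a *: quo_repr q).

Let quo_scaleE a v : quo_scale a (quo v) = quo (a *: v).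
Proof.
apply/eqP; rewrite eq_quo -scalerBr memvZ // -eq_quo.
by rewrite quo_reprK.
Qed.

Let quo_scaleA a b q : quo_scale a (quo_scale b q) = quo_scale (a * b) q.
Proof. by rewrite -[q]quo_reprK !quo_scaleE scalerA. Qed.
Let quo_scale1 : left_id 1 quo_scale.
Proof. by move=> q; rewrite -[q]quo_reprK quo_scaleE scale1r. Qed.
Let quo_scaleDr : right_distributive quo_scale +%R.
Proof.
move=> a p q; rewrite -[p]quo_reprK -[q]quo_reprK.
by rewrite -quoD !quo_scaleE scalerDr quoD.
Qed.
Let quo_scaleDl q : {morph quo_scale^~ q : a b / a + b}.
Proof.
by move=> a b; rewrite -[q]quo_reprK !quo_scaleE scalerDl quoD.
Qed.

HB.instance Definition _ := GRing.Zmodule_isLmodule.Build K quotv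
  quo_scaleA quo_scale1 quo_scaleDr quo_scaleDl.

Lemma quo_is_linear : linear quo.
Proof. by move=> a u v; rewrite quoD -quo_scaleE. Qed.
HB.instance Definition _ :=
  GRing.isLinear.Build K vT quotv _ quo quo_is_linear.

Fact quotv_vect_iso : Vector.axiom (dim (subvs_of W^C)) quotv.
Proof.
pose g (u : subvs_of W^C) : quotv := quo (vsval u).
have g_lin : linear g by move=> a u v; rewrite /g !linearP.
have g_inj : injective g.
  move=> u v /eqP; rewrite /g eq_quo => uvW.
  apply/eqP; rewrite -subr_eq0; apply/eqP/val_inj => /=.
  apply/eqP; rewrite -memv0 -(capv_compl W) memv_cap uvW /=.
  by rewrite memvB ?subvsP.
pose h (q : quotv) : subvs_of W^C :=
  vsproj W^C (quo_repr q - projv W (quo_repr q)).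
have hK : cancel h g.
  move=> q; have e := vsprojK (memv_projC W (quo_repr q)).
  rewrite /g /h e -[RHS]quo_reprK; apply/eqP; rewrite eq_quo.
  by rewrite addrAC subrr sub0r memvN memv_proj.
have gK : cancel g h by move=> u; apply: g_inj; rewrite hK.
have h_lin : linear h.
  by move=> a p q; apply: g_inj; rewrite g_lin !hK.
exists (fun q => v2r (h q)).
  by move=> a p q; rewrite h_lin linearP.
exists (fun r => g (r2v r)) => [q|r].
  by rewrite v2rK hK.
by rewrite gK r2vK.
Qed.
HB.instance Definition _ := Lmodule_hasFinDim.Build K quotv quotv_vect_iso.

End QuotientSpace.

Section DirectSum.
Variables (K : fieldType) (I : finType) (E : I -> vectType K).

(* A finite direct sum of the spaces E i, as their product. *)
Definition dsum : Type := {dffun forall i, E i}.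
HB.instance Definition _ := Choice.on dsum.

Definition dsum_fun (c : dsum) : forall i, E i := fun i => c i.
Definition dsum_of (f : forall i, E i) : dsum := finfun f.

Lemma dsumE f i : dsum_fun (dsum_of f) i = f i.
Proof. by rewrite /dsum_fun /dsum_of ffunE. Qed.

Lemma dsumP b c : (forall i, dsum_fun b i = dsum_fun c i) <-> b = c.
Proof. by split=> [bc|-> //]; apply/ffunP => i; apply: bc. Qed.

Let dzero : dsum := dsum_of (fun _ => 0).
Let dopp (c : dsum) : dsum := dsum_of (fun i => - dsum_fun c i).
Let dadd (b c : dsum) : dsum := dsum_of (fun i => dsum_fun b i + dsum_fun c i).
Let dscale a (c : dsum) : dsum := dsum_of (fun i => a *: dsum_fun c i).

Let daddA : associative dadd.
Proof. by move=> ? ? ?; apply/dsumP=> i; rewrite !dsumE addrA. Qed.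
Let daddC : commutative dadd.
Proof. by move=> ? ?; apply/dsumP=> i; rewrite !dsumE addrC. Qed.
Let dadd0 : left_id dzero dadd.
Proof. by move=> ?; apply/dsumP=> i; rewrite !dsumE add0r. Qed.
Let daddN : left_inverse dzero dopp dadd.
Proof. by move=> ?; apply/dsumP=> i; rewrite !dsumE addNr. Qed.
HB.instance Definition _ := GRing.isZmodule.Build dsum daddA daddC dadd0 daddN.

Let dscaleA a b c : dscale a (dscale b c) = dscale (a * b) c.
Proof. by apply/dsumP=> i; rewrite !dsumE scalerA. Qed.
Let dscale1 : left_id 1 dscale.
Proof. by move=> ?; apply/dsumP=> i; rewrite !dsumE scale1r. Qed.
Let dscaleDr : right_distributive dscale +%R.
Proof. by move=> ? ? ?; apply/dsumP=> i; rewrite !dsumE scalerDr. Qed.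
Let dscaleDl c : {morph dscale^~ c : a b / a + b}.
Proof. by move=> a b; apply/dsumP=> i; rewrite !dsumE scalerDl. Qed.
HB.instance Definition _ := GRing.Zmodule_isLmodule.Build K dsum
  dscaleA dscale1 dscaleDr dscaleDl.

Lemma dsumDE b c i : dsum_fun (b + c) i = dsum_fun b i + dsum_fun c i.
Proof. exact: dsumE. Qed.
Lemma dsumZE a c i : dsum_fun (a *: c) i = a *: dsum_fun c i.
Proof. exact: dsumE. Qed.

Fact dsum_vect_iso :
  Vector.axiom (dim {ffun {i : I & 'I_(dim (E i))} -> K^o}) dsum.
Proof.
pose h (c : dsum) : {ffun {i : I & 'I_(dim (E i))} -> K^o} :=
  [ffun t => v2r (dsum_fun c (tag t)) 0 (tagged t)].
pose g (u : {ffun {i : I & 'I_(dim (E i))} -> K^o}) : dsum :=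
  dsum_of (fun i => r2v
                      (\row_k (u (Tagged (fun i => 'I_(dim (E i))) k) : K))).
have hK : cancel h g.
  move=> c; apply/dsumP=> i; rewrite dsumE.
  apply: (canLR (@v2rK _ _)).
  by apply/rowP=> k; rewrite mxE ffunE.
have gK : cancel g h.
  move=> u; apply/ffunP=> -[i k].
  by rewrite ffunE dsumE r2vK mxE.
have h_lin : linear h.
  move=> a b c; apply/ffunP=> t.
  by rewrite !ffunE dsumDE dsumZE linearP !mxE.
exists (fun c => v2r (h c)).
  by move=> a p q; rewrite h_lin linearP.
exists (fun r => g (r2v r)) => [q|r].
  by rewrite v2rK hK.
by rewrite gK r2vK.
Qed.
HB.instance Definition _ := Lmodule_hasFinDim.Build K dsum dsum_vect_iso.

End DirectSum.

Section Homology.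
Variables (K : fieldType) (C : vectType K) (d : 'End(C)).

Definition cycles : vectType K := subvs_of (lker d).
Definition boundaries : {vspace cycles} :=
  (linfun (vsval : cycles -> C) @^-1: limg d)%VS.
(* ker d / (im d :&: ker d), which is ker d / im d when d \o d = 0. *)
Definition homology : vectType K := quotv boundaries.

End Homology.

Definition F2 : fieldType := 'F_2.

Section ExteriorPolynomials.
Variable n : nat.

(* Exterior polynomials in n generators over the field with two elements: p L
   is the coefficient of the product of the generators indexed by L. No signs
   occur in the product since the characteristic is 2. *)
Definition extpoly : vectType F2 := {ffun {set 'I_n} -> F2^o}.

Definition wedge (p q : extpoly) : extpoly :=
  [ffun L : {set 'I_n} =>
     \sum_(J : {set 'I_n} | J \subset L) (p J : F2) * q (L :\: J)].

Definition gen (i : 'I_n) : extpoly := [ffun J => (J == [set i])%:R].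

(* The degree one element with coordinates v in the generators. *)
Definition linform (v : 'rV[F2]_n) : extpoly := \sum_i v 0 i *: gen i.

Lemma wedge_is_linear p : linear (wedge p).
Proof.
move=> a q r; apply/ffunP=> L; rewrite !ffunE scaler_sumr -big_split /=.
by apply: eq_bigr => J _; rewrite !ffunE mulrDr mulrCA.
Qed.
HB.instance Definition _ p :=
  GRing.isLinear.Build F2 extpoly extpoly _ (wedge p) (wedge_is_linear p).

Lemma wedge_linearl q : linear (wedge^~ q).
Proof.
move=> a p r; apply/ffunP=> L; rewrite !ffunE scaler_sumr -big_split /=.
by apply: eq_bigr => J _; rewrite !ffunE mulrDl -mulrA.
Qed.

Lemma wedge_genE i p (L : {set 'I_n}) :
  wedge (gen i) p L = if i \in L then p (L :\ i) else 0.
Proof.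
rewrite ffunE big_mkcond (bigD1 [set i]) //= sub1set ffunE eqxx mul1r.
by rewrite big1 ?addr0 // => J /negPf Ji; case: ifP; rewrite // ffunE Ji mul0r.
Qed.

Lemma linform_is_linear : linear linform.
Proof.
move=> a u v; rewrite /linform scaler_sumr -big_split /=.
by apply: eq_bigr => i _; rewrite !mxE scalerDl scalerA.
Qed.
HB.instance Definition _ :=
  GRing.isLinear.Build F2 'rV[F2]_n extpoly _ linform linform_is_linear.

Lemma linform_delta i : linform (delta_mx 0 i) = gen i.
Proof.
rewrite /linform (bigD1 i) //= mxE !eqxx scale1r big1 ?addr0 // => j /negPf ji.
by rewrite mxE ji andbF scale0r.
Qed.

Lemma wedge_linform v q : wedge (linform v) q = \sum_i v 0 i *: wedge (gen i) q.
Proof.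
pose w q := GRing.isLinear.Build F2 extpoly extpoly _ _ (wedge_linearl q).
pose W : {linear extpoly -> extpoly} := HB.pack (wedge^~ q) (w q).
by rewrite -[LHS]/(W _) linear_sum; apply: eq_bigr => i _; rewrite linearZ.
Qed.

Lemma wedge_linform_is_linear q : linear (fun v => wedge (linform v) q).
Proof. by move=> a u v; rewrite linearP /= wedge_linearl. Qed.

Lemma wedge_gen2 i p : wedge (gen i) (wedge (gen i) p) = 0.
Proof.
by apply/ffunP=> L; rewrite !wedge_genE ffunE setD11; case: ifP.
Qed.

Lemma wedge_genC i j p :
  wedge (gen i) (wedge (gen j) p) = wedge (gen j) (wedge (gen i) p).
Proof.
apply/ffunP=> L; rewrite !wedge_genE !in_setD1 [j == i]eq_sym.
have [->|/= _] := eqVneq i j; first by case: (j \in L).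
rewrite setDDl setUC -setDDl.
by case: (i \in L); case: (j \in L).
Qed.

Lemma wedge_genCl i v p :
  wedge (gen i) (wedge (linform v) p) = wedge (linform v) (wedge (gen i) p).
Proof.
rewrite !wedge_linform linear_sum; apply: eq_bigr => j _.
by rewrite linearZ wedge_genC.
Qed.

End ExteriorPolynomials.

(* Framings are read true = 1, false = 0; signs are read true = +1, false = -1. *)
Record lgraph (n : nat) := LGraph {
  adj : rel 'I_n;
  fr : 'I_n -> bool;
  sgn : 'I_n -> bool;
  adj_sym : symmetric adj;
  adj_irr : irreflexive adj
}.

Section KhovanovComplex.
Variables (n : nat) (G : lgraph n).
Implicit Types (s t : {set 'I_n}) (i j k : 'I_n).

Definition adjmx : 'M[F2]_n :=
  \matrix_(i, j) (if i == j then fr G i else adj G i j)%:R.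

Definition xgen i : 'rV[F2]_n := delta_mx 0 i.

Definition relation s i : 'rV[F2]_n :=
  (if i \in s then 0 else xgen i) + \sum_(j in s) adjmx i j *: xgen j.

Definition relspace s : {vspace 'rV[F2]_n} :=
  <<[seq relation s i | i : 'I_n]>>%VS.

Definition Vstate s : vectType F2 := quotv (relspace s).

(* The ideal of exterior polynomials generated by the relations of s; the
   exterior algebra of V(s) is presented by the same generators and relations
   as V(s). *)
Fact relideal_key : unit. Proof. by []. Qed.
Definition relideal : {set 'I_n} -> {vspace extpoly n} :=
  locked_with relideal_key
    (fun s => \sum_(i < n) limg (linfun (wedge (linform (relation s i)))))%VS.
Canonical relideal_unlockable := [unlockable fun relideal].

Definition extV s : vectType F2 := quotv (relideal s).

Definition flip s i : {set 'I_n} := if i \in s then s :\ i else i |: s.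

(* There is an arrow from s to flip s i. *)
Definition arrow s i : bool := if i \in s then sgn G i else ~~ sgn G i.

Definition xzero s i : bool := (quo (relspace s) (xgen i) : Vstate s) == 0.

(* Meaningful for t = flip s i: the value on the class of an arbitrary exterior
   polynomial p, independently of the representative, is given by edgeE below. *)
Definition edge s t i (u : extV s) : extV t :=
  quo (relideal t)
    (if xzero s i then wedge (gen i) (quo_repr u) else quo_repr u).

Definition khC : vectType F2 := dsum extV.

Definition khd (c : khC) : khC :=
  dsum_of (fun t =>
    \sum_(s : {set 'I_n}) \sum_(i < n | arrow s i && (flip s i == t))
      edge t i (dsum_fun c s)).

Lemma adjmx_sym j k : adjmx j k = adjmx k j.
Proof. by rewrite !mxE eq_sym adj_sym; case: eqP => // ->. Qed.

Lemma relation_dot s j (y : 'I_n -> F2) :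
  \sum_k relation s j 0 k * y k =
    (j \notin s)%:R * y j + \sum_(k in s) adjmx j k * y k.
Proof.
rewrite /relation.
under eq_bigr do rewrite mxE mulrDl.
rewrite big_split /=; congr (_ + _).
  case: ifP => _ /=.
    by rewrite mul0r big1 // => k _; rewrite mxE mul0r.
  rewrite (bigD1 j) //= mxE !eqxx mul1r big1 ?addr0 // => k /negPf kj.
  by rewrite mxE kj mul0r.
rewrite [RHS]big_mkcond /=; apply: eq_bigr => k _.
rewrite summxE; case: ifP => ks.
  rewrite (bigD1 k) //= !mxE !eqxx mulr1 big1 ?addr0 // => l /andP[_ /negPf lk].
  by rewrite !mxE eqxx [k == l]eq_sym lk mulr0.
rewrite big1 ?mul0r // => l ls; rewrite !mxE eqxx.
by have [kl|_] := eqVneq k l; [rewrite kl ls in ks | rewrite mulr0].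
Qed.

Lemma xgen_notin_relspace s i : xgen i \notin relspace s ->
  exists2 y : 'I_n -> F2, y i != 0 &
    forall j, (j \notin s)%:R * y j + \sum_(k in s) adjmx j k * y k = 0.
Proof.
move=> xNs; pose B : 'M[F2]_n := \matrix_j relation s j.
have xNB : ~~ (xgen i <= B)%MS.
  apply: contra xNs => /submxP[w ->].
  rewrite mulmx_sum_row; apply: memv_suml => j _; apply: memvZ.
  by rewrite rowK; apply/memv_span/map_f; rewrite mem_enum.
have /rV0Pn[l yl] : xgen i *m cokermx B != 0 by rewrite -submxE.
exists (fun k => cokermx B k l).
  by rewrite -rowE mxE in yl.
move=> j; rewrite -relation_dot.
have /matrixP/(_ j l) := mulmx_coker B.
by rewrite !mxE => e; rewrite -[RHS]e; apply: eq_bigr => k _; rewrite !mxE.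
Qed.

Lemma xgen_flip s i : ~~ xzero s i -> xgen i \in relspace (flip s i).
Proof.
rewrite /xzero quo_eq0 => /xgen_notin_relspace[y yi yE].
apply/negPn/negP => /xgen_notin_relspace[z zi zE].
set t := flip s i in zE.
have {}yE j : \sum_(k in s) adjmx j k * y k = - ((j \notin s)%:R * y j).
  by apply/eqP; rewrite -addr_eq0 addrC yE.
have {}zE j : \sum_(k in t) adjmx j k * z k = - ((j \notin t)%:R * z j).
  by apply/eqP; rewrite -addr_eq0 addrC zE.
have : \sum_(j in s) y j * - ((j \notin t)%:R * z j) =
       \sum_(j in t) z j * - ((j \notin s)%:R * y j).
  under eq_bigr do rewrite -zE mulr_sumr.
  under [RHS]eq_bigr do rewrite -yE mulr_sumr.
  rewrite exchange_big /=; apply: eq_bigr => j _; apply: eq_bigr => k _.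
  by rewrite adjmx_sym mulrCA mulrA mulrC.
apply/eqP; rewrite /t /flip.
have [si|si] := boolP (i \in s).
  rewrite (bigD1 i) //= setD11 mul1r big1 => [|j /andP[sj ji]]; last first.
    by rewrite in_setD1 ji sj mul0r oppr0 mulr0.
  rewrite big1 => [|j]; last first.
    by rewrite in_setD1 => /andP[_ ->]; rewrite mul0r oppr0 mulr0.
  by rewrite addr0 mulrN oppr_eq0 mulf_neq0.
rewrite big1 => [|j sj]; last first.
  by rewrite in_setU1 sj orbT mul0r oppr0 mulr0.
rewrite (bigD1 i) ?in_setU1 ?eqxx //= si mul1r big1 => [|j].
  by rewrite addr0 mulrN eq_sym oppr_eq0 mulf_neq0.
rewrite in_setU1 => /andP[/orP[/eqP->|sj] ji]; first by rewrite eqxx in ji.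
by rewrite sj mul0r oppr0 mulr0.
Qed.

Lemma relation_flip s i j : exists a : F2,
  relation s j = relation (flip s i) j + a *: xgen i.
Proof.
have addU t : i \notin t -> exists a : F2,
    relation (i |: t) j = relation t j + a *: xgen i.
  move=> ti; exists (adjmx j i - (j == i)%:R).
  rewrite /relation big_setU1 //= in_setU1 scalerBl.
  have [->|_] := eqVneq j i.
    by rewrite /= (negPf ti) scale1r add0r [RHS]addrC addrA subrK.
  by rewrite /= scale0r subr0 -addrA; congr (_ + _); rewrite addrC.
rewrite /flip; have [si|/addU[a ->]] := boolP (i \in s).
  have [|a] := addU (s :\ i); first by rewrite setD11.
  by rewrite setD1K // => ->; exists a.
by exists (- a); rewrite -addrA -scalerDl subrr scale0r addr0.
Qed.

Lemma wedge_relation_in s j q : wedge (linform (relation s j)) q \in relideal s.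
Proof.
rewrite unlock; apply: (subvP (sumv_sup j _ (subvv _))) => //.
by apply/memv_imgP; exists q; rewrite ?memvf ?lfunE.
Qed.

Lemma wedge_relspace_in s v q :
  v \in relspace s -> wedge (linform v) q \in relideal s.
Proof.
pose w := GRing.isLinear.Build F2 'rV[F2]_n (extpoly n) _ _
  (wedge_linform_is_linear q).
pose W : {linear 'rV[F2]_n -> extpoly n} :=
  HB.pack (fun v => wedge (linform v) q) w.
suff /subvP sW : (relspace s <= linfun W @^-1: relideal s)%VS.
  by move/sW; rewrite -memv_preim lfunE.
apply/span_subvP => _ /mapP[j _ ->].
by rewrite -memv_preim lfunE; apply: wedge_relation_in.
Qed.

Lemma relideal_ind s (P : extpoly n -> Prop) : P 0 ->
  (forall p q, P p -> P q -> P (p + q)) ->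
  (forall j q, P (wedge (linform (relation s j)) q)) ->
  forall p, p \in relideal s -> P p.
Proof.
move=> P0 PD PW p; rewrite unlock => /memv_sumP[q q_in ->].
apply: (big_ind P) => // j _.
by have /memv_imgP[r _ ->] := q_in j isT; rewrite lfunE; apply: PW.
Qed.

Lemma relideal_flip s i p : p \in relideal s ->
  (if xzero s i then wedge (gen i) p else p) \in relideal (flip s i).
Proof.
pose t := flip s i; rewrite -/t.
elim/relideal_ind => {p} [|p q|j q].
- by rewrite linear0 if_same mem0v.
- by rewrite linearD; case: ifP => _; apply: memvD.
have [a ->] := relation_flip s i j; rewrite -/t addrC.
rewrite (wedge_linform_is_linear q); case: ifPn => [_|/xgen_flip xt].
  rewrite linearD linearZ /= linform_delta wedge_gen2 scaler0 add0r.
  by rewrite wedge_genCl wedge_relation_in.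
by rewrite memvD ?memvZ ?wedge_relation_in ?wedge_relspace_in.
Qed.

Lemma edgeE s i p :
  edge (flip s i) i (quo (relideal s) p) =
  quo (relideal (flip s i)) (if xzero s i then wedge (gen i) p else p).
Proof.
have : quo_repr (quo (relideal s) p) - p \in relideal s.
  by rewrite -eq_quo quo_reprK.
move/(@relideal_flip s i) => h; apply/eqP; rewrite /edge eq_quo.
by move: h; case: ifP => // _; rewrite linearB.
Qed.

Lemma edge_is_linear s i : linear (@edge s (flip s i) i).
Proof.
move=> a u v; pose p := quo_repr u; pose q := quo_repr v.
have <- : quo (relideal s) (a *: p + q) = a *: u + v.
  by rewrite quo_is_linear !quo_reprK.
have eu : edge (flip s i) i u = quo (relideal (flip s i))
    (if xzero s i then wedge (gen i) p else p) by [].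
have ev : edge (flip s i) i v = quo (relideal (flip s i))
    (if xzero s i then wedge (gen i) q else q) by [].
rewrite edgeE eu ev; case: (xzero s i); last exact: quo_is_linear.
by rewrite (wedge_is_linear (gen i) a) quo_is_linear.
Qed.

Lemma khd_is_linear : linear khd.
Proof.
move=> a b c; apply/dsumP => t; rewrite dsumDE dsumZE !dsumE.
rewrite scaler_sumr -big_split; apply: eq_bigr => s _ /=.
rewrite scaler_sumr -big_split; apply: eq_bigr => i /andP[_ /eqP <-] /=.
by rewrite dsumDE dsumZE edge_is_linear.
Qed.
HB.instance Definition _ :=
  GRing.isLinear.Build F2 khC khC _ khd khd_is_linear.

Definition Kh : vectType F2 := homology (linfun khd).

End KhovanovComplex.

Section Moves.
Implicit Types m n : nat.

Definition embeds_as_induced m n (f : 'I_m -> 'I_n)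
    (G : lgraph m) (H : lgraph n) : Prop :=
  [/\ injective f,
      forall i j, adj H (f i) (f j) = adj G i j,
      forall i, fr H (f i) = fr G i
    & forall i, sgn H (f i) = sgn G i].

(* H is G with one vertex v added; since v is outside the range of the
   injection f, every vertex of H other than v is some f i.              *)
Definition Omega1 n (G : lgraph n) (H : lgraph n.+1) : Prop :=
  exists (f : 'I_n -> 'I_n.+1) (v : 'I_n.+1),
    [/\ embeds_as_induced f G H,
        forall i, f i != v,
        fr H v = false
      & forall w, adj H v w = false].

Definition Omega2 n (G : lgraph n) (H : lgraph n.+2) : Prop :=
  exists (f : 'I_n -> 'I_n.+2) (u v : 'I_n.+2),
    [/\ embeds_as_induced f G H,
        u != v /\ (forall i, f i != u /\ f i != v),
        [/\ adj H u v, fr H u & fr H v] \/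
        [/\ ~~ adj H u v, ~~ fr H u & ~~ fr H v],
        sgn H u = false /\ sgn H v = true
      & forall w, w != u -> w != v -> adj H u w = adj H v w].

Definition Omega3 n (G H : lgraph n) : Prop :=
  exists u v w : 'I_n,
    [/\ uniq [:: u; v; w],
        forall x, x \in [:: u; v; w] -> fr G x = false /\ sgn G x = false
      & forall x, adj G u x = (x \in [:: v; w])] /\
    [/\ forall x, adj H u x = adj G v x (+) adj G w x,
        forall x y, x != u -> y != u -> adj H x y = adj G x y,
        forall x, fr H x = fr G x
      & forall x, sgn H x = (x \in [:: v; w]) || sgn G x].

Definition Omega4_toggles n (G : lgraph n) (u v t w : 'I_n) : bool :=
  [&& adj G u t, adj G v w & ~~ adj G u w] ||
  [&& adj G v t, adj G u w & ~~ adj G v w].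

(* Omega4_toggles is a condition on ordered pairs: an unordered pair {t, w} is
   toggled, once, when (t, w) or (w, t) satisfies it. *)
Definition Omega4 n (G H : lgraph n) : Prop :=
  exists u v : 'I_n,
    [/\ adj G u v, fr G u = false & fr G v = false] /\
    [/\ forall x, fr H x = fr G x,
        sgn H u = ~~ sgn G v /\ sgn H v = ~~ sgn G u,
        forall x, x != u -> x != v -> sgn H x = sgn G x,
        forall x, adj H u x = adj G u x /\ adj H v x = adj G v x
      & forall t w, t \notin [:: u; v] -> w \notin [:: u; v] ->
          adj H t w =
            adj G t w (+) (Omega4_toggles G u v t w || Omega4_toggles G u v w t)].

Definition Omega4' n (G H : lgraph n) : Prop :=
  exists v : 'I_n,
    [/\ fr G v,
        forall t w, adj H t w = adj G t w (+) [&& t != w, adj G v t & adj G v w],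
        forall x, sgn H x = (x == v) (+) sgn G x
      & forall x, fr H x = fr G x (+) adj G v x].

Inductive reidemeister : forall m n, lgraph m -> lgraph n -> Prop :=
| Omega1_add n (G : lgraph n) (H : lgraph n.+1) :
    Omega1 G H -> reidemeister G H
| Omega1_remove n (G : lgraph n) (H : lgraph n.+1) :
    Omega1 G H -> reidemeister H G
| Omega2_add n (G : lgraph n) (H : lgraph n.+2) :
    Omega2 G H -> reidemeister G H
| Omega2_remove n (G : lgraph n) (H : lgraph n.+2) :
    Omega2 G H -> reidemeister H G
| Omega3_move n (G H : lgraph n) : Omega3 G H -> reidemeister G H
| Omega3_inverse n (G H : lgraph n) : Omega3 G H -> reidemeister H G
| Omega4_move n (G H : lgraph n) : Omega4 G H -> reidemeister G H
| Omega4'_move n (G H : lgraph n) : Omega4' G H -> reidemeister G H.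

End Moves.

(* Main.v *)
(* Elements of the complex of G are families, indexed by the states s, of
   exterior polynomials modulo the ideals of the relations. The relations of s
   annihilate the space of all y such that q_j = sum_k a_jk p_k for every j, where
   (p_k, q_k) is (y_k, 0) if k is in s and (0, y_k) otherwise; removing k from s
   or adding it thus exchanges the roles of p_k and q_k.

   With this description Omega4' and Omega4 leave the whole complex unchanged up
   to relabeling of the states: v is moved in or out of s for Omega4', and the
   memberships of u and v are exchanged and complemented for Omega4. For the
   other moves, Gaussian elimination along edges that are multiplications by some
   x_u or quotients by some x_v gives smaller complexes. For Omega2, and for
   Omega1 with sign -1, the reduced complex is that of the graph without the added
   vertices; Omega1 with sign 1 follows, since adding two isolated vertices with
   opposite signs is an Omega2 move. For Omega3, the complexes of both graphs are
   reduced, and the remaining states correspond to each other bijectively, with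
   a linear substitution of x_u, x_v, x_w in each of them that is compatible with
   the edge maps of the two reduced complexes. *)
Require Import Defs.
From HB Require Import structures.
From mathcomp Require Import all_boot all_order all_algebra perm.

Set Implicit Arguments.
Unset Strict Implicit.
Unset Printing Implicit Defensive.

Import GRing.Theory.
Local Open Scope ring_scope.

(** * Exterior algebras over the field with two elements *)

(** The ideals change from state to state, so maps are written on polynomials and compared by
    congruences, and relation spaces are compared through their annihilators. Edge types need no
    bookkeeping of their own: whether x_i is zero is read off the relation space, so matching
    relation spaces match the edges. Elimination rests on the Clifford relation between
    multiplication by v and contraction by f. A covector with value 1 at x_u and x_v that
    annihilates the relations of the middle state splits both the multiplication and the quotient
    map, and the two splittings compose to zero because a contraction squares to zero. After
    elimination the differential acquires zigzags through the cancelled states. For Omega2 they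
    never return to a surviving state; for Omega3 one kind of zigzag survives in each complex and
    has to match an honest edge of the other. This can be checked because a contraction following a
    multiplication is again a substitution of generators. *)

Lemma F2P (x : F2) : x = 0 \/ x = 1.
Proof. by case: x => [[|[|k]] kP] //; [left | right]; apply: val_inj. Qed.

Lemma addxx (V : lmodType F2) (x : V) : x + x = 0.
Proof.
rewrite -[x]scale1r -scalerDl.
have -> : 1 + 1 = 0 :> F2 by apply: val_inj.
by rewrite scale0r.
Qed.

Lemma addxK (V : lmodType F2) (x y : V) : x + (x + y) = y.
Proof. by rewrite addrA addxx add0r. Qed.

Lemma oppx (V : lmodType F2) (x : V) : - x = x.
Proof. by apply/eqP; rewrite -subr_eq0 -opprD addxx oppr0. Qed.

Lemma addx_eq0 (V : lmodType F2) (x y : V) : (x + y == 0) = (x == y).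
Proof. by rewrite -[y in LHS]oppx subr_eq0. Qed.

Lemma addF2 (x : F2) : x + x = 0.
Proof. exact: (@addxx F2^o). Qed.

Lemma F2_linear (U V : lmodType F2) (f : U -> V) :
  {morph f : x y / x + y} -> linear f.
Proof.
move=> fD a x y; rewrite fD; congr (_ + _).
have f0 : f 0 = 0 by rewrite -[in f 0](addxx 0) fD addxx.
by have [->|->] := F2P a; rewrite ?scale0r ?scale1r.
Qed.

(** The terms off the diagonal cancel in pairs; the enumeration rank only selects one member of each
    pair. *)
Lemma sum_sym_F2 (V : lmodType F2) (I : finType) (f : I -> I -> V) :
  (forall i, f i i = 0) -> (forall i j, f i j = f j i) ->
  \sum_i \sum_j f i j = 0.
Proof.
move=> f0 fC; pose r (i j : I) := (enum_rank i < enum_rank j)%N.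
have -> : \sum_i \sum_j f i j =
    \sum_i \sum_(j | r i j) f i j + \sum_i \sum_(j | r j i) f i j.
  rewrite -big_split; apply: eq_bigr => i _ /=.
  rewrite [LHS](bigID (r i)) /=; congr (_ + _).
  rewrite (bigID (pred1 i)) /= [X in X + _]big1 ?add0r; last first.
    by move=> j /andP[_ /eqP->].
  apply: eq_bigl => j; rewrite /r -leqNgt [RHS]ltn_neqAle andbC.
  by congr andb; rewrite (inj_eq val_inj) (inj_eq enum_rank_inj).
rewrite [X in _ + X](exchange_big_dep xpredT) //=.
under [X in _ + X]eq_bigr do under eq_bigr do rewrite fC.
exact: addxx.
Qed.

(* An opaque copy of extpoly n: conversion problems on the concrete space of
   finite functions are intractable. *)
Lemma ext_copy n : {E : vectType F2 & {of_p : {linear extpoly n -> E} &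
  {to_p : {linear E -> extpoly n} | cancel of_p to_p & cancel to_p of_p}}}.
Proof. by exists (extpoly n), idfun, idfun. Qed.

Definition ext n : vectType F2 := projT1 (ext_copy n).

Section Exterior.
Variable n : nat.

Definition of_poly : {linear extpoly n -> ext n} := projT1 (projT2 (ext_copy n)).
Definition to_poly : {linear ext n -> extpoly n} :=
  s2val (projT2 (projT2 (ext_copy n))).
Lemma of_polyK : cancel of_poly to_poly.
Proof. exact: (s2valP (projT2 (projT2 (ext_copy n)))). Qed.
Lemma to_polyK : cancel to_poly of_poly.
Proof. exact: (s2valP' (projT2 (projT2 (ext_copy n)))). Qed.

Implicit Types (p q : ext n) (v : 'rV[F2]_n) (i j : 'I_n) (K L : {set 'I_n}).

Definition coef p K : F2 := to_poly p K.
Definition mon K : ext n := of_poly [ffun L => (L == K)%:R].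

Lemma coefP p q : coef p =1 coef q -> p = q.
Proof. by move=> pq; apply: (can_inj to_polyK); apply/ffunP. Qed.

Lemma coefD p q K : coef (p + q) K = coef p K + coef q K.
Proof. by rewrite /coef linearD ffunE. Qed.

Lemma coefZ a p K : coef (a *: p) K = a * coef p K.
Proof. by rewrite /coef linearZ /= ffunE. Qed.

Lemma coef_mon K L : coef (mon K) L = (L == K)%:R.
Proof. by rewrite /coef of_polyK ffunE. Qed.

Lemma coef_sum (I : Type) (r : seq I) (P : pred I) (F : I -> ext n) K :
  coef (\sum_(i <- r | P i) F i) K = \sum_(i <- r | P i) coef (F i) K.
Proof.
apply: (big_morph (fun p => coef p K)) => [p q|]; first exact: coefD.
by rewrite -(scale0r 0) coefZ mul0r.
Qed.

Definition lin (E : lmodType F2) (F : {set 'I_n} -> E) p : E :=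
  \sum_K coef p K *: F K.

Lemma lin_is_linear E F : linear (@lin E F).
Proof.
move=> a p q; rewrite /lin scaler_sumr -big_split; apply: eq_bigr => K _ /=.
by rewrite coefD coefZ scalerDl scalerA.
Qed.
HB.instance Definition _ (E : lmodType F2) (F : {set 'I_n} -> E) :=
  GRing.isLinear.Build F2 (ext n) E _ (@lin E F) (@lin_is_linear E F).

Lemma lin_mon E F K : @lin E F (mon K) = F K.
Proof.
rewrite /lin (bigD1 K) //= coef_mon eqxx scale1r big1 ?addr0 // => L LK.
by rewrite coef_mon (negPf LK) scale0r.
Qed.

Lemma monE p : p = \sum_K coef p K *: mon K.
Proof.
apply: coefP => L; rewrite coef_sum (bigD1 L) //= coefZ coef_mon eqxx mulr1.
rewrite big1 ?addr0 // => K /negPf KL.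
by rewrite coefZ coef_mon eq_sym KL mulr0.
Qed.

Lemma eq_on_mon (E : lmodType F2) (f g : {linear ext n -> E}) :
  (forall K, f (mon K) = g (mon K)) -> f =1 g.
Proof.
move=> fg p; rewrite [p]monE !linear_sum; apply: eq_bigr => K _.
by rewrite !linearZ /= fg.
Qed.

Definition wg i : ext n -> ext n :=
  lin (fun K => if i \in K then 0 else mon (i |: K)).
HB.instance Definition _ i := GRing.Linear.on (wg i).

Lemma wg_mon i K : wg i (mon K) = if i \in K then 0 else mon (i |: K).
Proof. exact: lin_mon. Qed.

Lemma wg_poly i p : to_poly (wg i p) = wedge (gen i) (to_poly p).
Proof.
move: p; pose f := [the {linear ext n -> extpoly n} of to_poly \o wg i].
pose g := [the {linear ext n -> extpoly n} of wedge (gen i) \o to_poly].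
apply: (@eq_on_mon _ f g) => K; rewrite /f /g /= wg_mon.
apply/ffunP => L; rewrite wedge_genE.
rewrite -[to_poly (mon K) _]/(coef _ _) coef_mon.
case: (boolP (i \in K)) => iK.
  rewrite linear0 ffunE; case: ifP => // _; case: eqP => // LK.
  by rewrite -LK setD11 in iK.
rewrite -[to_poly _ _]/(coef _ _) coef_mon.
case: (boolP (i \in L)) => iL.
  congr (nat_of_bool _)%:R; apply/eqP/eqP => [->|<-]; last by rewrite setD1K.
  by rewrite setU1K.
by case: eqP => // LK; rewrite LK setU11 in iL.
Qed.

Lemma wg2 i p : wg i (wg i p) = 0.
Proof.
by apply: (can_inj to_polyK); rewrite !wg_poly wedge_gen2 linear0.
Qed.

Lemma wgC i j p : wg i (wg j p) = wg j (wg i p).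
Proof. by apply: (can_inj to_polyK); rewrite !wg_poly wedge_genC. Qed.

Definition cg i : ext n -> ext n :=
  lin (fun K => if i \in K then mon (K :\ i) else 0).
HB.instance Definition _ i := GRing.Linear.on (cg i).

Lemma cg_mon i K : cg i (mon K) = if i \in K then mon (K :\ i) else 0.
Proof. exact: lin_mon. Qed.

Lemma cg2 i p : cg i (cg i p) = 0.
Proof.
move: p; apply: (@eq_on_mon _ (cg i \o cg i) \0) => K /=.
by rewrite cg_mon; case: ifP => iK; rewrite ?linear0 // cg_mon setD11.
Qed.

Lemma cgC i j p : cg i (cg j p) = cg j (cg i p).
Proof.
move: p; apply: (@eq_on_mon _ (cg i \o cg j) (cg j \o cg i)) => K /=.
rewrite !cg_mon; have [-> //|ij] := eqVneq i j.
case: (boolP (i \in K)) => iK; case: (boolP (j \in K)) => jK;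
  rewrite ?linear0 // !cg_mon !in_setD1 ?iK ?jK ?(negPf iK) ?(negPf jK)
          ?andbF // ij eq_sym ij.
by congr mon; rewrite !setDDl setUC.
Qed.

Lemma cg_wg i j p : cg i (wg j p) = (i == j)%:R *: p + wg j (cg i p).
Proof.
move: p; apply: (@eq_on_mon _ (cg i \o wg j)
  (GRing.add_fun ((i == j)%:R \*: idfun) (wg j \o cg i))) => K /=.
rewrite wg_mon cg_mon; have [->|ij] := eqVneq i j.
  case: (boolP (j \in K)) => jK; rewrite !linear0 ?scale1r ?addr0.
    by rewrite wg_mon setD11 setD1K // addxx.
  by rewrite cg_mon setU11 setU1K.
rewrite scale0r add0r.
case: (boolP (i \in K)) => iK; case: (boolP (j \in K)) => jK;
  rewrite ?linear0 // ?wg_mon ?cg_mon ?in_setD1 ?in_setU1 ?iK ?jK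
     ?(negPf iK) ?(negPf jK) ?(negPf ij) ?[j == i]eq_sym ?(negPf ij) ?andbF //=.
congr mon; apply/setP => k; rewrite !inE.
by case: (eqVneq k i) => [->|_] //=; rewrite (negPf ij).
Qed.

Lemma ext_ind (P : ext n -> Prop) :
  P 0 -> P (mon set0) -> (forall p q, P p -> P q -> P (p + q)) ->
  (forall i p, P p -> P (wg i p)) -> forall p, P p.
Proof.
move=> P0 P1 PD PW p; rewrite [p]monE; apply: (big_ind P) => // K _.
have [->|->] := F2P (coef p K); rewrite ?scale0r ?scale1r //.
elim: {K}#|K| {-2}K (erefl #|K|) => [|k IH] K Kk.
  by move/eqP: Kk; rewrite cards_eq0 => /eqP ->.
have /card_gt0P[i iK] : (0 < #|K|)%N by rewrite Kk.
have := PW i _ (IH (K :\ i) _); rewrite wg_mon setD11 setD1K //.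
by apply; have := cardsD1 i K; rewrite iK Kk => -[].
Qed.

(* wd is the wedge product by a vector, ct the contraction by a covector. *)
Definition wd v p : ext n := \sum_i v 0 i *: wg i p.
Definition ct v p : ext n := \sum_i v 0 i *: cg i p.
Definition pair (f v : 'rV[F2]_n) : F2 := \sum_i f 0 i * v 0 i.

Lemma wd_is_linear v : linear (wd v).
Proof.
move=> a p q; rewrite /wd scaler_sumr -big_split; apply: eq_bigr => i _ /=.
by rewrite linearP scalerDr !scalerA mulrC.
Qed.
HB.instance Definition _ v :=
  GRing.isLinear.Build F2 (ext n) (ext n) _ (wd v) (wd_is_linear v).

Lemma ct_is_linear v : linear (ct v).
Proof.
move=> a p q; rewrite /ct scaler_sumr -big_split; apply: eq_bigr => i _ /=.
by rewrite linearP scalerDr !scalerA mulrC.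
Qed.
HB.instance Definition _ v :=
  GRing.isLinear.Build F2 (ext n) (ext n) _ (ct v) (ct_is_linear v).

Lemma wdD u v p : wd (u + v) p = wd u p + wd v p.
Proof. by rewrite /wd -big_split; apply: eq_bigr => i _; rewrite mxE scalerDl. Qed.

Lemma wdZ a v p : wd (a *: v) p = a *: wd v p.
Proof. by rewrite /wd scaler_sumr; apply: eq_bigr => i _; rewrite mxE scalerA. Qed.

Lemma wd0 p : wd 0 p = 0.
Proof. by rewrite -(scale0r 0) wdZ scale0r. Qed.

Lemma wd_gen i p : wd (delta_mx 0 i) p = wg i p.
Proof.
rewrite /wd (bigD1 i) //= mxE !eqxx scale1r big1 ?addr0 // => j /negPf ji.
by rewrite mxE ji andbF scale0r.
Qed.

Lemma wd_poly v p : to_poly (wd v p) = wedge (linform v) (to_poly p).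
Proof.
rewrite wedge_linform linear_sum; apply: eq_bigr => i _.
by rewrite linearZ /= wg_poly.
Qed.

Lemma sum_comp (F H : 'I_n -> {linear ext n -> ext n}) (u v : 'rV[F2]_n) p :
  \sum_i u 0 i *: F i (\sum_j v 0 j *: H j p) =
  \sum_i \sum_j (u 0 i * v 0 j) *: F i (H j p).
Proof.
apply: eq_bigr => i _; rewrite linear_sum scaler_sumr.
by apply: eq_bigr => j _; rewrite linearZ scalerA.
Qed.

Lemma wdC u v p : wd u (wd v p) = wd v (wd u p).
Proof.
rewrite /wd (sum_comp (fun i => wg i) (fun i => wg i)).
rewrite (sum_comp (fun i => wg i) (fun i => wg i)) exchange_big /=.
by apply: eq_bigr => i _; apply: eq_bigr => j _; rewrite mulrC wgC.
Qed.

Lemma wd2 v p : wd v (wd v p) = 0.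
Proof.
rewrite /wd (sum_comp (fun i => wg i) (fun i => wg i)).
apply: sum_sym_F2 => [i|i j]; first by rewrite /= wg2 scaler0.
by rewrite mulrC /= wgC.
Qed.

Lemma ct2 v p : ct v (ct v p) = 0.
Proof.
rewrite /ct (sum_comp (fun i => cg i) (fun i => cg i)).
apply: sum_sym_F2 => [i|i j]; first by rewrite /= cg2 scaler0.
by rewrite mulrC /= cgC.
Qed.

(** The Clifford relation, without signs in characteristic 2. When [pair f v = 1] it makes
    contraction by f a contracting homotopy for multiplication by v. *)
Lemma ct_wd f v p : ct f (wd v p) = pair f v *: p + wd v (ct f p).
Proof.
rewrite /ct /wd /pair.
rewrite (sum_comp (fun i => cg i) (fun i => wg i)).
under eq_bigr do under eq_bigr do rewrite /= cg_wg scalerDr scalerA.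
under eq_bigr do rewrite big_split /=.
rewrite big_split /=; congr (_ + _).
  rewrite scaler_suml; apply: eq_bigr => i _.
  rewrite (bigD1 i) //= eqxx mulr1 big1 ?addr0 // => j.
  by rewrite eq_sym => /negPf ->; rewrite mulr0 scale0r.
rewrite exchange_big /=; apply: eq_bigr => j _; rewrite (linear_sum (wg j)) scaler_sumr.
by apply: eq_bigr => i _; rewrite linearZ /= scalerA mulrC.
Qed.

Lemma pairD f u v : pair f (u + v) = pair f u + pair f v.
Proof. by rewrite -big_split; apply: eq_bigr => i _; rewrite mxE mulrDr. Qed.

Lemma pairZ f a v : pair f (a *: v) = a * pair f v.
Proof. by rewrite mulr_sumr; apply: eq_bigr => i _; rewrite mxE mulrCA. Qed.

Lemma pair0 f : pair f 0 = 0.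
Proof. by rewrite -(scale0r 0) pairZ mul0r. Qed.

Lemma pair_sum f (I : Type) (r : seq I) (P : pred I) (F : I -> 'rV[F2]_n) :
  pair f (\sum_(i <- r | P i) F i) = \sum_(i <- r | P i) pair f (F i).
Proof. exact: (big_morph _ (pairD f) (pair0 f)). Qed.

Lemma pair_delta f i : pair f (delta_mx 0 i) = f 0 i.
Proof.
rewrite /pair (bigD1 i) //= mxE !eqxx mulr1 big1 ?addr0 // => j /negPf ji.
by rewrite mxE ji andbF mulr0.
Qed.

End Exterior.

Arguments of_poly {n}.
Arguments to_poly {n}.

Section ExteriorMap.
Variables (n m : nat) (A : 'M[F2]_(n, m)).

(* The algebra morphism sending the i-th generator to the i-th row of A. *)
Definition Lam : ext n -> ext m :=
  lin (fun K => foldr (fun i q => wd (row i A) q) (mon set0) (enum K)).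
HB.instance Definition _ := GRing.Linear.on Lam.

Let W (s : seq 'I_n) := foldr (fun i q => wd (row i A) q) (mon set0) s.

(** Needed because [enum (i |: K)] does not list i first; the factors commute. *)
Let W_perm s t : perm_eq s t -> W s = W t.
Proof.
have Wrem i u : i \in u -> W u = wd (row i A) (W (rem i u)).
  elim: u => //= j u IH; rewrite inE; case: eqVneq => [-> //|_] /= iu.
  by rewrite IH // wdC.
elim: s t => [|i s IH] t st; first by move: st; rewrite perm_sym => /perm_nilP ->.
have it : i \in t by rewrite -(perm_mem st) mem_head.
rewrite [RHS](Wrem i) //= (IH (rem i t)) //.
by rewrite -(perm_cons i) (perm_trans st) // perm_to_rem.
Qed.

Lemma Lam1 : Lam (mon set0) = mon set0.
Proof. by rewrite /Lam lin_mon enum_set0. Qed.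

Lemma Lam_wg i p : Lam (wg i p) = wd (row i A) (Lam p).
Proof.
move: p; apply: (@eq_on_mon _ _ (Lam \o wg i) (wd (row i A) \o Lam)) => K /=.
rewrite wg_mon /Lam lin_mon -/(W _).
have Wcons (L : {set 'I_n}) : i \notin L ->
    W (enum (i |: L)) = wd (row i A) (W (enum L)).
  move=> iL; apply: (W_perm (t := i :: enum L)); apply: uniq_perm.
  - exact: enum_uniq.
  - by rewrite /= mem_enum iL enum_uniq.
  by move=> j; rewrite inE !mem_enum in_setU1.
case: (boolP (i \in K)) => iK; last by rewrite lin_mon -/(W _) Wcons.
by rewrite linear0 -(setD1K iK) Wcons ?setD11 // wd2.
Qed.

Lemma Lam_wd v p : Lam (wd v p) = wd (v *m A) (Lam p).
Proof.
rewrite mulmx_sum_row /wd linear_sum /=.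
have -> : \sum_i (\sum_j v 0 j *: row j A) 0 i *: wg i (Lam p) =
    wd (\sum_j v 0 j *: row j A) (Lam p) by [].
rewrite (big_morph (fun u => wd u (Lam p)) (id1 := 0) (op1 := +%R)).
- by apply: eq_bigr => i _; rewrite linearZ /= Lam_wg wdZ.
- by move=> u u'; rewrite wdD.
by rewrite wd0.
Qed.

End ExteriorMap.

Lemma Lam_unique n m (A : 'M[F2]_(n, m)) (f : {linear ext n -> ext m}) :
  f (mon set0) = mon set0 -> (forall i p, f (wg i p) = wd (row i A) (f p)) ->
  f =1 Lam A.
Proof.
move=> f1 fw; elim/ext_ind => [||p q fp fq|i p fp].
- by rewrite !linear0.
- by rewrite f1 Lam1.
- by rewrite !linearD fp fq.
- by rewrite fw Lam_wg fp.
Qed.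

Lemma Lam_id n (p : ext n) : Lam 1%:M p = p.
Proof.
rewrite -(@Lam_unique _ _ 1%:M idfun) // => i {}p /=.
by rewrite rowE mulmx1 wd_gen.
Qed.

Lemma Lam_comp n m l (A : 'M[F2]_(n, m)) (B : 'M[F2]_(m, l)) p :
  Lam B (Lam A p) = Lam (A *m B) p.
Proof.
rewrite -(@Lam_unique _ _ _ (Lam B \o Lam A)) //= ?Lam1 // => i {}p.
by rewrite Lam_wg Lam_wd row_mul.
Qed.

Lemma ct_mon0 n (f : 'rV[F2]_n) : ct f (mon set0) = 0.
Proof. by rewrite /ct big1 // => i _; rewrite cg_mon inE scaler0. Qed.

(* The projection along v onto the kernel of f, provided pair f v = 1. *)
Definition projmx n (f v : 'rV[F2]_n) : 'M[F2]_n := 1%:M + f^T *m v.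

Lemma projmxE n (f v u : 'rV[F2]_n) : u *m projmx f v = u + pair f u *: v.
Proof.
rewrite mulmxDr mulmx1 mulmxA; congr (_ + _).
have -> : u *m f^T = (pair f u)%:M; last by rewrite mul_scalar_mx.
apply/rowP => i; rewrite !mxE ord1 eqxx mulr1n.
by apply: eq_bigr => j _; rewrite mxE mulrC.
Qed.

(** The composite fixes 1 and turns multiplication by a generator into multiplication by its
    projection, so it is an algebra morphism. This lets zigzags be handled as substitutions. *)
Lemma ct_wd_Lam n (f v : 'rV[F2]_n) p : pair f v = 1 ->
  ct f (wd v p) = Lam (projmx f v) p.
Proof.
move=> fv; apply: (@Lam_unique _ _ _ (ct f \o wd v)) => [|i {}p] /=.
  by rewrite ct_wd fv scale1r ct_mon0 linear0 addr0.
rewrite -wd_gen rowE projmxE wdD wdZ wdC ct_wd addrC; congr (_ + _).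
by rewrite [ct f (wd v p)]ct_wd fv scale1r (linearD (wd v)) /= wd2 addr0.
Qed.

Lemma wgE n (i : 'I_n) p : wg i p = wd (xgen i) p.
Proof. by rewrite wd_gen. Qed.

(** * Contractions and homology *)

Section HomologyClass.
Variables (K : fieldType) (C : vectType K) (d : 'End(C)).

Definition hclass (x : C) : homology d := quo (boundaries d) (vsproj (lker d) x).

Lemma hclass_linear : linear hclass.
Proof. by move=> a x y; rewrite /hclass !linearP. Qed.
HB.instance Definition _ :=
  GRing.isLinear.Build K C (homology d) _ hclass hclass_linear.

Lemma hclass_eq0 x : d x = 0 -> (hclass x == 0) = (x \in limg d).
Proof.
move=> dx; have xd : x \in lker d by rewrite memv_ker dx.
by rewrite quo_eq0 -memv_preim lfunE /= vsprojK.
Qed.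

Lemma hclassP q : exists2 x, d x = 0 & q = hclass x.
Proof.
exists (vsval (quo_repr q)).
  by apply/eqP; rewrite -memv_ker subvsP.
by rewrite /hclass vsvalK quo_reprK.
Qed.

End HomologyClass.

Lemma homology_iso (K : fieldType) (C D : vectType K) (c : 'End(C)) (d : 'End(D))
    (f : {linear C -> D}) :
  (forall x, f (c x) = d (f x)) ->
  (forall y, d y = 0 -> exists x b, c x = 0 /\ y = f x + d b) ->
  (forall x b, c x = 0 -> f x = d b -> exists a, x = c a) ->
  exists phi : {linear homology c -> homology d}, bijective phi.
Proof.
move=> fc f_surj f_inj.
(* [g] uses an arbitrary representative cycle; [gE] shows that the choice is immaterial. *)
pose g (q : homology c) := hclass d (f (vsval (quo_repr q))).
have gE x : c x = 0 -> g (hclass c x) = hclass d (f x).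
  move=> cx; set q := hclass c x; pose x' := vsval (quo_repr q).
  have cx' : c x' = 0 by apply/eqP; rewrite -memv_ker subvsP.
  have : hclass c (x' - x) == 0.
    by rewrite linearB subr_eq0 /= {1}/hclass vsvalK quo_reprK.
  rewrite hclass_eq0; last by rewrite linearB /= cx cx' subr0.
  case/memv_imgP => a _ x'x; apply/eqP; rewrite -subr_eq0 -!linearB /=.
  rewrite hclass_eq0; first by rewrite x'x fc memv_img ?memvf.
  by rewrite -fc linearB /= cx cx' subr0 linear0.
have g_lin : linear g.
  move=> a p q; have [x cx ->] := hclassP p; have [y cy ->] := hclassP q.
  have cxy : c (a *: x + y) = 0 by rewrite linearP /= cx cy scaler0 addr0.
  by rewrite -(linearP (hclass c)) !gE // !linearP.
pose phi : {linear homology c -> homology d} := HB.pack g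
  (GRing.isLinear.Build K (homology c) (homology d) _ g g_lin).
have phiE q : phi q = g q by [].
have phi_inj : lker (linfun phi) == 0%VS.
  rewrite -subv0; apply/subvP => q; rewrite memv_ker lfunE /= memv0.
  have [x cx ->] := hclassP q; rewrite gE //.
  rewrite hclass_eq0; last by rewrite -fc cx linear0.
  case/memv_imgP => b _ /(f_inj _ _ cx) [a xa].
  by rewrite hclass_eq0 // xa memv_img ?memvf.
exists phi; exists (fun y => (linfun phi)^-1%VF y) => [p|y].
  by have := lker0_lfunK phi_inj p; rewrite lfunE.
have [z dz ->] := hclassP y; have [x [b [cx zE]]] := f_surj z dz.
have -> : hclass d z = phi (hclass c x).
  rewrite phiE gE // zE linearD /=.
  have /eqP -> : hclass d (d b) == 0.
    rewrite hclass_eq0 ?memv_img ?memvf //.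
    by have := dz; rewrite zE linearD /= -fc cx linear0 add0r.
  by rewrite addr0.
by have := lker0_lfunK phi_inj (hclass c x); rewrite lfunE => ->.
Qed.

(* h contracts the complement of im E in the complex (C, d): the complex is
   homotopy equivalent to {x | h x = h (d x) = 0}, on which E is injective. *)
Record contraction (C : vectType F2) (d h E : {linear C -> C}) : Prop :=
  Contraction {
    ctn_dd : forall x, d (d x) = 0;
    ctn_hh : forall x, h (h x) = 0;
    ctn_hdh : forall x, h (d (h x)) = h x;
    ctn_hE : forall x, h (E x) = 0;
    ctn_Eh : forall x, E (h x) = 0;
    ctn_EE : forall x, E (E x) = E x;
    ctn_ker : forall x, h x = 0 -> h (d x) = 0 -> x = E x + h (d (E x))
  }.

Section Reduction.
Variables (C D : vectType F2).
Variables (c h E : {linear C -> C}) (d k F : {linear D -> D}).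
Hypotheses (Cc : contraction c h E) (Cd : contraction d k F).
Variable f : {linear C -> D}.
Hypotheses (fE : forall x, F (f (E x)) = f (E x))
  (f_inj : forall x, f (E x) = 0 -> E x = 0)
  (f_surj : forall y, exists x, F y = f (E x))
  (fd : forall x, F (d (f (E x) + k (d (f (E x))))) =
                  f (E (c (E x + h (c (E x)))))).

(** E and F are not chain maps. The differential transported to the image of E sends e to
    [E (c (e + h (c e)))], where the correction collects the zigzags through the cancelled part;
    [fd] says that f intertwines these transported differentials. *)
Lemma reduction_iso :
  exists phi : {linear homology (linfun c) -> homology (linfun d)},
    bijective phi.
Proof.
case: Cc Cd => cc hh hch hE Eh EE Ck [dd kk kdk kF Fk FF Dk].
(* [pi] is homotopic to the identity and projects onto the subcomplex where h and h after c vanish;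
   [rho] lifts the image of F back into the analogous subcomplex of D. *)
pose pi x := x + c (h x) + h (c x).
pose rho y := F y + k (d (F y)).
pose g x := f (E (pi x)).
have hpi x : h (pi x) = 0.
  by rewrite /pi !linearD hh addr0 hch addxx.
have cpi x : c (pi x) = pi (c x).
  by rewrite /pi !linearD cc addr0 /= cc !linear0 addr0.
have hcpi x : h (c (pi x)) = 0 by rewrite cpi.
have piE x : pi x = E (pi x) + h (c (E (pi x))) by apply: Ck.
have krho y : k (rho y) = 0 by rewrite /rho linearD kF kk addr0.
have kdrho y : k (d (rho y)) = 0.
  by rewrite /rho !linearD /= kdk addxx.
have Frho y : F (rho y) = F y by rewrite /rho linearD FF Fk addr0.
have Fg x : F (g x) = g x by apply: fE.
have piD x y : pi (x + y) = pi x + pi y.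
  by rewrite /pi !linearD /= [RHS]addrACA; congr (_ + _); rewrite addrACA.
have rhoD x y : rho (x + y) = rho x + rho y.
  by rewrite /rho !linearD /= addrACA.
have g_lin : linear (rho \o g).
  by apply: F2_linear => x y; rewrite /g /= piD !linearD rhoD.
pose H : {linear C -> D} := HB.pack (rho \o g)
  (GRing.isLinear.Build F2 C D _ (rho \o g) g_lin).
have FD x y : k x = 0 -> k (d x) = 0 -> k y = 0 -> k (d y) = 0 -> F x = F y ->
    x = y.
  by move=> kx kdx ky kdy xy; rewrite (Dk x) // (Dk y) // xy.
have H_chain x : H (c x) = d (H x).
  apply: FD => //=; rewrite ?dd ?linear0 ?kdrho //.
  rewrite Frho Fg /g -cpi {1}piE -fd /= /rho !Fg.
  by [].
have f_inj' x : h x = 0 -> h (c x) = 0 -> f (E x) = 0 -> x = 0.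
  by move=> hx hcx /f_inj Ex0; rewrite (Ck x) // Ex0 !linear0 addr0.
have EE' x : h x = 0 -> h (c x) = 0 -> pi x = x.
  by move=> hx hcx; rewrite /pi hx hcx linear0 !addr0.
have H_pi x : h x = 0 -> h (c x) = 0 -> H x = rho (f (E x)).
  by move=> hx hcx; rewrite /H /= /g EE'.
have H_inj x : h x = 0 -> h (c x) = 0 -> H x = 0 -> x = 0.
  move=> hx hcx Hx; apply: f_inj' => //.
  by rewrite -fE -Frho -H_pi // Hx linear0.
have H_surj y : k y = 0 -> k (d y) = 0 ->
    exists x, [/\ h x = 0, h (c x) = 0 & H x = y].
  move=> ky kdy; have [x yx] := f_surj y; pose x' := E x + h (c (E x)).
  have hx' : h x' = 0 by rewrite /x' linearD hE hh addr0.
  have hcx' : h (c x') = 0 by rewrite /x' !linearD /= hch addxx.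
  exists x'; split=> //; rewrite H_pi // /x' linearD EE Eh addr0 -yx.
  by rewrite /rho FF -Dk.
apply: (homology_iso (f := H)) => [x|y|x b]; rewrite !lfunE /=.
- exact: H_chain.
(* A homologous cycle that k kills, hence one lying in the reduced subcomplex. *)
- move=> dy; pose y' := y + d (k y).
  have ky' : k y' = 0 by rewrite /y' linearD kdk addxx.
  have dy' : d y' = 0 by rewrite /y' linearD dy dd addr0.
  have [|x [hx hcx Hx]] := H_surj y' ky'; first by rewrite dy' linear0.
  exists x, (k y); rewrite !lfunE /=; split; last first.
    by rewrite -[rho _]/(H x) Hx /y' -addrA addxx addr0.
  by apply: H_inj; rewrite ?H_chain ?Hx // cc linear0.
move=> cx; rewrite -[rho _]/(H x) => Hx.
have hpc : h (c (pi x)) = 0 by rewrite hcpi.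
have Hpi : H (pi x) = H x by rewrite /H /= /g EE'.
have kdb : k (d b) = 0 by rewrite -Hx /H /= krho.
(* The same boundary as b, from an element in the reach of [H_surj]. *)
pose b' := b + d (k b).
have kb' : k b' = 0 by rewrite /b' linearD kdk addxx.
have db' : d b' = d b by rewrite /b' linearD dd addr0.
have [|x' [hx' hcx' Hx']] := H_surj b' kb'; first by rewrite db'.
have xE : pi x = c x'.
  apply/eqP; rewrite -addx_eq0; apply/eqP; apply: H_inj.
  - by rewrite linearD hcx' hpi addr0.
  - by rewrite (linearD c) linearD hpc /= cc linear0 addr0.
  by rewrite linearD Hpi H_chain Hx' db' Hx addxx.
exists (x' + h x); rewrite lfunE /= linearD -xE /pi cx linear0 addr0.
by rewrite -addrA addxx addr0.
Qed.
End Reduction.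

(** * The complex on representatives *)

Section Ideal.
Variables (n : nat) (G : lgraph n).
Implicit Types (s t : {set 'I_n}) (i j : 'I_n) (p q : ext n).

(* inJ s p: the polynomial p vanishes in the exterior algebra of V(s). *)
Definition inJ : {set 'I_n} -> ext n -> bool :=
  locked_with relideal_key (fun s p => to_poly p \in relideal G s).
Lemma inJE s p : inJ s p = (to_poly p \in relideal G s).
Proof. by rewrite /inJ unlock. Qed.

Lemma inJ0 s : inJ s 0.
Proof. by rewrite !inJE linear0 mem0v. Qed.

Lemma inJD s p q : inJ s p -> inJ s q -> inJ s (p + q).
Proof. by rewrite !inJE linearD; apply: memvD. Qed.

Lemma inJDl s p q : inJ s p -> inJ s (p + q) = inJ s q.
Proof.
move=> sp; apply/idP/idP => [|sq]; last exact: inJD.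
by move=> /(inJD sp); rewrite addxK.
Qed.

Lemma inJ_sum s (I : Type) (r : seq I) (P : pred I) (F : I -> ext n) :
  (forall k, P k -> inJ s (F k)) -> inJ s (\sum_(i <- r | P i) F i).
Proof.
by move=> sF; apply: (big_ind (inJ s)) => //; [apply: inJ0|apply: inJD].
Qed.

Lemma inJ_wd s v p : v \in relspace G s -> inJ s (wd v p).
Proof. by move=> sv; rewrite !inJE wd_poly wedge_relspace_in. Qed.

Lemma inJ_ind s (P : ext n -> Prop) : P 0 ->
  (forall p q, P p -> P q -> P (p + q)) ->
  (forall v q, v \in relspace G s -> P (wd v q)) ->
  forall p, inJ s p -> P p.
Proof.
move=> P0 PD PW p sp; rewrite -[p]to_polyK; move: sp; rewrite !inJE.
elim/relideal_ind => {p} [|p q|j q]; first by rewrite linear0.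
  by rewrite linearD; apply: PD.
have -> : of_poly (wedge (linform (relation G s j)) q) =
    wd (relation G s j) (of_poly q).
  by apply: (can_inj (@to_polyK n)); rewrite wd_poly !of_polyK.
by apply: PW; apply/memv_span/map_f; rewrite mem_enum.
Qed.

Lemma inJ_wdr s v p : inJ s p -> inJ s (wd v p).
Proof.
elim/inJ_ind => {p} [|p q|u q su]; rewrite ?linear0 ?linearD ?inJ0 //.
  exact: inJD.
by rewrite wdC inJ_wd.
Qed.

(** By the Clifford relation, contraction by f commutes with multiplication by vectors that f
    annihilates, so it descends to the exterior algebra of V(s). *)
Lemma inJ_ct s f p : (forall v, v \in relspace G s -> pair f v = 0) ->
  inJ s p -> inJ s (ct f p).
Proof.
move=> sf; elim/inJ_ind => {p} [|p q|u q su]; rewrite ?linear0 ?linearD ?inJ0 //.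
  exact: inJD.
by rewrite ct_wd sf // scale0r add0r inJ_wd.
Qed.

Definition xz s i := xgen i \in relspace G s.

Lemma xzeroE s i : xzero G s i = xz s i.
Proof. by rewrite /xzero quo_eq0. Qed.

(** Each defining relation changes only by a multiple of x_i when i is flipped. *)
Lemma relspace_flip s i v : v \in relspace G s ->
  exists a : F2, v + a *: xgen i \in relspace G (flip s i).
Proof.
move=> sv; suff /subvP/(_ v sv)/memv_addP[u su [w]] :
    (relspace G s <= relspace G (flip s i) + <[xgen i]>)%VS.
  by case/vlineP => a -> ->; exists a; rewrite -addrA addxx addr0.
apply/span_subvP => _ /mapP[j _ ->].
have [a ->] := relation_flip G s i j.
rewrite memv_add ?memvZ ?memv_line //.
by apply/memv_span/map_f; rewrite mem_enum.
Qed.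

Lemma xz_flip s i : ~~ xz s i -> xz (flip s i) i.
Proof. by rewrite -xzeroE; apply: xgen_flip. Qed.

Lemma in_flip s i j : (j \in flip s i) = (j == i) (+) (j \in s).
Proof.
rewrite /flip; case: (boolP (i \in s)) => si; rewrite !inE.
  by case: eqVneq => [->|_] //=; rewrite si.
by case: eqVneq => [->|_] //=; rewrite (negPf si).
Qed.

Lemma flipK s i : flip (flip s i) i = s.
Proof. by apply/setP => k; rewrite !in_flip addKb. Qed.

Lemma flipC s i j : flip (flip s i) j = flip (flip s j) i.
Proof. by apply/setP => k; rewrite !in_flip addbCA. Qed.

Lemma relspace_flip_xz s i v : xz (flip s i) i ->
  v \in relspace G s -> v \in relspace G (flip s i).
Proof.
move=> tz /(relspace_flip i) [a ta].
by rewrite -(addr0 v) -(addxx (a *: xgen i)) addrA memvD // memvZ.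
Qed.

Definition ed s i p := if xz s i then wg i p else p.

Lemma ed_is_linear s i : linear (ed s i).
Proof. by move=> a p q; rewrite /ed; case: ifP; rewrite ?linearP. Qed.
HB.instance Definition _ s i :=
  GRing.isLinear.Build F2 (ext n) (ext n) _ (ed s i) (ed_is_linear s i).

Lemma inJ_ed s i p : inJ s p -> inJ (flip s i) (ed s i p).
Proof.
rewrite !inJE => /(@relideal_flip _ G s i); rewrite /ed xzeroE.
by case: ifP; rewrite ?wg_poly.
Qed.

(* The arrow joining s and flip s i points to s. *)
Definition on s i : bool := (i \in s) (+) sgn G i.

Lemma on_flip s i j : on (flip s i) j = (j == i) (+) on s j.
Proof. by rewrite /on in_flip addbA. Qed.

Lemma arrow_on s i : arrow G s i = ~~ on s i.
Proof. by rewrite /arrow /on; case: (i \in s); rewrite /= ?negbK. Qed.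

(** The differential on representatives, sorted by target: the arrows into t are those along the i
    that are on. *)
Definition dP (x : {set 'I_n} -> ext n) t : ext n :=
  \sum_(i | on t i) ed (flip t i) i (x (flip t i)).

Definition kcls (x : {set 'I_n} -> ext n) : khC G :=
  dsum_of (fun s => quo (relideal G s) (to_poly (x s)) : extV G s).

Definition krep (c : khC G) s : ext n := of_poly (quo_repr (dsum_fun c s)).

Lemma krepK c : kcls (krep c) = c.
Proof.
by apply/dsumP => s; rewrite dsumE /krep of_polyK quo_reprK.
Qed.

Lemma kclsD x y : kcls (fun s => x s + y s) = kcls x + kcls y.
Proof. by apply/dsumP => s; rewrite dsumDE !dsumE !linearD. Qed.

Lemma kcls_eq0 x : (forall s, inJ s (x s)) <-> kcls x = 0.
Proof.
split=> [sp|].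
  apply/dsumP => s; rewrite dsumE (_ : dsum_fun 0 s = 0).
    by apply/eqP; rewrite quo_eq0 -inJE; apply: sp.
  by rewrite -[0 in LHS](scale0r 0) dsumZE scale0r.
move=> /dsumP x0 s; have := x0 s; rewrite dsumE (_ : dsum_fun 0 s = 0).
  by move/eqP; rewrite quo_eq0 -inJE.
by rewrite -[0 in LHS](scale0r 0) dsumZE scale0r.
Qed.

Lemma khd_kcls x : khd (kcls x) = kcls (dP x).
Proof.
apply/dsumP => t; rewrite !dsumE (exchange_big_dep xpredT) //=.
rewrite /dP !linear_sum /= [RHS]big_mkcond /=; apply: eq_bigr => i _.
case: ifP => ti.
  rewrite (bigD1 (flip t i)) ?arrow_on ?on_flip ?eqxx ?flipK ?eqxx ?ti //=.
  rewrite big1 ?addr0 => [|s /andP[/andP[_ /eqP <-]]]; last by rewrite flipK eqxx.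
  have := edgeE G (flip t i) i (to_poly (x (flip t i))); rewrite flipK dsumE => ->.
  by rewrite xzeroE /ed; case: ifP; rewrite ?wg_poly.
rewrite big1 // => s /andP[sa /eqP st]; move: sa ti.
by rewrite arrow_on -st on_flip eqxx; case: (on s i).
Qed.

Lemma big_on_pair t (F : 'I_n -> 'I_n -> ext n) :
  \sum_(i | on t i) \sum_(j | on (flip t i) j) F i j =
  \sum_i \sum_j if [&& on t i, on t j & i != j] then F i j else 0.
Proof.
rewrite big_mkcond; apply: eq_bigr => i _; case: (boolP (on t i)) => ti /=.
  rewrite big_mkcond; apply: eq_bigr => j _; rewrite on_flip eq_sym.
  by case: (eqVneq j i) => [->|_]; rewrite ?ti //= andbT.
by rewrite big1.
Qed.

Lemma relspace_flipP s i v : v \in relspace G s ->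
  (v \in relspace G (flip s i)) || (v + xgen i \in relspace G (flip s i)).
Proof.
move=> /(relspace_flip i) [a].
by have [->|->] := F2P a; rewrite ?scale0r ?addr0 ?scale1r => ->; rewrite ?orbT.
Qed.

Lemma relspaceDl s u v : u \in relspace G s ->
  (u + v \in relspace G s) = (v \in relspace G s).
Proof.
move=> su; apply/idP/idP => [|sv]; last exact: memvD.
by move=> /(memvD su); rewrite addxK.
Qed.

(** The cases are whether x_i and x_j vanish along the square. If the two composites are not
    literally equal, their sum is built from multiples of vectors that are zero at the opposite
    corner u. *)
Lemma ed_square s i j (p : ext n) : i != j ->
  inJ (flip (flip s i) j) (ed (flip s i) j (ed s i p) + ed (flip s j) i (ed s j p)).
Proof.
move=> ij; pose si := flip s i; pose sj := flip s j; pose u := flip si j.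
rewrite -/si -/sj -/u.
have ju : flip sj i = u by rewrite /u /si /sj flipC.
have Jx k q : xz u k -> inJ u (wg k q) by rewrite wgE; apply: inJ_wd.
have uj : ~~ xz si j -> xz u j by apply: xz_flip.
have ui : ~~ xz sj i -> xz u i by rewrite -ju; apply: xz_flip.
rewrite /ed.
have [zi|zi] := boolP (xz s i); have [zj|zj] := boolP (xz s j).
- have [zij|zij] := boolP (xz si j); have [zji|zji] := boolP (xz sj i).
  + by rewrite wgC addxx inJ0.
  + suff xj : xz u j by rewrite inJD ?Jx.
    have := relspace_flipP j zi; rewrite -/(xz sj i) (negPf zji) /=.
    move/(relspace_flipP i); rewrite ju (relspaceDl (xgen j) (ui zji)) -/(xz u j).
    by rewrite addrAC addxx add0r orbb.
  + suff xi : xz u i by rewrite inJD ?Jx.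
    have := relspace_flipP i zj; rewrite -/(xz si j) (negPf zij) /=.
    move/(relspace_flipP j); rewrite -/u (relspaceDl (xgen i) (uj zij)) -/(xz u i).
    by rewrite addrAC addxx add0r orbb.
  + by rewrite inJD ?Jx ?ui ?uj.
- have -> : xz si j = false.
    apply/negP => /(relspace_flipP i); rewrite flipK -/(xz s j) (negPf zj) /=.
    by rewrite addrC (relspaceDl _ zi); apply/negP.
  have -> : xz sj i by apply: relspace_flip_xz zi; apply: xz_flip.
  by rewrite addxx inJ0.
- have -> : xz sj i = false.
    apply/negP => /(relspace_flipP j); rewrite flipK -/(xz s i) (negPf zi) /=.
    by rewrite addrC (relspaceDl _ zj); apply/negP.
  have -> : xz si j by apply: relspace_flip_xz zj; apply: xz_flip.
  by rewrite addxx inJ0.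
have xi : xz si i by apply: xz_flip.
have xj : xz sj j by apply: xz_flip.
have ij_s : xz si j -> xgen i + xgen j \in relspace G s.
  move/(relspace_flipP i); rewrite flipK -/(xz s j) (negPf zj) /=.
  by rewrite addrC.
have ji_s : xz sj i -> xgen i + xgen j \in relspace G s.
  by move/(relspace_flipP j); rewrite flipK -/(xz s i) (negPf zi).
have -> : xz sj i = xz si j.
  apply/idP/idP => [/ji_s|/ij_s].
    by move/(relspace_flip_xz xi); rewrite (relspaceDl _ xi).
  by move/(relspace_flip_xz xj); rewrite addrC (relspaceDl _ xj).
have [zij|_] := boolP (xz si j); last by rewrite addxx inJ0.
rewrite !wgE -wdD addrC; have sij := ij_s zij.
(* Arriving through [si], either x_i + x_j or x_i is zero at u; arriving through [sj], either x_i +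
   x_j or x_j is. In every combination x_i + x_j is zero there. *)
have := relspace_flip_xz xi sij; move/(relspace_flipP j); rewrite -/u.
case/orP => [|ui']; first exact: inJ_wd.
have := relspace_flip_xz xj sij; move/(relspace_flipP i); rewrite ju.
case/orP => [|uj']; first exact: inJ_wd.
apply: inJ_wd; move: ui' uj'; rewrite -addrA addxx addr0 addrAC addxx add0r.
exact: memvD.
Qed.

Lemma khdK (c : khC G) : khd (khd c) = 0.
Proof.
rewrite -[c]krepK !khd_kcls; apply/kcls_eq0 => t; set x := krep c.
have -> : dP (dP x) t = \sum_(i | on t i) \sum_(j | on (flip t i) j)
    ed (flip t i) i (ed (flip (flip t i) j) j (x (flip (flip t i) j))).
  by apply: eq_bigr => i _; rewrite linear_sum.
rewrite big_on_pair; pose F i j :=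
  if [&& on t i, on t j & i != j] then
    ed (flip t i) i (ed (flip (flip t i) j) j (x (flip (flip t i) j))) else 0.
pose r (i j : 'I_n) := (i < j)%N.
(* The terms for (i, j) and (j, i) are the two paths around one square. *)
have -> : \sum_i \sum_j F i j = \sum_i \sum_(j | r i j) (F i j + F j i).
  under [RHS]eq_bigr do rewrite big_split /=.
  rewrite big_split /= [X in _ + X](exchange_big_dep xpredT) //= -big_split.
  apply: eq_bigr => i _; rewrite [LHS](bigID (r i)) /=; congr (_ + _).
  rewrite (bigID (pred1 i)) /= [X in X + _]big1 ?add0r; last first.
    by move=> j /andP[_ /eqP ->]; rewrite /F eqxx /= !andbF.
  by apply: eq_bigl => j; rewrite /r -leqNgt [RHS]ltn_neqAle andbC.
apply: inJ_sum => i _; apply: inJ_sum => j _; rewrite /F [j == i]eq_sym.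
rewrite [on t j && (on t i && _)]andbCA; case: ifP => [/and3P[_ _ ij]|_]; last by rewrite addr0 inJ0.
rewrite [flip (flip t j) i]flipC; set s := flip (flip t i) j.
have := ed_square s (x s) ij.
have -> : flip s i = flip t j by rewrite /s flipC flipK.
by rewrite /s !flipK addrC.
Qed.

End Ideal.

(* Opaque copies of the chain spaces, for the same reason as ext. *)
Lemma chain_copy n (G : lgraph n) : {C : vectType F2 & {e : {linear khC G -> C} &
  {e' : {linear C -> khC G} | cancel e e' & cancel e' e}}}.
Proof. by exists (khC G), idfun, idfun. Qed.

Definition chain n (G : lgraph n) : vectType F2 := projT1 (chain_copy G).

Section Chain.
Variables (n : nat) (G : lgraph n).
Implicit Types (x y : {set 'I_n} -> ext n) (c : chain G).

Definition of_khC : {linear khC G -> chain G} := projT1 (projT2 (chain_copy G)).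
Definition to_khC : {linear chain G -> khC G} :=
  s2val (projT2 (projT2 (chain_copy G))).
Lemma of_khCK : cancel of_khC to_khC.
Proof. exact: (s2valP (projT2 (projT2 (chain_copy G)))). Qed.
Lemma to_khCK : cancel to_khC of_khC.
Proof. exact: (s2valP' (projT2 (projT2 (chain_copy G)))). Qed.

Definition chd c : chain G := of_khC (khd (to_khC c)).
Lemma chd_linear : linear chd.
Proof. by move=> a c d; rewrite /chd !linearP. Qed.
HB.instance Definition _ :=
  GRing.isLinear.Build F2 (chain G) (chain G) _ chd chd_linear.

Definition cls x : chain G := of_khC (kcls G x).
Definition rep c : {set 'I_n} -> ext n := krep (to_khC c).

Lemma repK c : cls (rep c) = c.
Proof. by rewrite /cls /rep krepK to_khCK. Qed.

Lemma clsD x y : cls (fun s => x s + y s) = cls x + cls y.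
Proof. by rewrite /cls kclsD linearD. Qed.

Lemma cls_eq0 x : (forall s, inJ G s (x s)) <-> cls x = 0.
Proof.
split=> [/kcls_eq0 x0|x0]; first by rewrite /cls x0 linear0.
by apply/kcls_eq0; rewrite -[LHS]of_khCK -[of_khC _]/(cls x) x0 linear0.
Qed.

Lemma cls_eq x y : (forall s, inJ G s (x s + y s)) <-> cls x = cls y.
Proof.
split=> [/cls_eq0/eqP|xy].
  by rewrite clsD addx_eq0 => /eqP.
by apply/cls_eq0; rewrite clsD xy addxx.
Qed.

Lemma chd_cls x : chd (cls x) = cls (dP G x).
Proof. by rewrite /chd /cls of_khCK khd_kcls. Qed.

Lemma chdK c : chd (chd c) = 0.
Proof. by rewrite /chd of_khCK khdK linear0. Qed.

End Chain.

(** * Maps of families and substitutions *)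

Section Mono.
Variables (n m : nat) (G : lgraph n) (H : lgraph m).

(* A map of families of polynomials with one possibly nonzero component per
   target state t, namely mloc t from the state mix t, when mcond t holds. *)
Record mono := Mono {
  mcond : {set 'I_m} -> bool;
  mix : {set 'I_m} -> {set 'I_n};
  mloc : {set 'I_m} -> {linear ext n -> ext m};
  mono_inJ : forall t p, mcond t -> inJ G (mix t) p -> inJ H t (mloc t p)
}.

Variable M : mono.

Definition mapp (x : {set 'I_n} -> ext n) t : ext m :=
  if mcond M t then mloc M t (x (mix M t)) else 0.

Definition klift : chain G -> chain H :=
  locked_with relideal_key (fun c => cls H (mapp (rep c))).

Lemma mappD x y t : mapp (fun s => x s + y s) t = mapp x t + mapp y t.
Proof. by rewrite /mapp; case: ifP; rewrite ?linearD ?addr0. Qed.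

Lemma eq_mapp x y : x =1 y -> mapp x =1 mapp y.
Proof. by move=> xy t; rewrite /mapp xy. Qed.

Lemma inJ_mapp x t : inJ G (mix M t) (x (mix M t)) -> inJ H t (mapp x t).
Proof.
by rewrite /mapp; case: ifP => [/mono_inJ|_ _]; [apply|apply: inJ0].
Qed.

Lemma klift_cls x : klift (cls G x) = cls H (mapp x).
Proof.
rewrite /klift unlock; apply/cls_eq => t; rewrite -mappD; apply: inJ_mapp.
by move: (mix M t); apply/cls_eq; rewrite repK.
Qed.

Lemma klift_linear : linear klift.
Proof.
apply: F2_linear => c d; rewrite -[c]repK -[d]repK -clsD !klift_cls -clsD.
by apply/cls_eq => t; rewrite mappD addxx inJ0.
Qed.
HB.instance Definition _ :=
  GRing.isLinear.Build F2 (chain G) (chain H) _ klift klift_linear.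

End Mono.

(** * Annihilators of the relation spaces and linear substitutions *)

Section Solutions.
Variables (n : nat) (G : lgraph n).

(* The annihilator of relspace G s, in the coordinates dual to xgen: it is cut
   out by the linear relations with matrix adjmx between the coordinates
   p_k = [k in s] y_k and q_k = [k notin s] y_k. *)
Definition sol (s : {set 'I_n}) (y : 'I_n -> F2) : Prop :=
  forall j, (j \notin s)%:R * y j = \sum_k adjmx G j k * ((k \in s)%:R * y k).

Lemma sol_ext s y z : y =1 z -> sol s y -> sol s z.
Proof.
by move=> yz ys j; rewrite -yz ys; apply: eq_bigr => k _; rewrite yz.
Qed.

Lemma relation_pair s (y : 'rV[F2]_n) j :
  pair y (relation G s j) = (j \notin s)%:R * y 0 j +
     \sum_k adjmx G j k * ((k \in s)%:R * y 0 k).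
Proof.
have := relation_dot G s j (fun k => y 0 k); rewrite /pair => e.
rewrite -[LHS](eq_bigr _ (fun k _ => mulrC _ _)) e; congr (_ + _).
rewrite big_mkcond; apply: eq_bigr => k _.
by case: ifP; rewrite ?mul1r // mul0r mulr0.
Qed.

(** The double annihilator theorem: a vector outside the row span of the relations is detected by
    some column of the cokernel matrix, and that column is a solution. *)
Lemma relspaceP s (v : 'rV[F2]_n) :
  (v \in relspace G s) <-> (forall y : 'rV[F2]_n, sol s (y 0) -> pair y v = 0).
Proof.
split=> [sv y ys|vs].
  pose P : {linear 'rV[F2]_n -> F2^o} := HB.pack (pair y)
    (GRing.isLinear.Build F2 'rV[F2]_n F2^o _ (pair y)
       (@F2_linear _ F2^o _ (pairD y))).
  suff /subvP/(_ v sv) : (relspace G s <= lker (linfun P))%VS.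
    by rewrite memv_ker lfunE => /eqP.
  apply/span_subvP => _ /mapP[j _ ->]; rewrite memv_ker lfunE /=.
  by rewrite relation_pair ys addF2.
apply/negPn/negP => vNs; pose B : 'M[F2]_n := \matrix_j relation G s j.
have vNB : ~~ (v <= B)%MS.
  apply: contra vNs => /submxP[w ->].
  rewrite mulmx_sum_row; apply: memv_suml => j _; apply: memvZ.
  by rewrite rowK; apply/memv_span/map_f; rewrite mem_enum.
have /rV0Pn[l] : v *m cokermx B != 0 by rewrite -submxE.
pose y := (col l (cokermx B))^T.
have -> : (v *m cokermx B) 0 l = pair y v.
  by rewrite mxE; apply: eq_bigr => k _; rewrite !mxE mulrC.
rewrite vs ?eqxx // => j.
have : pair y (relation G s j) = 0.
  have /matrixP/(_ j l) := mulmx_coker B; rewrite !mxE => <-.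
  by apply: eq_bigr => k _; rewrite !mxE mulrC.
by rewrite relation_pair => /eqP; rewrite (@addx_eq0 F2^o) => /eqP.
Qed.

End Solutions.

Section Substitution.
Variables (n m : nat) (G : lgraph n) (H : lgraph m).

Lemma pair_mul (A : 'M[F2]_(n, m)) (y : 'rV[F2]_m) v :
  pair y (v *m A) = pair (\row_i pair y (row i A)) v.
Proof.
rewrite mulmx_sum_row pair_sum; apply: eq_bigr => i _.
by rewrite pairZ mxE mulrC.
Qed.

(** By the double annihilator criterion it suffices that the transpose of A carries solutions at t
    to solutions at s. *)
Lemma relspace_map (A : 'M[F2]_(n, m)) s t :
  (forall y : 'rV[F2]_m, sol H t (y 0) -> sol G s (fun i => pair y (row i A))) ->
  forall v, v \in relspace G s -> v *m A \in relspace H t.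
Proof.
move=> solA v sv; apply/relspaceP => y yt; rewrite pair_mul.
have /relspaceP := sv; apply; apply: sol_ext (solA _ yt) => i.
by rewrite mxE.
Qed.

Lemma inJ_Lam (A : 'M[F2]_(n, m)) s t :
  (forall v, v \in relspace G s -> v *m A \in relspace H t) ->
  forall p, inJ G s p -> inJ H t (Lam A p).
Proof.
move=> sA p; elim/inJ_ind => {p} [|p q|v q /sA tv].
- by rewrite linear0 inJ0.
- by rewrite linearD; apply: inJD.
by rewrite Lam_wd inJ_wd.
Qed.

Lemma Lam_cong (A B : 'M[F2]_(n, m)) t p :
  (forall i, row i A + row i B \in relspace H t) -> inJ H t (Lam A p + Lam B p).
Proof.
move=> AB; elim/ext_ind: p => [||p q pAB qAB|i p pAB].
- by rewrite !linear0 addr0 inJ0.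
- by rewrite !Lam1 addxx inJ0.
- by rewrite !linearD addrACA inJD.
rewrite !Lam_wg.
have -> : wd (row i A) (Lam A p) + wd (row i B) (Lam B p) =
   wd (row i A + row i B) (Lam A p) + wd (row i B) (Lam A p + Lam B p).
  by rewrite wdD linearD /= addrA; congr (_ + _); rewrite -addrA addxx addr0.
by apply: inJD; [apply: inJ_wd | apply: inJ_wdr].
Qed.

End Substitution.

(** * Reduction and relabeling of Khovanov complexes *)

Definition lin_iso (U V : vectType F2) : Prop :=
  exists phi : {linear U -> V}, bijective phi.

Lemma lin_iso_sym U V : lin_iso U V -> lin_iso V U.
Proof.
case=> phi [psi phiK psiK].
have psi_lin : linear psi.
  by apply: F2_linear => x y; apply: (can_inj phiK); rewrite linearD !psiK.
pose f : {linear V -> U} := HB.pack psi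
  (GRing.isLinear.Build F2 V U _ psi psi_lin).
by exists f; exists phi.
Qed.

Lemma lin_iso_trans U V W : lin_iso U V -> lin_iso V W -> lin_iso U W.
Proof.
case=> f f_bij [g g_bij].
by exists [the {linear U -> W} of g \o f]; apply: bij_comp.
Qed.

Definition kh_iso n m (G : lgraph n) (H : lgraph m) : Prop :=
  lin_iso (Kh G) (Kh H).

Lemma kh_chain n (G : lgraph n) :
  lin_iso (Kh G) (homology (linfun (@chd n G))).
Proof.
have chdE x : chd (of_khC G x) = of_khC G (khd x) by rewrite /chd of_khCK.
apply: (@homology_iso _ _ _ _ _ (of_khC G)) => [x|y|x b]; rewrite !lfunE /=.
- by rewrite chdE.
- move=> dy; exists (to_khC G y), 0; rewrite !lfunE /= !linear0 addr0 to_khCK.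
  by split=> //; apply: (can_inj (@of_khCK n G)); rewrite linear0 -chdE to_khCK.
move=> _ xb; exists (to_khC G b); rewrite lfunE /=.
by apply: (can_inj (@of_khCK n G)); rewrite xb.
Qed.

Definition eqJ n (G : lgraph n) (x y : {set 'I_n} -> ext n) : Prop :=
  forall s, inJ G s (x s + y s).

Definition add_fam n (x y : {set 'I_n} -> ext n) : {set 'I_n} -> ext n :=
  fun s => x s + y s.

(* The data of a contraction at the level of representatives. *)
Record fam_contraction n (G : lgraph n) (h E : mono G G) : Prop :=
  FamContraction {
    fc_hh : forall x, eqJ G (mapp h (mapp h x)) (fun=> 0);
    fc_hdh : forall x, eqJ G (mapp h (dP G (mapp h x))) (mapp h x);
    fc_hE : forall x, eqJ G (mapp h (mapp E x)) (fun=> 0);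
    fc_Eh : forall x, eqJ G (mapp E (mapp h x)) (fun=> 0);
    fc_EE : forall x, eqJ G (mapp E (mapp E x)) (mapp E x);
    fc_ker : forall x, eqJ G (mapp h x) (fun=> 0) ->
      eqJ G (mapp h (dP G x)) (fun=> 0) ->
      eqJ G x (add_fam (mapp E x) (mapp h (dP G (mapp E x))))
  }.

Lemma cls0 n (G : lgraph n) : cls G (fun=> 0) = 0.
Proof. by apply/cls_eq0 => s; apply: inJ0. Qed.

Lemma eqJ0 n (G : lgraph n) x : eqJ G x (fun=> 0) <-> cls G x = 0.
Proof. by rewrite -[X in _ <-> _ = X](cls0 G); apply: cls_eq. Qed.

Lemma fam_contractionP n (G : lgraph n) (h E : mono G G) :
  fam_contraction h E -> contraction (@chd n G) (klift h) (klift E).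
Proof.
case=> hh hdh hE Eh EE ker; split=> /= c; rewrite -[c]repK.
- by rewrite chd_cls chd_cls -chd_cls -chd_cls chdK.
- by rewrite !klift_cls; apply/eqJ0/hh.
- by rewrite klift_cls chd_cls klift_cls; apply/cls_eq/hdh.
- by rewrite !klift_cls; apply/eqJ0/hE.
- by rewrite !klift_cls; apply/eqJ0/Eh.
- by rewrite !klift_cls; apply/cls_eq/EE.
rewrite chd_cls !klift_cls chd_cls klift_cls -clsD => /eqJ0 hx /eqJ0 hdx.
exact/cls_eq/ker.
Qed.

Definition mono_id n (G : lgraph n) : mono G G :=
  @Mono n n G G xpredT id (fun=> idfun) (fun _ _ _ => id).

Lemma mono_0_inJ n m (G : lgraph n) (H : lgraph m) t :
  forall p, false -> inJ G set0 p -> inJ H t ((\0 : {linear ext n -> ext m}) p).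
Proof. by []. Qed.
(** The condition is constantly false, so the source state [set0] and the zero map are
    placeholders. *)
Definition mono_0 n m (G : lgraph n) (H : lgraph m) : mono G H :=
  @Mono n m G H xpred0 (fun=> set0) (fun=> \0) (@mono_0_inJ n m G H).

(** Lets [kh_reduction] be applied to a complex from which nothing is cancelled. *)
Lemma fam_contraction_trivial n (G : lgraph n) :
  fam_contraction (mono_0 G G) (mono_id G).
Proof.
split=> x; try by move=> s; rewrite /mapp /= ?addr0 ?addxx inJ0.
by move=> _ _ s; rewrite /add_fam /mapp /= addr0 addxx inJ0.
Qed.

(** [reduction_iso] restated on families of representatives, with equalities replaced by congruences
    modulo the ideals. *)
Lemma kh_reduction n m (G : lgraph n) (H : lgraph m)
    (h E : mono G G) (k F : mono H H) (f : mono G H) :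
  fam_contraction h E -> fam_contraction k F ->
  (forall x, eqJ H (mapp F (mapp f (mapp E x))) (mapp f (mapp E x))) ->
  (forall x, eqJ H (mapp f (mapp E x)) (fun=> 0) -> eqJ G (mapp E x) (fun=> 0)) ->
  (forall y, exists x, eqJ H (mapp F y) (mapp f (mapp E x))) ->
  (forall x, let y := mapp f (mapp E x) in let z := mapp E x in
     eqJ H (mapp F (dP H (add_fam y (mapp k (dP H y)))))
           (mapp f (mapp E (dP G (add_fam z (mapp h (dP G z))))))) ->
  kh_iso G H.
Proof.
move=> /fam_contractionP Cc /fam_contractionP Cd fE f_inj f_surj fd.
apply: lin_iso_trans (kh_chain G) _.
apply: (lin_iso_trans _ (lin_iso_sym (kh_chain H))).
apply: (@reduction_iso _ _ _ _ _ _ _ _ Cc Cd (klift f)) => /=.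
- by move=> c; rewrite -[c]repK !klift_cls; apply/cls_eq/fE.
- move=> c; rewrite -[c]repK !klift_cls => /eqJ0 /f_inj.
  by move=> Ex0; apply/eqJ0.
- move=> d; have [x dx] := f_surj (rep d); exists (cls G x).
  by rewrite -[d]repK !klift_cls; apply/cls_eq.
move=> c; rewrite -[c]repK; set x := rep c.
rewrite !klift_cls !chd_cls !klift_cls.
have -> : cls G (mapp E x) + cls G (mapp h (dP G (mapp E x))) =
  cls G (add_fam (mapp E x) (mapp h (dP G (mapp E x)))) by rewrite -clsD.
have -> : cls H (mapp f (mapp E x)) + cls H (mapp k (dP H (mapp f (mapp E x)))) =
  cls H (add_fam (mapp f (mapp E x)) (mapp k (dP H (mapp f (mapp E x))))) by rewrite -clsD.
by rewrite !chd_cls !klift_cls; apply/cls_eq; apply: (fd x).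
Qed.

Section Substitution.
Variables (n m : nat) (G : lgraph n) (H : lgraph m).

(** B has to undo A only modulo the relations of s, since [Lam_cong] absorbs the difference. *)
Lemma inJ_Lam_inv (A : 'M[F2]_(n, m)) (B : 'M[F2]_(m, n)) s t p :
  (forall v, v \in relspace H t -> v *m B \in relspace G s) ->
  (forall i, row i (A *m B) + xgen i \in relspace G s) ->
  inJ H t (Lam A p) -> inJ G s p.
Proof.
move=> tB AB /(inJ_Lam tB); rewrite Lam_comp => /inJDl <-.
rewrite -[X in _ + X](Lam_id p); apply: Lam_cong => i.
by rewrite [row i 1%:M]rowE mulmx1; apply: AB.
Qed.

Lemma ed_Lam (A : 'M[F2]_(n, m)) s t i j p :
  xz G s i = xz H t j -> row i A = xgen j ->
  Lam A (ed G s i p) = ed H t j (Lam A p).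
Proof.
by move=> st iA; rewrite /ed st; case: ifP; rewrite // Lam_wg iA wd_gen.
Qed.

Lemma xz_Lam (A : 'M[F2]_(n, m)) s t i j : row i A = xgen j ->
  (forall v, (v \in relspace G s) = (v *m A \in relspace H t)) ->
  xz G s i = xz H t j.
Proof. by move=> iA sA; rewrite /xz sA /xgen -rowE iA. Qed.

End Substitution.

Section Relabel.
Variables (n : nat) (G H : lgraph n) (r : 'S_n).
Variables (f g : {set 'I_n} -> {set 'I_n}).
Hypotheses (fK : cancel f g) (gK : cancel g f)
  (f_flip : forall t i, f (flip t (r i)) = flip (f t) i)
  (f_on : forall t i, on H t (r i) = on G (f t) i)
  (solHG : forall t y, sol H t y -> sol G (f t) (y \o r))
  (solGH : forall t y, sol G (f t) (y \o r) -> sol H t y).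

Let A : 'M[F2]_n := perm_mx r.
Let B : 'M[F2]_n := perm_mx r^-1.
Let rowA i : row i A = xgen (r i).
Proof. by apply/rowP => j; rewrite !mxE eqxx /= eq_sym. Qed.
Let rowB i : row i B = xgen (r^-1%g i).
Proof. by apply/rowP => j; rewrite !mxE eqxx /= eq_sym. Qed.
Let AB : A *m B = 1%:M.
Proof. by rewrite -perm_mxM mulgV perm_mx1. Qed.
Let BA : B *m A = 1%:M.
Proof. by rewrite -perm_mxM mulVg perm_mx1. Qed.

Let mapA t v : v \in relspace G (f t) -> v *m A \in relspace H t.
Proof.
apply: relspace_map => y yt; apply: sol_ext (solHG yt) => i /=.
by rewrite rowA pair_delta.
Qed.

Let mapB t v : v \in relspace H t -> v *m B \in relspace G (f t).
Proof.
apply: relspace_map => y yt; apply: solGH; apply: sol_ext yt => i /=.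
by rewrite rowB pair_delta permK.
Qed.

Let mapAE t v : (v \in relspace G (f t)) = (v *m A \in relspace H t).
Proof.
apply/idP/idP => [|/mapB]; first exact: mapA.
by rewrite -mulmxA AB mulmx1.
Qed.

Let M : mono G H := @Mono _ _ G H xpredT f (fun=> Lam A)
  (fun t p _ => inJ_Lam (@mapA t) (p := p)).

Let M_dP x t : mapp M (dP G x) t = dP H (mapp M x) t.
Proof.
rewrite /dP (reindex_inj (@perm_inj _ r)) /=.
rewrite /mapp /= linear_sum; apply: eq_big => [i|i _]; first by rewrite f_on.
rewrite f_flip; apply/ed_Lam; last exact: rowA.
by apply: (xz_Lam (rowA i)) => v; rewrite -f_flip; apply: mapAE.
Qed.

(** States are pulled back by [f] while vertices are pushed forward by [r]. The two hypotheses on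
    solutions match the relation spaces, and therefore also the types of all edges. *)
Lemma kh_iso_relabel : kh_iso G H.
Proof.
apply: (@kh_reduction _ _ G H (mono_0 G G) (mono_id G) (mono_0 H H) (mono_id H) M).
- exact: fam_contraction_trivial.
- exact: fam_contraction_trivial.
- by move=> x s; rewrite addxx inJ0.
- move=> x x0 s; have := x0 (g s).
  rewrite /mapp /= gK !addr0; apply: (inJ_Lam_inv (B := B)) => [v /mapB|i].
    by rewrite gK.
  by rewrite AB rowE mulmx1 addxx mem0v.
- move=> y; exists (fun s => Lam B (y (g s))) => t.
  by rewrite /mapp /= fK Lam_comp BA Lam_id addxx inJ0.
move=> x y z t; rewrite /y /z {y z}.
have -> : mapp (mono_id H) (dP H (add_fam (mapp M (mapp (mono_id G) x))
  (mapp (mono_0 H H) (dP H (mapp M (mapp (mono_id G) x)))))) t = dP H (mapp M x) t.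
  by apply: eq_bigr => i _; rewrite /add_fam /mapp /= addr0.
have -> : mapp M (mapp (mono_id G) (dP G (add_fam (mapp (mono_id G) x)
  (mapp (mono_0 G G) (dP G (mapp (mono_id G) x)))))) t = mapp M (dP G x) t.
  rewrite /mapp /=; congr (Lam A _); apply: eq_bigr => i _.
  by rewrite /add_fam /mapp /= addr0.
by rewrite M_dP addxx inJ0.
Qed.

End Relabel.

(** * The moves Omega4' and Omega4 *)

Definition F2simp := (@mul0r F2, @mulr0 F2, @mul1r F2, @mulr1 F2, @add0r F2, @addr0 F2,
  addF2, @eqxx F2, @scale0r F2, @scale1r F2).

Ltac f2cases := repeat match goal with x : _ |- _ =>
  let e := fresh in case: (F2P x) => e; rewrite e {x e} end; rewrite ?F2simp //.

Section Omega4'.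
Variables (n : nat) (G H : lgraph n) (v : 'I_n).
Hypotheses (frv : fr G v)
  (adjH : forall t w, adj H t w = adj G t w (+) [&& t != w, adj G v t & adj G v w])
  (sgnH : forall x, sgn H x = (x == v) (+) sgn G x)
  (frH : forall x, fr H x = fr G x (+) adj G v x).

(** Pivoting at the diagonal entry of v: away from v the outer square of row v is added. On the
    diagonal this is the change of framing, since squaring is the identity in F2. *)
Lemma adjmx_Omega4' j k : adjmx H j k =
  adjmx G j k + (j != v)%:R * (k != v)%:R * (adjmx G v j * adjmx G v k).
Proof.
rewrite !mxE adjH frH ![v == _]eq_sym.
have [-> | jv] := eqVneq j v.
  by rewrite !adj_irr /= andbF !addbF mul0r mul0r addr0.
have [-> | kv] := eqVneq k v.
  by rewrite !adj_irr /= !andbF !addbF mulr0 mul0r addr0; case: eqP => // jv'; rewrite jv' eqxx in jv.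
rewrite !mul1r.
have [->|jk] := eqVneq j k => /=; case: (adj G v k); rewrite ?F2simp ?addbF //.
- by rewrite addbT; case: (fr G k); rewrite ?F2simp.
- by case: (adj G v j); case: (adj G j k); rewrite ?F2simp.
by case: (adj G v j); rewrite /= ?andbF ?addbF ?F2simp.
Qed.

(** As a_vv = 1, row v reads q_v = p_v + S_v. Flipping v exchanges p_v and q_v, which preserves this
    equation, and eliminating p_v from the other rows produces the pivoted matrix. *)
Lemma sol_Omega4' s y : sol G s y -> sol H (flip s v) y.
Proof.
move=> Gsy.
have vv : adjmx G v v = 1 by rewrite mxE eqxx frv.
pose S j := \sum_(k | k != v) adjmx G j k * ((k \in s)%:R * y k).
have rowE j : (j \notin s)%:R * y j = adjmx G j v * ((v \in s)%:R * y v) + S j.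
  by rewrite Gsy (bigD1 v).
have rowv : (v \notin s)%:R * y v = (v \in s)%:R * y v + S v by rewrite rowE vv mul1r.
move=> j; rewrite (bigD1 v) //= !in_flip eqxx adjmx_Omega4' eqxx mulr0 mul0r addr0 addTb rowv.
have -> : \sum_(k | k != v) adjmx H j k * ((k \in flip s v)%:R * y k) =
    S j + (j != v)%:R * adjmx G v j * S v.
  rewrite mulr_sumr -big_split; apply: eq_bigr => k kv /=.
  rewrite in_flip (negPf kv) addFb adjmx_Omega4' kv mulr1 mulrDl.
  by rewrite -!mulrA; congr (_ + _ * _); rewrite mulrA.
have [->|jv] := eqVneq j v => /=.
  rewrite mul0r mul0r addr0 negbK vv mul1r -addrA addF2 addr0 //.
rewrite rowE mul1r [adjmx G v j]adjmx_sym mulrDr.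
by rewrite -!addrA; congr (_ + _); rewrite addrCA addF2 addr0.
Qed.
End Omega4'.

Lemma Omega4'_sym n (G H : lgraph n) v :
  [/\ fr G v,
        forall t w, adj H t w = adj G t w (+) [&& t != w, adj G v t & adj G v w],
        forall x, sgn H x = (x == v) (+) sgn G x
      & forall x, fr H x = fr G x (+) adj G v x] ->
  [/\ fr H v,
        forall t w, adj G t w = adj H t w (+) [&& t != w, adj H v t & adj H v w],
        forall x, sgn G x = (x == v) (+) sgn H x
      & forall x, fr G x = fr H x (+) adj H v x].
Proof.
case=> frv adjH sgnH frH.
have Hv t : adj H v t = adj G v t by rewrite adjH adj_irr andbF addbF.
split=> [|t w|x|x]; first by rewrite frH adj_irr addbF.
- by rewrite adjH !Hv addbK.
- by rewrite sgnH addKb.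
by rewrite frH Hv addbK.
Qed.

Lemma kh_Omega4' n (G H : lgraph n) : Omega4' G H -> kh_iso G H.
Proof.
case=> v GH; have HG := Omega4'_sym GH.
case: GH HG => frv adjH sgnH frH [frv' adjG sgnG frG].
apply: (@kh_iso_relabel _ G H 1%g (fun t => flip t v) (fun t => flip t v)).
- by move=> t; rewrite flipK.
- by move=> t; rewrite flipK.
- by move=> t i; rewrite perm1 flipC.
- by move=> t i; rewrite perm1 /on in_flip sgnH addbCA addbA.
- move=> t y yt; apply: (@sol_ext _ _ _ y) => [i /=|]; first by rewrite perm1.
  exact: sol_Omega4' yt.
move=> t y yt; rewrite -[t](flipK t v); apply: (@sol_Omega4' n G H v) => //.
by apply: sol_ext yt => i /=; rewrite perm1.
Qed.

(** A row j other than u, v, before and after the move: [pu + Sv] is q_v and [pv + Su] is q_u, the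
    new p-coordinates at u and at v. *)
Lemma Omega4_identity (a b Su Sv Sj pu pv : F2) :
  a * pu + (b * pv + Sj) =
  a * (pu + Sv) + (b * (pv + Su) + (Sj + (a * Sv + b * Su))).
Proof. by f2cases. Qed.

Definition Omega4_at n (G H : lgraph n) (u v : 'I_n) : Prop :=
    [/\ adj G u v, fr G u = false & fr G v = false] /\
    [/\ forall x, fr H x = fr G x,
        sgn H u = ~~ sgn G v /\ sgn H v = ~~ sgn G u,
        forall x, x != u -> x != v -> sgn H x = sgn G x,
        forall x, adj H u x = adj G u x /\ adj H v x = adj G v x
      & forall t w, t \notin [:: u; v] -> w \notin [:: u; v] ->
          adj H t w =
            adj G t w (+) (Omega4_toggles G u v t w || Omega4_toggles G u v w t)].

Lemma Omega4_sym n (G H : lgraph n) (u v : 'I_n) :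
  Omega4_at G H u v -> Omega4_at H G u v.
Proof.
case=> [[uv fu fv] [frH [su sv] sH nH tH]].
split; first by split; rewrite ?frH //; case: (nH v) => ->.
have nu x : adj H u x = adj G u x by case: (nH x).
have nv x : adj H v x = adj G v x by case: (nH x).
split=> [x||x xu xv|x|t w ht hw].
- by rewrite frH.
- by rewrite su sv !negbK.
- by rewrite sH.
- by rewrite nu nv.
by rewrite tH // /Omega4_toggles !nu !nv -addbA addbb addbF.
Qed.

(** With y transposed as well, the pair (p, q) at u becomes (q, p) of the old v, and conversely; the
    two exclusive ors do the complementing. *)
Definition Omega4_state n (u v : 'I_n) (t : {set 'I_n}) : {set 'I_n} :=
  [set i | (tperm u v i \in t) (+) (i == u) (+) (i == v)].

Section Omega4.
Variables (n : nat) (G H : lgraph n) (u v : 'I_n).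
Hypothesis GH : Omega4_at G H u v.

Lemma Omega4_neq : u != v.
Proof. by case: GH => [[uv _ _] _]; apply: contraTneq uv => ->; rewrite adj_irr. Qed.

Lemma adjmx_Omega4l k :
  (adjmx H u k = adjmx G u k) * (adjmx H v k = adjmx G v k).
Proof.
case: GH => [_ [frH _ _ nH _]].
by rewrite !mxE !frH; case: (nH k) => -> ->.
Qed.

(** Pivoting on the block of u and v, which has zero diagonal and off-diagonal entries 1. The added
    matrix is symmetric with zero diagonal, in agreement with the unchanged framings. *)
Lemma adjmx_Omega4 j k : j != u -> j != v -> k != u -> k != v ->
  adjmx H j k = adjmx G j k + (adjmx G j u * adjmx G v k + adjmx G j v * adjmx G u k).
Proof.
case: GH => [_ [frH _ _ _ tH]] ju jv ku kv.
rewrite [adjmx G j u]adjmx_sym [adjmx G j v]adjmx_sym !mxE frH.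
rewrite ![u == _]eq_sym ![v == _]eq_sym (negPf ju) (negPf jv) (negPf ku) (negPf kv).
have [<-|jk] := eqVneq j k.
  by rewrite [X in _ + (X + _)]mulrC addF2 addr0.
rewrite tH ?inE ?negb_or ?ju ?jv ?ku ?kv // /Omega4_toggles.
by case: (adj G j k); case: (adj G u j); case: (adj G u k);
   case: (adj G v j); case: (adj G v k) => /=; rewrite ?F2simp.
Qed.

Lemma sol_Omega4 s y : sol G s y ->
  sol H (Omega4_state u v s) (fun i => y (tperm u v i)).
Proof.
move=> Gsy; have uv := Omega4_neq; have vu : v != u by rewrite eq_sym.
have [[auv fu fv] _] := GH.
have a_uu : adjmx G u u = 0 by rewrite mxE eqxx fu.
have a_vv : adjmx G v v = 0 by rewrite mxE eqxx fv.
have a_uv : adjmx G u v = 1 by rewrite mxE (negPf uv) auv.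
have a_vu : adjmx G v u = 1 by rewrite adjmx_sym.
pose S j := \sum_(k | (k != u) && (k != v)) adjmx G j k * ((k \in s)%:R * y k).
have rowE j : (j \notin s)%:R * y j = adjmx G j u * ((u \in s)%:R * y u) +
   (adjmx G j v * ((v \in s)%:R * y v) + S j).
  by rewrite Gsy (bigD1 u) //= (bigD1 v) ?vu //=.
have rowu : (u \notin s)%:R * y u = (v \in s)%:R * y v + S u.
  by rewrite rowE a_uu a_uv mul0r add0r mul1r.
have rowv : (v \notin s)%:R * y v = (u \in s)%:R * y u + S v.
  by rewrite rowE a_vv a_vu mul0r add0r mul1r.
have inu : (u \in Omega4_state u v s) = (v \notin s).
  by rewrite inE tpermL eqxx (negPf uv) addbF addbT.
have inv : (v \in Omega4_state u v s) = (u \notin s).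
  by rewrite inE tpermR eqxx (negPf vu) addbF addbT.
have ink k : k != u -> k != v ->
    ((k \in Omega4_state u v s) = (k \in s)) * (tperm u v k = k).
  move=> ku kv; have tk : tperm u v k = k by rewrite tpermD // eq_sym.
  by rewrite inE tk (negPf ku) (negPf kv) !addbF.
move=> j; rewrite (bigD1 u) //= (bigD1 v) ?vu //= inu inv tpermL tpermR rowu rowv.
have [->|ju] := eqVneq j u.
  rewrite inu tpermL negbK !adjmx_Omega4l a_uu a_uv mul0r add0r mul1r.
  rewrite (eq_bigr (fun k => adjmx G u k * ((k \in s)%:R * y k))) => [|k /andP[ku kv]].
    by rewrite -/(S u) -addrA addF2 addr0.
  by rewrite adjmx_Omega4l !ink.
have [->|jv] := eqVneq j v.
  rewrite inv tpermR negbK !adjmx_Omega4l a_vu a_vv mul0r add0r mul1r.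
  rewrite (eq_bigr (fun k => adjmx G v k * ((k \in s)%:R * y k))) => [|k /andP[ku kv]].
    by rewrite -/(S v) -addrA addF2 addr0.
  by rewrite adjmx_Omega4l !ink.
rewrite !ink // rowE [adjmx H j u]adjmx_sym [adjmx H j v]adjmx_sym !adjmx_Omega4l.
rewrite (eq_bigr (fun k => adjmx G j k * ((k \in s)%:R * y k) +
   (adjmx G j u * (adjmx G v k * ((k \in s)%:R * y k)) +
    adjmx G j v * (adjmx G u k * ((k \in s)%:R * y k))))); last first.
  move=> k /andP[ku kv]; rewrite !ink // adjmx_Omega4 //.
  by rewrite mulrDl mulrDl !mulrA.
rewrite !big_split /= -!mulr_sumr -!/(S _) ![adjmx G _ j]adjmx_sym.
exact: Omega4_identity.
Qed.
End Omega4.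

Lemma kh_Omega4 n (G H : lgraph n) : Omega4 G H -> kh_iso G H.
Proof.
case=> u [v GH]; have HG := Omega4_sym GH; have uv := Omega4_neq GH.
have tK : involutive (Omega4_state u v).
  move=> t; apply/setP => i; rewrite !inE tpermK.
  rewrite !(canF_eq (tpermK u v)) tpermL tpermR.
  by case: (i \in t); case: (i == u); case: (i == v).
apply: (@kh_iso_relabel _ G H (tperm u v) (Omega4_state u v) (Omega4_state u v)) => //.
- move=> t i; apply/setP => j; rewrite in_flip !inE in_flip.
  by rewrite (inj_eq perm_inj) !addbA.
- case: GH => [_ [_ [su sv] sH _ _]] t i; rewrite /on inE.
  have [->|iu] := eqVneq i u.
    by rewrite tpermL sv (negPf uv) addbF addbT addNb addbN.
  have [->|iv] := eqVneq i v.
    by rewrite tpermR su addbF addbT addNb addbN.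
  by rewrite tpermD ?sH // ?[_ == i]eq_sym // !addbF.
- by move=> t y yt; apply: (sol_Omega4 HG).
move=> t y /(sol_Omega4 GH); rewrite tK; apply: sol_ext => i /=.
by rewrite tpermK.
Qed.

(** * Cancellation of two adjacent directions *)

Lemma inJ_sub n (G H : lgraph n) s t p :
  (forall v, v \in relspace G s -> v \in relspace H t) ->
  inJ G s p -> inJ H t p.
Proof.
move=> st; elim/inJ_ind => {p} [|p q|v q /st]; [exact: inJ0|exact: inJD|].
exact: inJ_wd.
Qed.

(* Consider the states with no vertex of B on. There the edge along u starting
   with u and v off is the multiplication by x_u (xz_u), and the edge along v
   starting with u on and v off is the quotient map by x_v, since the covector
   phi takes the value 1 at x_v and vanishes on the relations; phi also splits
   both maps. Cancelling them leaves the states with some vertex of B on and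
   those with u off and v on. *)
Section Cancellation.
Variables (n : nat) (G : lgraph n) (u v : 'I_n) (B : {set 'I_n}) (phi : 'rV[F2]_n).
Implicit Types (s t : {set 'I_n}) (i : 'I_n) (x : {set 'I_n} -> ext n).

Definition off s := [forall (i | i \in B), ~~ on G s i].
Definition rest i := [&& i \notin B, i != u & i != v].

Hypotheses (uv : u != v) (uB : u \notin B) (vB : v \notin B)
  (phi_u : phi 0 u = 1) (phi_v : phi 0 v = 1)
  (phi_rest : forall i, rest i -> phi 0 i = 0)
  (phi_rel : forall s, on G s u -> ~~ on G s v -> off s ->
     forall w, w \in relspace G s -> pair phi w = 0)
  (xz_u : forall s, ~~ on G s u -> ~~ on G s v -> off s -> xz G s u).

Lemma off_flip s i : i \notin B -> off (flip s i) = off s.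
Proof.
move=> iB; apply: eq_forallb_in => j jB; rewrite on_flip.
by case: eqVneq => // ji; rewrite -ji jB in iB.
Qed.

Let vu : v != u. Proof. by rewrite eq_sym. Qed.
Let on_uu s : on G (flip s u) u = ~~ on G s u.
Proof. by rewrite on_flip eqxx. Qed.
Let on_uv s : on G (flip s u) v = on G s v.
Proof. by rewrite on_flip (negPf vu). Qed.
Let on_vu s : on G (flip s v) u = on G s u.
Proof. by rewrite on_flip (negPf uv). Qed.
Let on_vv s : on G (flip s v) v = ~~ on G s v.
Proof. by rewrite on_flip eqxx. Qed.
Let offu s : off (flip s u) = off s. Proof. exact: off_flip. Qed.
Let offv s : off (flip s v) = off s. Proof. exact: off_flip. Qed.
Let onE := (on_uu, on_uv, on_vu, on_vv, offu, offv).

Let not_xz_v s : on G s u -> ~~ on G s v -> off s -> ~~ xz G s v.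
Proof.
move=> su sv so; apply/negP => /(phi_rel su sv so)/eqP.
by rewrite pair_delta phi_v oner_eq0.
Qed.

Let xz_v s : on G s u -> on G s v -> off s -> xz G s v.
Proof.
move=> su sv so; rewrite -[s](flipK s v); apply: xz_flip.
by apply: not_xz_v; rewrite ?onE ?negbK ?su ?sv.
Qed.

(** The substitution killing x_v, with values in the kernel of contraction by [phi]. Splitting the
    quotient by x_v in this way makes the homotopy square to zero. *)
Definition ctv (p : ext n) := ct phi (wd (xgen v) p).
Lemma ctv_linear : linear ctv.
Proof. by move=> a p q; rewrite /ctv !linearP. Qed.
HB.instance Definition _ :=
  GRing.isLinear.Build F2 (ext n) (ext n) _ ctv ctv_linear.

Lemma ct_ctv p : ct phi (ctv p) = 0.
Proof. exact: ct2. Qed.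

Lemma ctvE p : ctv p = p + wd (xgen v) (ct phi p).
Proof. by rewrite /ctv /= ct_wd pair_delta phi_v scale1r. Qed.

Definition hloc s :=
  if on G s u then [the {linear ext n -> ext n} of ctv]
  else [the {linear ext n -> ext n} of ct phi].

Lemma h_inJ s p : off s && ~~ on G s v ->
  inJ G (if on G s u then flip s v else flip s u) p ->
  inJ G s (hloc s p).
Proof.
rewrite /hloc; case/andP => so sv; case: ifP => su pJ.
  apply: inJ_ct; first exact: phi_rel.
  move/(inJ_ed v): pJ; rewrite flipK /ed.
  by rewrite xz_v ?onE ?sv ?su ?so // wgE.
have sz : xz G s u by apply: xz_u; rewrite ?su.
have : inJ G (flip s u) (ct phi p).
  by apply: inJ_ct pJ; apply: phi_rel; rewrite !onE ?su.
by apply: inJ_sub => w; rewrite -{2}[s](flipK s u); apply: relspace_flip_xz; rewrite flipK.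
Qed.

Definition cancel_h : mono G G := @Mono n n G G _ _ hloc h_inJ.

Lemma E_inJ s p :
  ~~ off s || (~~ on G s u && on G s v) -> inJ G s p -> inJ G s (idfun p).
Proof. by []. Qed.

Definition cancel_E : mono G G := @Mono n n G G _ id (fun=> idfun) E_inJ.

Let h := mapp cancel_h.
Let E := mapp cancel_E.

Let h00 x s : ~~ on G s u -> ~~ on G s v -> off s ->
  h x s = ct phi (x (flip s u)).
Proof. by move=> su sv so; rewrite /h /mapp /= /hloc so sv /= (negPf su). Qed.

Let h10 x s : on G s u -> ~~ on G s v -> off s -> h x s = ctv (x (flip s v)).
Proof. by move=> su sv so; rewrite /h /mapp /= /hloc so sv /= su. Qed.

Let h_0 x s : on G s v || ~~ off s -> h x s = 0.
Proof.
by rewrite /h /mapp /=; case: (off s) => //=; rewrite orbF => ->.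
Qed.

Let E_0 x s : ~~ (~~ off s || (~~ on G s u && on G s v)) -> E x s = 0.
Proof. by rewrite /E /mapp /= => /negPf ->. Qed.

Let E_1 x s : ~~ off s || (~~ on G s u && on G s v) -> E x s = x s.
Proof. by rewrite /E /mapp /= => ->. Qed.

(** The part of the differential that stays within one kind of corner. *)
Definition dR x t := \sum_(i | on G t i && rest i) ed G (flip t i) i (x (flip t i)).

Lemma dR_inJ x : (forall s, inJ G s (x s)) -> forall t, inJ G t (dR x t).
Proof.
move=> xJ t; apply: inJ_sum => i _.
by have := inJ_ed i (xJ (flip t i)); rewrite flipK.
Qed.

(** The edge along i has the same type at 00 and 10: otherwise x_i + x_u would be a relation at 10,
    but [phi] takes the value 1 on it. *)
Let xz00 s i : ~~ on G s u -> ~~ on G s v -> off s -> rest i ->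
  xz G (flip s u) i = xz G s i.
Proof.
move=> su sv so ri; apply/idP/idP.
  rewrite -{2}[s](flipK s u); apply: relspace_flip_xz; rewrite flipK.
  exact: xz_u.
move/(relspace_flipP u) => /orP[//|] /phi_rel => e.
have := e; rewrite !onE su sv so => /(_ isT isT isT)/eqP.
by rewrite pairD !pair_delta phi_u phi_rest // add0r oner_eq0.
Qed.

Let xz10 s i : on G s u -> ~~ on G s v -> off s -> rest i ->
  xz G (flip s v) i = xz G s i.
Proof.
move=> su sv so ri; apply/idP/idP; last first.
  by apply: relspace_flip_xz; apply: xz_flip; apply: not_xz_v.
move/(relspace_flipP v); rewrite flipK => /orP[//|] /phi_rel => e.
have := e; rewrite su sv so => /(_ isT isT isT)/eqP.
by rewrite pairD !pair_delta phi_v phi_rest // add0r oner_eq0.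
Qed.

Let ct_wg i p : rest i -> ct phi (wg i p) = wg i (ct phi p).
Proof. by move=> ri; rewrite !wgE ct_wd pair_delta phi_rest // scale0r add0r. Qed.

Let ctv_wg i p : rest i -> ctv (wg i p) = wg i (ctv p).
Proof. by move=> ri; rewrite /ctv /= -ct_wg // !wgE wdC. Qed.

Let rest_on s i : rest i -> [/\ on G (flip s i) u = on G s u,
  on G (flip s i) v = on G s v & off (flip s i) = off s].
Proof.
case/and3P => iB iu iv; rewrite !on_flip off_flip //.
by rewrite [u == _]eq_sym [v == _]eq_sym (negPf iu) (negPf iv).
Qed.

Let on_off s i : off s -> on G s i -> i \notin B.
Proof. by move=> /forall_inP so si; apply/negP => /so; rewrite si. Qed.

(** The Clifford relation turns contraction after multiplication by x_u into the identity plus a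
    multiple of x_u, and x_u is zero at 00. *)
Lemma hd00 x s : ~~ on G s u -> ~~ on G s v -> off s ->
  inJ G s (h (dP G x) s + (dR (h x) s + x s)).
Proof.
move=> su sv so; rewrite h00 // /dP (bigD1 u) ?onE //= flipK.
have -> : ed G s u (x s) = wd (xgen u) (x s) by rewrite /ed xz_u // wgE.
rewrite (linearD (ct phi)) /= ct_wd pair_delta phi_u scale1r.
rewrite (linear_sum (ct phi)) /=.
have -> : \sum_(i | on G (flip s u) i && (i != u))
    ct phi (ed G (flip (flip s u) i) i (x (flip (flip s u) i))) = dR (h x) s.
  apply: eq_big => i.
    rewrite on_flip; case: (eqVneq i u) => [->|iu]; first by rewrite /rest eqxx !andbF.
    rewrite andbT addFb; apply/idP/andP => [si|[] //]; split=> //.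
    rewrite /rest iu (on_off so si) /=; apply: contraTneq si => ->; exact: sv.
  rewrite on_flip => /andP[si iu]; move: si; rewrite (negPf iu) addFb => si.
  have ri : rest i.
    rewrite /rest iu (on_off so si) /=; apply: contraTneq si => ->; exact: sv.
  have [e1 e2 e3] := rest_on s ri.
  rewrite flipC h00 ?e1 ?e2 ?e3 // /ed xz00 ?e1 ?e2 ?e3 //.
  by case: ifP => // _; apply: ct_wg.
rewrite [dR _ _ + _]addrC addrACA addxx addr0 addrAC addxx add0r.
by apply: inJ_wd; apply: xz_u.
Qed.

Definition dU x t := if on G t u then ed G (flip t u) u (x (flip t u)) else 0.

(** Two special edges enter the corner 11: the quotient map from s itself, which gives [ctv (x s)],
    and the u-edge from 01, which gives the term with [dU]. *)
Lemma hd10 x s : on G s u -> ~~ on G s v -> off s ->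
  h (dP G x) s = dR (h x) s + (ctv (x s) + h (dU x) s).
Proof.
move=> su sv so; rewrite !h10 // /dU /dP !onE su.
rewrite (bigD1 u) ?onE //= (bigD1 v) /= ?onE ?sv ?vu // flipK.
have -> : ed G s v (x s) = x s by rewrite /ed (negPf (not_xz_v su sv so)).
rewrite 2!(linearD ctv) addrA addrC; congr (_ + _); last exact: addrC.
rewrite (linear_sum ctv); apply: eq_big => i.
  rewrite on_flip; case: (eqVneq i u) => [->|iu]; first by rewrite /rest eqxx !andbF.
  case: (eqVneq i v) => [->|iv]; first by rewrite /rest eqxx !andbF.
  rewrite !andbT addFb; apply/idP/andP => [si|[] //]; split=> //.
  by rewrite /rest iu iv (on_off so si).
rewrite on_flip => /andP[/andP[si iu] iv]; move: si; rewrite (negPf iv) addFb => si.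
have ri : rest i by rewrite /rest iu iv (on_off so si).
have [e1 e2 e3] := rest_on s ri.
rewrite flipC h10 ?e1 ?e2 ?e3 // /ed xz10 ?e1 ?e2 ?e3 //.
by case: ifP => // _; apply: ctv_wg.
Qed.

Lemma cancel_hE x s : h (E x) s = 0.
Proof.
have [sv|sv] := boolP (on G s v); first by rewrite h_0 ?sv.
have [so|so] := boolP (off s); last by rewrite h_0 // so orbT.
have [su|su] := boolP (on G s u).
  by rewrite h10 // E_0 ?linear0 // !onE so su.
by rewrite h00 // E_0 ?linear0 // !onE so (negPf sv) andbF.
Qed.

Lemma cancellation : fam_contraction cancel_h cancel_E.
Proof.
have hh x : h (h x) =1 (fun=> 0).
  move=> s; have [sv|sv] := boolP (on G s v); first by rewrite h_0 ?sv.
  have [so|so] := boolP (off s); last by rewrite h_0 // so orbT.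
  have [su|su] := boolP (on G s u).
    by rewrite h10 // h_0 ?linear0 // !onE sv.
  by rewrite h00 // h10 ?onE // ct_ctv.
have hE x : h (E x) =1 (fun=> 0) by move=> s; apply: cancel_hE.
have dR_J0 x s : (forall t, inJ G t (x t)) -> inJ G s (dR x s) by move=> xJ; apply: dR_inJ.
have dR_h0 x s : inJ G s (dR (h (h x)) s).
  by apply: dR_J0 => t; rewrite hh inJ0.
have dR_hE s x : inJ G s (dR (h (E x)) s).
  by apply: dR_J0 => t; rewrite hE inJ0.
split=> [x s|x s|x s|x s|x s|x hx hdx s]; rewrite -/h -/E.
- by rewrite hh addr0 inJ0.
- have [sv|sv] := boolP (on G s v); first by rewrite !h_0 ?sv // addr0 inJ0.
  have [so|so] := boolP (off s); last by rewrite !h_0 ?so ?orbT // addr0 inJ0.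
  have [su|su] := boolP (on G s u); last first.
    by rewrite -(inJDl _ (dR_h0 x s)) addrCA hd00.
  rewrite hd10 // [ctv (h x s)]ctvE h10 // ct_ctv linear0 addr0.
  rewrite -h10 // -addrA [h x s + _]addrC -addrA addxx addr0.
  have hz : h x (flip (flip s v) u) = 0 by rewrite h_0 // !onE sv.
  by rewrite [h (dU _) s]h10 // /dU !onE su hz !linear0 addr0.
- by rewrite hE addr0 inJ0.
- rewrite addr0; have [c|c] := boolP (~~ off s || (~~ on G s u && on G s v)).
    rewrite E_1 // h_0 ?inJ0 //; move: c; case: (off s) => //=; last by rewrite orbT.
    by case/andP => _ ->.
  by rewrite E_0 ?inJ0.
- have [c|c] := boolP (~~ off s || (~~ on G s u && on G s v)).
    by rewrite E_1 // addxx inJ0.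
  by rewrite !E_0 // addxx inJ0.
rewrite /add_fam -/h -/E.
have {}hx t : inJ G t (h x t) by have := hx t; rewrite addr0.
have {}hdx t : inJ G t (h (dP G x) t) by have := hdx t; rewrite addr0.
have [so|so] := boolP (off s); last first.
  by rewrite E_1 ?so // h_0 ?so ?orbT // addr0 addxx inJ0.
have [sv|sv] := boolP (on G s v).
  rewrite [h _ s]h_0 ?sv // addr0.
  have [su|su] := boolP (on G s u); last by rewrite E_1 ?su ?sv ?orbT // addxx inJ0.
  rewrite E_0 ?su ?so // addr0.
  (* Corner 11: [ctv (x s)] is zero already at 10, and it differs from [x s] by a multiple of x_v,
     which is zero at 11. *)
  have : inJ G s (ctv (x s)).
    have := hx (flip s v); rewrite h10 ?onE ?sv // flipK.
    apply: inJ_sub => w; rewrite -{2}[s](flipK s v); apply: relspace_flip_xz.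
    by rewrite flipK xz_v.
  rewrite ctvE addrC => e; rewrite -(inJDl _ (_ : inJ G s (wd (xgen v) (ct phi (x s))))) //.
  by apply: inJ_wd; apply: xz_v.
have Es : E x s = 0 by rewrite E_0 // so (negPf sv) andbF.
rewrite Es add0r.
have [su|su] := boolP (on G s u); last first.
  have := hd00 (E x) su sv so; rewrite Es addr0 addrC (inJDl _ (dR_hE s x)) => hEs.
  have := hd00 x su sv so; rewrite (inJDl _ (hdx s)) (inJDl _ (dR_J0 _ s hx)) => xs.
  exact: inJD.
rewrite (hd10 (E x)) // Es linear0 add0r addrCA (inJDl _ (dR_hE s x)).
have -> : h (dU (E x)) s = h (dU x) s.
  by rewrite !h10 // /dU !onE su E_1 // !onE so su sv.
suff ct_s : inJ G s (wd (xgen v) (ct phi (x s))).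
  have := hdx s; rewrite hd10 // (inJDl _ (dR_J0 _ s hx)) ctvE.
  by rewrite [x s + wd _ _]addrC -addrA (inJDl _ ct_s).
apply: inJ_wdr.
(* The contraction of [x s] is known to vanish only at 00. Multiplying by x_u carries this to 10,
   and contracting once more recovers the same element there. *)
have := hx (flip s u); rewrite h00 ?onE ?su // flipK => /(inJ_ed u).
rewrite flipK /ed xz_u ?onE ?su // wgE => /(inJ_ct (phi_rel su sv so)).
by rewrite ct_wd ct2 linear0 addr0 pair_delta phi_u scale1r.
Qed.

Section Free.
Variable x : {set 'I_n} -> ext n.
Hypothesis Ex : forall s, mapp cancel_E x s = x s.

Let hx s : h x s = 0.
Proof.
transitivity (h (E x) s); last exact: cancel_hE.
by apply: eq_mapp => t; rewrite [RHS]Ex.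
Qed.

Let dR_hx s : inJ G s (dR (h x) s).
Proof. by apply: dR_inJ => t; rewrite hx inJ0. Qed.

Lemma hd_0 s : on G s v || ~~ off s -> mapp cancel_h (dP G x) s = 0.
Proof. exact: h_0. Qed.

Lemma hd_00 s : ~~ on G s u -> ~~ on G s v -> off s ->
  inJ G s (mapp cancel_h (dP G x) s).
Proof.
move=> su sv so; have := hd00 x su sv so.
have -> : x s = 0 by rewrite -Ex; apply: E_0; rewrite so (negPf sv) andbF.
by rewrite addr0 addrC inJDl.
Qed.

(** The only correction to a family supported on surviving states: from 01 along u to 11, then
    backwards along v to 10. *)
Lemma hd_10 s : on G s u -> ~~ on G s v -> off s ->
  inJ G s (mapp cancel_h (dP G x) s +
    ctv (ed G (flip (flip s v) u) u (x (flip (flip s v) u)))).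
Proof.
move=> su sv so; have -> : mapp cancel_h (dP G x) s = h (dP G x) s by [].
rewrite hd10 //.
have -> : x s = 0 by rewrite -Ex; apply: E_0; rewrite so su.
by rewrite linear0 add0r [h (dU _) s]h10 // /dU !onE su -addrA addxx addr0.
Qed.

End Free.

End Cancellation.

(** * The move Omega2 *)

Section Embedding.
Variables (n m : nat) (G : lgraph n) (H : lgraph m) (f : 'I_n -> 'I_m).
Hypothesis emb : embeds_as_induced f G H.

Let f_inj : injective f. Proof. by case: emb. Qed.

Lemma big_codom (V : zmodType) (P : pred 'I_m) (F : 'I_m -> V) :
  \sum_(k | P k) F k =
  \sum_(k | P k && (k \notin codom f)) F k + \sum_(j | P (f j)) F (f j).
Proof.
rewrite (bigID (mem (codom f))) /= addrC; congr (_ + _).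
transitivity (\sum_(k in f @: [set j | P (f j)]) F k); last first.
  rewrite big_imset => [|i j _ _ /f_inj //].
  by apply: eq_bigl => j; rewrite inE.
apply: eq_bigl => k; apply/andP/imsetP => [[Pk /codomP[j kj]]|[j]].
  by exists j; rewrite // inE -kj.
by rewrite inE => Pj ->; rewrite Pj codom_f.
Qed.

Lemma adjmx_emb i j : adjmx H (f i) (f j) = adjmx G i j.
Proof.
case: emb => _ adjH frH _; rewrite !mxE (inj_eq f_inj) adjH frH.
by [].
Qed.

Lemma on_emb t i : on H t (f i) = on G (f @^-1: t) i.
Proof. by case: emb => _ _ _ sgnH; rewrite /on inE sgnH. Qed.

Lemma preim_flip t i : f @^-1: flip t (f i) = flip (f @^-1: t) i.
Proof. by apply/setP => j; rewrite inE !in_flip inE (inj_eq f_inj). Qed.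

Definition embmx : 'M[F2]_(n, m) := \matrix_i xgen (f i).

Lemma row_embmx i : row i embmx = xgen (f i).
Proof. exact: rowK. Qed.

(** The added vertices then contribute nothing to the relations of the embedded ones, which are thus
    those of G. *)
Definition clean (t : {set 'I_m}) : Prop :=
  forall i k, k \notin codom f -> k \in t -> adjmx H (f i) k = 0.

Lemma sum_clean (t : {set 'I_m}) i (y : 'I_m -> F2) : clean t ->
  \sum_k adjmx H (f i) k * ((k \in t)%:R * y k) =
  \sum_j adjmx G i j * ((j \in f @^-1: t)%:R * y (f j)).
Proof.
move=> ct; rewrite big_codom /= big1 ?add0r.
  by apply: eq_bigr => j _; rewrite adjmx_emb inE.
move=> k kf; case: (boolP (k \in t)) => kt; last by rewrite mul0r mulr0.
by rewrite ct // mul0r.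
Qed.

Lemma relspace_emb t v : clean t -> v \in relspace G (f @^-1: t) ->
  v *m embmx \in relspace H t.
Proof.
move=> ct; apply: relspace_map => y yt i.
rewrite row_embmx pair_delta inE yt sum_clean //.
by apply: eq_bigr => j _; rewrite row_embmx pair_delta.
Qed.

Lemma inJ_emb t p : clean t -> inJ G (f @^-1: t) p -> inJ H t (Lam embmx p).
Proof. by move=> ct; apply: inJ_Lam => v; apply: relspace_emb. Qed.

Section Retraction.
Variables (t : {set 'I_m}) (r : 'M[F2]_(m, n)).
Hypotheses (ct : clean t) (rf : forall i, row (f i) r = xgen i)
  (r_sol : forall y : 'rV_n, sol G (f @^-1: t) (y 0) ->
     forall k, k \notin codom f -> (k \notin t)%:R * pair y (row k r) =
       (\sum_(l | (l \notin codom f) && (l \in t)) adjmx H k l * pair y (row l r)) +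
       \sum_j adjmx H k (f j) * ((j \in f @^-1: t)%:R * y 0 j)).

(** Dually, [r] extends a solution of G to the added vertices. [r_sol] is the equation at those
    vertices; the other equations hold because t is clean. *)
Lemma relspace_retr v : v \in relspace H t -> v *m r \in relspace G (f @^-1: t).
Proof.
apply: relspace_map => y ys k.
have sumE l : \sum_k adjmx H l k * ((k \in t)%:R * pair y (row k r)) =
  (\sum_(k | (k \notin codom f) && (k \in t)) adjmx H l k * pair y (row k r)) +
       \sum_j adjmx H l (f j) * ((j \in f @^-1: t)%:R * y 0 j).
  rewrite big_codom /=; congr (_ + _).
    rewrite [RHS]big_mkcondr; apply: eq_bigr => l' _.
    by case: ifP; rewrite ?mul1r // mul0r mulr0.
  by apply: eq_bigr => j _; rewrite rf pair_delta inE.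
case: (boolP (k \in codom f)) => [/codomP[i ->]|kf]; last by rewrite sumE r_sol.
rewrite sum_clean // rf pair_delta.
have := ys i; rewrite inE => ->; apply: eq_bigr => j _.
by rewrite rf pair_delta.
Qed.

Lemma inJ_emb_inv p : inJ H t (Lam embmx p) -> inJ G (f @^-1: t) p.
Proof.
apply: inJ_Lam_inv; first exact: relspace_retr.
move=> i; rewrite row_mul row_embmx -rowE rf addxx.
exact: mem0v.
Qed.

Lemma xz_emb i : xz H t (f i) = xz G (f @^-1: t) i.
Proof.
apply/esym; apply: (xz_Lam (A := embmx)) => [|v]; first exact: row_embmx.
apply/idP/idP => [|/relspace_retr]; first exact: relspace_emb.
rewrite -mulmxA; have -> : embmx *m r = 1%:M; last by rewrite mulmx1.
apply/row_matrixP => j; rewrite row_mul row_embmx -rowE rf rowE mulmx1.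
by [].
Qed.

End Retraction.

Lemma codomC (S : {set 'I_m}) : (forall i, f i \notin S) -> (#|S| + n = m)%N ->
  forall k, (k \notin codom f) = (k \in S).
Proof.
move=> fS Sm k; have : f @: setT == ~: S.
  rewrite eqEcard; apply/andP; split.
    by apply/subsetP => _ /imsetP[i _ ->]; rewrite inE fS.
  rewrite card_imset // cardsT card_ord.
  have /eqP : (#|S| + #|~: S| = #|S| + n)%N by rewrite cardsC card_ord Sm.
  by rewrite eqn_add2l => /eqP ->.
move/eqP/setP/(_ k); rewrite inE => e; rewrite -[k \in S]negbK -e; congr negb.
by apply/codomP/imsetP => [[i ->]|[i _ ->]]; exists i.
Qed.

Variable c : pred {set 'I_m}.
Hypotheses (c_clean : forall t, c t -> clean t)
  (c_flip : forall t i, c (flip t (f i)) = c t).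

Lemma emb_mono_inJ t p : c t -> inJ G (f @^-1: t) p -> inJ H t (Lam embmx p).
Proof. by move/c_clean; apply: inJ_emb. Qed.

Definition emb_mono : mono G H :=
  @Mono n m G H c (fun t => f @^-1: t) (fun=> Lam embmx) emb_mono_inJ.

Lemma dP_emb x t : c t ->
  (forall i, xz H (flip t (f i)) (f i) = xz G (flip (f @^-1: t) i) i) ->
  \sum_(j | on H t (f j)) ed H (flip t (f j)) (f j) (mapp emb_mono x (flip t (f j))) =
  Lam embmx (dP G x (f @^-1: t)).
Proof.
move=> ct xzE; rewrite /dP linear_sum /=; apply: eq_big => [i|i _].
  exact: on_emb.
rewrite /mapp /= c_flip ct preim_flip; apply/esym/ed_Lam => //.
exact: row_embmx.
Qed.

End Embedding.

Section Omega2.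
Variables (n : nat) (G : lgraph n) (H : lgraph n.+2) (f : 'I_n -> 'I_n.+2) (u v : 'I_n.+2).
Hypotheses (emb : embeds_as_induced f G H) (uv : u != v)
  (fu : forall i, f i != u) (fv : forall i, f i != v)
  (su : sgn H u = false) (sv : sgn H v = true)
  (uvE : forall k, adjmx H u k = adjmx H v k).

Let codomE k : (k \notin codom f) = (k == u) || (k == v).
Proof.
rewrite (codomC emb (S := [set u; v])) ?in_set2 // => [i|]; last by rewrite cards2 uv.
by rewrite in_set2 negb_or fu fv.
Qed.

Let on_u s : on H s u = (u \in s). Proof. by rewrite /on su addbF. Qed.
Let on_v s : on H s v = (v \notin s). Proof. by rewrite /on sv addbT. Qed.

Let phi : 'rV[F2]_n.+2 := xgen u + xgen v.

Let phiE k : phi 0 k = ((k == u) || (k == v))%:R.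
Proof.
rewrite !mxE eqxx /=; have [->|ku] := eqVneq k u; first by rewrite (negPf uv) addr0.
by rewrite add0r.
Qed.

Let phi_u : phi 0 u = 1. Proof. by rewrite phiE eqxx. Qed.
Let phi_v : phi 0 v = 1. Proof. by rewrite phiE eqxx orbT. Qed.
Let phi_rest i : rest u v set0 i -> phi 0 i = 0.
Proof. by case/and3P => _ /negPf iu /negPf iv; rewrite phiE iu iv. Qed.

(** Here u and v both belong to s, so [phi] has p = 1 at each of them and q = 0 everywhere; it is a
    solution because rows u and v of the matrix coincide and cancel. *)
Let phi_rel s : on H s u -> ~~ on H s v -> off H set0 s ->
  forall w, w \in relspace H s -> pair phi w = 0.
Proof.
rewrite on_u on_v negbK => us vs _ w /relspaceP; apply => j.
rewrite (bigD1 u) //= (bigD1 v) 1?eq_sym //= us vs phi_u phi_v.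
rewrite big1 => [|k /andP[/negPf ku /negPf kv]]; last by rewrite phiE ku kv !mulr0.
rewrite !mulr1 addr0 ![adjmx H j _]adjmx_sym uvE addF2 phiE.
have [->|_] := eqVneq j u; first by rewrite us mul0r.
have [->|_] := eqVneq j v; first by rewrite vs mul0r.
by rewrite mulr0.
Qed.

(** As v is in s, its relation is the row sum alone; subtracting it from the relation of u leaves
    x_u. *)
Let xz_u s : ~~ on H s u -> ~~ on H s v -> off H set0 s -> xz H s u.
Proof.
rewrite on_u on_v negbK => us vs _; apply/relspaceP => y ys.
rewrite pair_delta; have := ys u; have := ys v; rewrite us vs mul0r mul1r => e ->.
by rewrite [RHS]e; apply: eq_bigr => k _; rewrite uvE.
Qed.

Let uN : u \notin set0. Proof. by rewrite inE. Qed.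
Let vN : v \notin set0. Proof. by rewrite inE. Qed.
Let Can := cancellation uv uN vN phi_u phi_v phi_rest phi_rel xz_u.

Let c (t : {set 'I_n.+2}) : bool := (u \notin t) && (v \notin t).

Let c_clean t : c t -> clean H f t.
Proof.
case/andP => /negPf ut /negPf vt i k; rewrite codomE.
by case/orP => /eqP ->; rewrite ?ut ?vt.
Qed.

Let c_flip t i : c (flip t (f i)) = c t.
Proof. by rewrite /c !in_flip ![_ == f i]eq_sym (negPf (fu i)) (negPf (fv i)). Qed.

Let M := emb_mono emb c_clean.

(** When neither u nor v is in t, their relations express x_u and x_v by the same sum over
    neighbours in t; the retraction substitutes this sum. *)
Let retr (t : {set 'I_n.+2}) : 'M[F2]_(n.+2, n) :=
  \matrix_k if [pick j | f j == k] is Some j then xgen j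
    else \sum_(l | l \in f @^-1: t) adjmx H u (f l) *: xgen l.

Let retr_f t i : row (f i) (retr t) = xgen i.
Proof.
have [f_inj _ _ _] := emb; rewrite rowK; case: pickP => [j /eqP /f_inj -> //|/(_ i)].
by rewrite eqxx.
Qed.

Let retr_uv t k : k \notin codom f ->
  row k (retr t) = \sum_(l | l \in f @^-1: t) adjmx H u (f l) *: xgen l.
Proof.
move=> kf; rewrite rowK; case: pickP => // j /eqP jk.
by rewrite -jk codom_f in kf.
Qed.

Let uvE' k l : k \notin codom f -> adjmx H k l = adjmx H u l.
Proof. by rewrite codomE => /orP[] /eqP ->. Qed.

Let retr_sol t : c t -> forall y : 'rV_n, sol G (f @^-1: t) (y 0) ->
  forall k, k \notin codom f -> (k \notin t)%:R * pair y (row k (retr t)) =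
    (\sum_(l | (l \notin codom f) && (l \in t)) adjmx H k l * pair y (row l (retr t))) +
    \sum_j adjmx H k (f j) * ((j \in f @^-1: t)%:R * y 0 j).
Proof.
case/andP => ut vt y _ k kf.
have kt : k \notin t by move: kf; rewrite codomE => /orP[] /eqP ->.
rewrite big1 => [|l /andP[]]; last first.
  by rewrite codomE => /orP[] /eqP ->; rewrite ?(negPf ut) ?(negPf vt).
rewrite kt mul1r add0r retr_uv // pair_sum big_mkcond; apply: eq_bigr => l _.
by case: ifP => _; rewrite ?mul0r ?mulr0 // pairZ pair_delta mul1r uvE'.
Qed.

Let xzE t i : c t -> xz H t (f i) = xz G (f @^-1: t) i.
Proof.
by move=> ct; apply: (xz_emb emb (c_clean ct) (retr_f t) (retr_sol ct)).
Qed.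

Let E_cond t : mcond (cancel_E H u v set0) t = c t.
Proof.
rewrite /= /c on_u on_v (_ : off H set0 t = true) //.
by apply/forall_inP => i; rewrite inE.
Qed.

Lemma kh_Omega2_reduction : kh_iso G H.
Proof.
apply: (@kh_reduction _ _ G H (mono_0 G G) (mono_id G) _ _ M) => //.
- exact: fam_contraction_trivial.
- exact: Can.
- move=> x t; set y := mapp M _; rewrite {1}/mapp E_cond /=.
  case: ifP => ct; first by rewrite addxx inJ0.
  by rewrite /y /mapp /= ct addr0 inJ0.
- move=> x x0 s; have := x0 (f @: s); rewrite /mapp /=.
  have [f_inj _ _ _] := emb.
  have ct : c (f @: s).
    by apply/andP; split; apply/imsetP => -[i _] /eqP; rewrite eq_sym ?(negPf (fu i)) ?(negPf (fv i)).
  rewrite ct !addr0 => /(inJ_emb_inv emb (c_clean ct) (retr_f _) (retr_sol ct)).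
  have -> : f @^-1: (f @: s) = s; last by [].
  by apply/setP => i; rewrite inE mem_imset.
- move=> y; exists (fun s : {set 'I_n} => Lam (retr (f @: s)) (y (f @: s))) => t.
  rewrite {1}/mapp E_cond /= /mapp /=; case: ifP => ct; last by rewrite addr0 inJ0.
  have [ut vt] := andP ct.
  have -> : f @: (f @^-1: t) = t.
    apply/setP => k; apply/imsetP/idP => [[i]|kt]; first by rewrite inE => ? ->.
    have := codomE k; case: (boolP (k \in codom f)) => [/codomP[i ki] _|_ /esym].
      by exists i; rewrite // inE -ki.
    by case/orP => /eqP ke; rewrite -ke kt in ut vt.
  rewrite Lam_comp -{1}[y t]Lam_id; apply: Lam_cong => k.
  rewrite [row k 1%:M]rowE mulmx1 row_mul.
  have [/codomP[i ->]|kf] := boolP (k \in codom f).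
    by rewrite retr_f -rowE row_embmx addxx mem0v.
  rewrite retr_uv // mulmx_suml; apply/relspaceP => z zt.
  have kt : k \notin t by move: kf; rewrite codomE => /orP[] /eqP ->.
  rewrite pairD pair_delta; have := zt k; rewrite kt mul1r => ->.
  rewrite pair_sum (big_codom emb) /= [X in X + _ + _]big1 ?add0r; last first.
    by move=> l; rewrite codomE => /orP[] /eqP ->;
      rewrite ?(negPf ut) ?(negPf vt) mul0r mulr0.
  rewrite [X in _ + X]big_mkcond -big_split /= big1 // => l _; rewrite inE uvE' //.
  case: ifP => _; last by rewrite mul0r mulr0 addr0.
  by rewrite -scalemxAl pairZ -rowE row_embmx pair_delta mul1r addF2.
move=> x y z t; rewrite {1}/mapp E_cond /= [mapp M _ t]/mapp /=.
case: ifP => ct; last by rewrite addr0 inJ0.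
have -> : mapp (mono_id G) (dP G (add_fam z (mapp (mono_0 G G) (dP G z)))) (f @^-1: t)
    = dP G x (f @^-1: t).
  by rewrite /mapp /=; apply: eq_bigr => i _; rewrite /add_fam /mapp /= addr0.
have Ey s : mapp (cancel_E H u v set0) y s = y s.
  rewrite {1}/mapp E_cond /=; case: ifP => // cs.
  by rewrite /y /mapp /= cs.
have [ut vt] := andP ct.
rewrite -(dP_emb emb c_clean c_flip x ct) => [|i]; last first.
  by rewrite xzE ?c_flip // (preim_flip emb).
rewrite {1}/dP (big_codom emb) /=.
set S1 := \sum_(k | _ && _) _; set S2 := \sum_(j | _) _.
set S3 := \sum_(j | _) _; have -> : S2 = S3.
  apply: eq_bigr => i _; rewrite /add_fam hd_0 ?addr0 //.
  by rewrite on_v in_flip eq_sym (negPf (fv i)) addFb vt.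
(* What is left are the directions u and v: u is off, and the v-edge comes from a corner 00, where
   the corrected family is zero. *)
rewrite -addrA addxx addr0; apply: inJ_sum => k /andP[tk].
rewrite codomE => /orP[] /eqP kE; move: tk; rewrite kE => tk.
  by move: tk; rewrite on_u (negPf ut).
suff e : inJ H (flip t v) (add_fam y (mapp (cancel_h uv uN vN phi_v phi_rel xz_u) (dP H y)) (flip t v)).
  by have := inJ_ed v e; rewrite flipK.
have y0 : y (flip t v) = 0 by rewrite /y /mapp /= /c !in_flip eqxx (negPf vt) /= andbF.
rewrite /add_fam y0 add0r.
apply: hd_00 => //; first by rewrite on_u in_flip (negPf uv) addFb.
  by rewrite on_v negbK in_flip eqxx (negPf vt).
by apply/forall_inP => i; rewrite inE.
Qed.

End Omega2.

Lemma kh_Omega2 n (G : lgraph n) (H : lgraph n.+2) : Omega2 G H -> kh_iso G H.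
Proof.
case=> f [u [v [emb [uv fN] uv_type [su sv] uvN]]].
apply: (kh_Omega2_reduction emb uv) => // [i|i|k]; [by case: (fN i)..|].
(* In both variants the framings make rows u and v agree at the columns u and v too. *)
rewrite !mxE [v == k]eq_sym [u == k]eq_sym.
have [->|ku] := eqVneq k u.
  rewrite (negPf uv) adj_sym.
  by case: uv_type => -[]; [move=> -> -> | move=> /negPf -> /negPf ->].
have [->|kv] := eqVneq k v; last by rewrite uvN.
by case: uv_type => -[]; [move=> -> _ -> | move=> /negPf -> _ /negPf ->].
Qed.

(** * The move Omega1 *)

Section Omega1.
Variables (n : nat) (G : lgraph n) (H : lgraph n.+1) (f : 'I_n -> 'I_n.+1) (v : 'I_n.+1).
Hypotheses (emb : embeds_as_induced f G H) (fv : forall i, f i != v)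
  (frv : fr H v = false) (adjv : forall w, adj H v w = false) (sv : sgn H v = false).
Implicit Types (t : {set 'I_n.+1}) (x : {set 'I_n.+1} -> ext n.+1).

Let codomE k : (k \notin codom f) = (k == v).
Proof.
rewrite (codomC emb (S := [set v])) ?in_set1 // => [i|]; last by rewrite cards1.
by rewrite in_set1 fv.
Qed.

Let on_v t : on H t v = (v \in t). Proof. by rewrite /on sv addbF. Qed.

Let adj0 k : adjmx H v k = 0.
Proof. by rewrite mxE frv adjv if_same. Qed.

Let phi : 'rV[F2]_n.+1 := xgen v.

Let phiE k : phi 0 k = (k == v)%:R.
Proof. by rewrite mxE eqxx. Qed.

Let phi_v : pair phi (xgen v) = 1.
Proof. by rewrite pair_delta phiE eqxx. Qed.

Let phi_k k : k != v -> pair phi (xgen k) = 0.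
Proof. by move=> kv; rewrite pair_delta phiE (negPf kv). Qed.

Let phi_rel t : v \in t -> forall w, w \in relspace H t -> pair phi w = 0.
Proof.
move=> vt w /relspaceP; apply => j; rewrite big1 => [|k _]; last first.
  rewrite phiE; case: eqVneq => [->|_]; last by rewrite !mulr0.
  by rewrite adjmx_sym adj0 mul0r.
rewrite phiE; case: eqVneq => [->|_]; last by rewrite mulr0.
by rewrite vt mul0r.
Qed.

Let xz_v t : v \notin t -> xz H t v.
Proof.
move=> vt; apply/relspaceP => y yt; have := yt v.
by rewrite vt mul1r pair_delta => ->; rewrite big1 // => k _; rewrite adj0 mul0r.
Qed.

Let in_v t : (v \in flip t v) = (v \notin t).
Proof. by rewrite in_flip eqxx. Qed.

(** Only a multiplication by x_v is cancelled here. Its cokernel is represented by the polynomials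
    without x_v, so E projects inside each state with v instead of selecting states. *)
Let pr := [the {linear ext n.+1 -> ext n.+1} of ct phi \o wd (xgen v)].

Let prE p : ct phi (wd (xgen v) p) = p + wd (xgen v) (ct phi p).
Proof. by rewrite ct_wd phi_v scale1r. Qed.

Let h_inJ t p : v \notin t -> inJ H (flip t v) p -> inJ H t (ct phi p).
Proof.
move=> vt pJ; have : inJ H (flip t v) (ct phi p).
  by apply: inJ_ct pJ; apply: phi_rel; rewrite in_v.
by apply: inJ_sub => w /(relspace_flip_xz (i := v)); rewrite flipK; apply; apply: xz_v.
Qed.

Let E_inJ t p : v \in t -> inJ H t p -> inJ H t (pr p).
Proof. by move=> vt pJ; apply: inJ_ct; [exact: phi_rel|apply: inJ_wdr]. Qed.

Let hm : mono H H := @Mono _ _ H H (fun t => v \notin t) (fun t => flip t v) (fun=> ct phi) h_inJ.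
Let Em : mono H H := @Mono _ _ H H (fun t => v \in t) id (fun=> pr) E_inJ.
Let h := mapp hm.
Let E := mapp Em.

Let h0 x t : v \notin t -> h x t = ct phi (x (flip t v)).
Proof. by rewrite /h /mapp /= => ->. Qed.
Let h1 x t : v \in t -> h x t = 0.
Proof. by rewrite /h /mapp /= => ->. Qed.
Let E0 x t : v \notin t -> E x t = 0.
Proof. by rewrite /E /mapp /= => /negPf ->. Qed.
Let E1 x t : v \in t -> E x t = ct phi (wd (xgen v) (x t)).
Proof. by rewrite /E /mapp /= => ->. Qed.

Let dr x t := \sum_(i | on H t i && (i != v)) ed H (flip t i) i (x (flip t i)).

Let dr_inJ x : (forall s, inJ H s (x s)) -> forall t, inJ H t (dr x t).
Proof.
move=> xJ t; apply: inJ_sum => i _.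
by have := inJ_ed i (xJ (flip t i)); rewrite flipK.
Qed.

Let xz_flip_v t i : v \notin t -> i != v -> xz H (flip t v) i = xz H t i.
Proof.
move=> vt iv; apply/idP/idP.
  by move=> /(relspace_flip_xz (i := v)); rewrite flipK; apply; apply: xz_v.
move/(relspace_flipP v) => /orP[//|]; have vt' : v \in flip t v by rewrite in_v.
by move/(phi_rel vt')/eqP; rewrite pairD phi_k // phi_v add0r oner_eq0.
Qed.

Let hd x t : v \notin t -> inJ H t (h (dP H x) t + (dr (h x) t + x t)).
Proof.
move=> vt; rewrite h0 // /dP (bigD1 v) /= ?on_v ?in_v // flipK.
have -> : ed H t v (x t) = wd (xgen v) (x t) by rewrite /ed xz_v // wgE.
rewrite (linearD (ct phi)) /= prE (linear_sum (ct phi)) /=.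
have -> : \sum_(i | on H (flip t v) i && (i != v))
    ct phi (ed H (flip (flip t v) i) i (x (flip (flip t v) i))) = dr (h x) t.
  apply: eq_big => [i|i].
    by rewrite on_flip; case: eqVneq => //=; rewrite ?andbF ?addFb.
  rewrite on_flip => /andP[_ iv].
  have vt' : v \notin flip t i by rewrite in_flip eq_sym (negPf iv).
  rewrite flipC h0 // /ed xz_flip_v //; case: ifP => // _.
  by rewrite !wgE ct_wd phi_k // scale0r add0r.
rewrite [dr _ _ + _]addrC addrACA addxx addr0 addrAC addxx add0r.
by apply: inJ_wd; apply: xz_v.
Qed.

Let fam_contraction_Omega1 : fam_contraction hm Em.
Proof.
have hh x t : h (h x) t = 0.
  have [vt|vt] := boolP (v \in t); first by rewrite h1.
  by rewrite h0 // h1 ?in_v // linear0.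
have hE x t : h (E x) t = 0.
  have [vt|vt] := boolP (v \in t); first by rewrite h1.
  by rewrite h0 // E1 ?in_v // ct2.
split=> [x t|x t|x t|x t|x t|x hx hdx t]; rewrite /add_fam -/h -/E.
- by rewrite hh addr0 inJ0.
- have [vt|vt] := boolP (v \in t); first by rewrite !h1 // addr0 inJ0.
  have J : inJ H t (dr (h (h x)) t) by apply: dr_inJ => s; rewrite hh inJ0.
  by rewrite -(inJDl _ J) addrCA hd.
- by rewrite hE addr0 inJ0.
- rewrite addr0; have [vt|vt] := boolP (v \in t); last by rewrite E0 // inJ0.
  by rewrite E1 // h1 // !linear0 inJ0.
- have [vt|vt] := boolP (v \in t); last by rewrite !E0 // addr0 inJ0.
  by rewrite !E1 // [ct phi (wd _ (ct _ _))]prE ct2 linear0 addr0 addxx inJ0.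
have {}hx s : inJ H s (h x s) by have := hx s; rewrite addr0.
have {}hdx s : inJ H s (h (dP H x) s) by have := hdx s; rewrite addr0.
have [vt|vt] := boolP (v \in t).
  rewrite [h _ t]h1 // addr0 E1 // prE addxK.
  have := hx (flip t v); rewrite h0 ?in_v ?vt // flipK => /(inJ_ed v).
  by rewrite flipK /ed xz_v ?in_v ?vt // wgE.
have J y : (forall s, inJ H s (h y s)) -> inJ H t (h (dP H y) t + y t).
  by move=> hy; rewrite -(inJDl _ (dr_inJ hy t)) addrCA hd.
have xJ : inJ H t (x t) by rewrite -(inJDl _ (hdx t)) J.
rewrite (inJDl _ xJ) E0 // add0r.
have := J (E x); rewrite E0 // addr0; apply => s.
by rewrite hE inJ0.
Qed.

Let c t : bool := v \in t.

Let c_clean t : c t -> clean H f t.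
Proof. by move=> _ i k; rewrite codomE => /eqP -> _; rewrite adjmx_sym adj0. Qed.

Let c_flip t i : c (flip t (f i)) = c t.
Proof. by rewrite /c in_flip eq_sym (negPf (fv i)). Qed.

Let M := emb_mono emb c_clean.

Let retr : 'M[F2]_(n.+1, n) :=
  \matrix_k if [pick j | f j == k] is Some j then xgen j else 0.

Let retr_f i : row (f i) retr = xgen i.
Proof.
have [f_inj _ _ _] := emb; rewrite rowK; case: pickP => [j /eqP /f_inj -> //|/(_ i)].
by rewrite eqxx.
Qed.

Let retr_v k : k \notin codom f -> row k retr = 0.
Proof.
move=> kf; rewrite rowK; case: pickP => // j /eqP jk.
by rewrite -jk codom_f in kf.
Qed.

Let retr_sol t : forall y : 'rV_n, sol G (f @^-1: t) (y 0) ->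
  forall k, k \notin codom f -> (k \notin t)%:R * pair y (row k retr) =
    (\sum_(l | (l \notin codom f) && (l \in t)) adjmx H k l * pair y (row l retr)) +
    \sum_j adjmx H k (f j) * ((j \in f @^-1: t)%:R * y 0 j).
Proof.
move=> y _ k kf; rewrite retr_v // pair0 mulr0.
rewrite big1 => [|l /andP[lf _]]; last by rewrite retr_v // pair0 mulr0.
by rewrite big1 ?addr0 // => j _; move: kf; rewrite codomE => /eqP ->; rewrite adj0 mul0r.
Qed.

Let xzE t i : c t -> xz H t (f i) = xz G (f @^-1: t) i.
Proof. by move=> ct; apply: (xz_emb emb (c_clean ct) retr_f (@retr_sol t)). Qed.

Let prM p : ct phi (wd (xgen v) (Lam (embmx f) p)) = Lam (embmx f) p.
Proof.
rewrite ct_wd_Lam // Lam_comp; congr (Lam _ p).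
apply/row_matrixP => i; rewrite row_mul row_embmx projmxE phi_k //.
by rewrite scale0r addr0.
Qed.

Let retrK p : Lam (embmx f) (Lam retr p) = ct phi (wd (xgen v) p).
Proof.
rewrite ct_wd_Lam // Lam_comp; congr (Lam _ p).
apply/row_matrixP => k; rewrite row_mul [row k (projmx _ _)]rowE projmxE.
have [/codomP[i ->]|kf] := boolP (k \in codom f).
  by rewrite retr_f -rowE row_embmx phi_k // scale0r addr0.
rewrite retr_v // mul0mx; move: kf; rewrite codomE => /eqP ->.
by rewrite phi_v scale1r addxx.
Qed.

Lemma kh_Omega1_neg : kh_iso G H.
Proof.
apply: (@kh_reduction _ _ G H (mono_0 G G) (mono_id G) hm Em M).
- exact: fam_contraction_trivial.
- exact: fam_contraction_Omega1.
- move=> x t; rewrite -/E; have [vt|vt] := boolP (v \in t).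
    by rewrite E1 // /mapp /= /c vt prM addxx inJ0.
  by rewrite E0 // /mapp /= /c (negPf vt) addr0 inJ0.
- move=> x x0 s; have := x0 (v |: f @: s); rewrite /mapp /=.
  have [f_inj _ _ _] := emb.
  have ct : c (v |: f @: s) by rewrite /c setU11.
  rewrite ct !addr0 => /(inJ_emb_inv emb (c_clean ct) retr_f (@retr_sol _)).
  have -> : f @^-1: (v |: f @: s) = s; last by [].
  by apply/setP => i; rewrite !inE (negPf (fv i)) mem_imset.
- move=> y; exists (fun s : {set 'I_n} => Lam retr (y (v |: f @: s))) => t.
  rewrite -/E; have [vt|vt] := boolP (v \in t); last first.
    by rewrite E0 // /mapp /= /c (negPf vt) addr0 inJ0.
  rewrite E1 // /mapp /= /c vt; have -> : v |: f @: (f @^-1: t) = t.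
    apply/setP => k; rewrite in_setU1; have [->|kv] := eqVneq k v; first by rewrite vt.
    apply/imsetP/idP => [[i]|kt]; first by rewrite inE => ? ->.
    have := codomE k; rewrite (negPf kv) => /negbFE/codomP[i ki].
    by exists i; rewrite // inE -ki.
  by rewrite retrK addxx inJ0.
move=> x y z t; rewrite -/E; have [vt|vt] := boolP (v \in t); last first.
  by rewrite E0 // /mapp /= /c (negPf vt) addr0 inJ0.
rewrite E1 // [mapp M _ t]/mapp /= /c vt.
have -> : mapp (mono_id G) (dP G (add_fam z (mapp (mono_0 G G) (dP G z)))) (f @^-1: t)
    = dP G x (f @^-1: t).
  by rewrite /mapp /=; apply: eq_bigr => i _; rewrite /add_fam /mapp /= addr0.
rewrite -prM -(linearD (ct phi)) -(linearD (wd _)) /=.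
apply: E_inJ => //.
rewrite -(dP_emb emb c_clean c_flip x) // => [|i]; last first.
  by rewrite xzE ?c_flip // (preim_flip emb).
rewrite {1}/dP (big_codom emb) /=.
set S1 := \sum_(k | _ && _) _; set S2 := \sum_(j | _) _.
set S3 := \sum_(j | _) _; have -> : S2 = S3.
  apply: eq_bigr => i _; rewrite /add_fam -/h h1 ?addr0 //.
  by rewrite in_flip eq_sym (negPf (fv i)).
rewrite -addrA addxx addr0; apply: inJ_sum => k /andP[tk].
rewrite codomE => /eqP ->.
suff e : inJ H (flip t v) (add_fam y (h (dP H y)) (flip t v)).
  by have := inJ_ed v e; rewrite flipK.
have vt' : v \notin flip t v by rewrite in_v vt.
have y0 : y (flip t v) = 0 by rewrite /y /mapp /= /c (negPf vt').
rewrite /add_fam y0 add0r.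
have hy s : h y s = 0.
  have [vs|vs] := boolP (v \in s); first by rewrite h1.
  by rewrite h0 // /y /mapp /= /c in_v vs -prM ct2.
have J : inJ H (flip t v) (dr (h y) (flip t v)).
  by apply: dr_inJ => s; rewrite hy inJ0.
by have := hd y vt'; rewrite y0 addr0 addrC (inJDl _ J).
Qed.

End Omega1.

Section AddIsolated.
Variables (n : nat) (G : lgraph n).

Definition iso_adj (i j : 'I_n.+1) : bool :=
  match unlift ord0 i, unlift ord0 j with
  | Some i', Some j' => adj G i' j'
  | _, _ => false
  end.

Lemma iso_adj_sym : symmetric iso_adj.
Proof.
move=> i j; rewrite /iso_adj; case: (unlift ord0 i); case: (unlift ord0 j) => // *.
exact: adj_sym.
Qed.

Lemma iso_adj_irr : irreflexive iso_adj.
Proof. by move=> i; rewrite /iso_adj; case: unlift => // *; apply: adj_irr. Qed.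

Definition add_isolated : lgraph n.+1 :=
  LGraph (fun i => oapp (fr G) false (unlift ord0 i))
         (fun i => oapp (sgn G) false (unlift ord0 i)) iso_adj_sym iso_adj_irr.

Lemma add_isolated_emb : embeds_as_induced (lift ord0) G add_isolated.
Proof.
split=> [|i j|i|i]; first exact: lift_inj.
- by rewrite /= /iso_adj !liftK.
- by rewrite /= liftK.
by rewrite /= liftK.
Qed.

Lemma add_isolated_adj i : adj add_isolated ord0 i = false.
Proof. by rewrite /= /iso_adj unlift_none. Qed.

Lemma kh_add_isolated : kh_iso G add_isolated.
Proof.
apply: (kh_Omega1_neg add_isolated_emb (v := ord0)) => [i||w|].
- by rewrite eq_sym neq_lift.
- by rewrite /= unlift_none.
- exact: add_isolated_adj.
by rewrite /= unlift_none.
Qed.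

End AddIsolated.

(* Adding an isolated vertex labeled (0, 1) and then one labeled (0, -1) is an
   instance of Omega2. *)
Lemma kh_Omega1 n (G : lgraph n) (H : lgraph n.+1) : Omega1 G H -> kh_iso G H.
Proof.
case=> f [v [emb fv frv adjv]].
have [sv|/negbTE sv] := boolP (sgn H v); last exact: kh_Omega1_neg emb fv frv adjv sv.
apply: lin_iso_trans (lin_iso_sym (kh_add_isolated H)).
apply: kh_Omega2; exists (lift ord0 \o f), ord0, (lift ord0 v).
have [f_inj adjH frH sgnH] := emb.
split.
- split=> [|i j|i|i]; first by apply: inj_comp f_inj; apply: lift_inj.
  + by rewrite /= /iso_adj !liftK adjH.
  + by rewrite /= liftK /= frH.
  by rewrite /= liftK /= sgnH.
- split=> [|i]; first exact: neq_lift.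
  by rewrite eq_sym neq_lift (inj_eq (@lift_inj _ _)) fv.
- by right; rewrite add_isolated_adj /= liftK /= frv unlift_none.
- by rewrite /= liftK unlift_none.
move=> w _ _; rewrite add_isolated_adj /= /iso_adj liftK.
by case: unlift => // w'; rewrite adjv.
Qed.

(** * The move Omega3 *)

Section EdgeComparison.
Variables (n : nat) (G H : lgraph n).

(* wd e kills the multiples of e, so that the two substitutions only have to
   agree up to such multiples. *)
Lemma Lam_cong_mod (A B : 'M[F2]_n) t e (p : ext n) :
  (forall k, exists a : F2, row k A + row k B + a *: e \in relspace H t) ->
  inJ H t (wd e (Lam A p + Lam B p)).
Proof.
move=> AB; elim/ext_ind: p => [||p q pAB qAB|k p pAB].
- by rewrite !linear0 addr0 linear0 inJ0.
- by rewrite !Lam1 addxx linear0 inJ0.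
- by rewrite (linearD (Lam A)) (linearD (Lam B)) /= addrACA linearD inJD.
rewrite !Lam_wg; have [a ABk] := AB k.
have -> : wd (row k A) (Lam A p) + wd (row k B) (Lam B p) =
   wd (row k A + row k B) (Lam A p) + wd (row k B) (Lam A p + Lam B p).
  by rewrite wdD linearD /= addrA; congr (_ + _); rewrite -addrA addxx addr0.
rewrite (linearD (wd e)) /= [wd e (wd (row k B) _)]wdC; apply: inJD; last exact: inJ_wdr.
have -> : wd e (wd (row k A + row k B) (Lam A p)) =
    wd (row k A + row k B + a *: e) (wd e (Lam A p)).
  by rewrite wdC [RHS]wdD wdZ wd2 scaler0 addr0.
exact: inJ_wd.
Qed.

(** For edges of multiplication type the substitutions may differ by multiples of the image of x_j
    under T, since this image is a factor; for edges of quotient type that image is zero at t'. *)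
Lemma ed_compare (A B T : 'M[F2]_n) s t t' i j (p : ext n) :
  xz G s i = xz H t j ->
  row i B + row j T \in relspace H t' ->
  (forall k, exists a : F2,
      row k (A *m T) + row k B + a *: row j T \in relspace H t') ->
  (~~ xz H t j -> row j T \in relspace H t') ->
  inJ H t' (Lam T (ed H t j (Lam A p)) + Lam B (ed G s i p)).
Proof.
move=> st BT ATB Tj; rewrite /ed st; case: ifPn => [_|/Tj Tj']; last first.
  rewrite Lam_comp; apply: Lam_cong => k; have [a] := ATB k.
  move=> ATBk; rewrite -[X in X \in _]addr0 -(addxx (a *: row j T)) addrA.
  by rewrite memvD // memvZ.
rewrite !Lam_wg Lam_comp.
have -> : wd (row j T) (Lam (A *m T) p) + wd (row i B) (Lam B p) =
  wd (row i B + row j T) (Lam B p) + wd (row j T) (Lam (A *m T) p + Lam B p).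
  by rewrite wdD linearD /= [RHS]addrACA addxx addr0 addrC.
by apply: inJD; [apply: inJ_wd | apply: Lam_cong_mod].
Qed.

End EdgeComparison.

Section Omega3.
Variables (n : nat) (G H : lgraph n) (u v w : 'I_n).
Hypotheses (uv : u != v) (uw : u != w) (vw : v != w)
  (labG : forall x, x \in [:: u; v; w] -> fr G x = false /\ sgn G x = false)
  (adjGu : forall x, adj G u x = (x \in [:: v; w]))
  (adjHu : forall x, adj H u x = adj G v x (+) adj G w x)
  (adjH : forall x y, x != u -> y != u -> adj H x y = adj G x y)
  (frH : forall x, fr H x = fr G x)
  (sgnH : forall x, sgn H x = (x \in [:: v; w]) || sgn G x).
Implicit Types (s t : {set 'I_n}) (y : 'I_n -> F2) (k j i : 'I_n).

Let vu : v != u. Proof. by rewrite eq_sym. Qed.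
Let wu : w != u. Proof. by rewrite eq_sym. Qed.
Let wv : w != v. Proof. by rewrite eq_sym. Qed.
Let neqs := (negPf uv, negPf uw, negPf vw, negPf vu, negPf wu, negPf wv).

Let onG_u s : on G s u = (u \in s).
Proof. by rewrite /on; case: (labG (x := u)) => [|_ ->]; rewrite ?inE ?eqxx ?addbF. Qed.
Let onG_v s : on G s v = (v \in s).
Proof. by rewrite /on; case: (labG (x := v)) => [|_ ->]; rewrite ?inE ?eqxx ?orbT ?addbF. Qed.
Let onG_w s : on G s w = (w \in s).
Proof. by rewrite /on; case: (labG (x := w)) => [|_ ->]; rewrite ?inE ?eqxx ?orbT ?addbF. Qed.
Let onH_u s : on H s u = (u \in s).
Proof.
rewrite /on sgnH; case: (labG (x := u)) => [|_ ->]; rewrite !inE ?eqxx //.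
by rewrite !neqs addbF.
Qed.
Let onH_v s : on H s v = (v \notin s).
Proof. by rewrite /on sgnH !inE eqxx addbT. Qed.
Let onH_w s : on H s w = (w \notin s).
Proof. by rewrite /on sgnH !inE eqxx orbT addbT. Qed.

Let rst k := [&& k != u, k != v & k != w].

Let on_rst s t i : rst i -> (i \in s) = (i \in t) -> on G s i = on H t i.
Proof. by case/and3P => iu iv iw st; rewrite /on sgnH !inE (negPf iv) (negPf iw) st. Qed.

Let a : F2 := adjmx G v w.

Let big3 (V : nmodType) (F : 'I_n -> V) :
  \sum_k F k = F u + (F v + (F w + \sum_(k | rst k) F k)).
Proof.
rewrite (bigD1 u) //= (bigD1 v) //= (bigD1 w) ?wu ?wv //=.
by congr (_ + (_ + (_ + _))); apply: eq_bigl => k; rewrite /rst andbA.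
Qed.

Let diagG k : k \in [:: u; v; w] -> adjmx G k k = 0.
Proof. by move=> /labG [frk _]; rewrite mxE eqxx frk. Qed.

Let aGuu : adjmx G u u = 0. Proof. by apply: diagG; rewrite inE eqxx. Qed.
Let aGvv : adjmx G v v = 0. Proof. by apply: diagG; rewrite !inE eqxx orbT. Qed.
Let aGww : adjmx G w w = 0. Proof. by apply: diagG; rewrite !inE eqxx !orbT. Qed.
Let aGuv : adjmx G u v = 1. Proof. by rewrite mxE neqs adjGu !inE eqxx. Qed.
Let aGuw : adjmx G u w = 1. Proof. by rewrite mxE neqs adjGu !inE eqxx orbT. Qed.
Let aGu k : rst k -> adjmx G u k = 0.
Proof.
case/and3P => ku kv kw.
by rewrite mxE eq_sym (negPf ku) adjGu !inE (negPf kv) (negPf kw).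
Qed.

Let aHE j k : j != u -> k != u -> adjmx H j k = adjmx G j k.
Proof. by move=> ju ku; rewrite !mxE frH adjH. Qed.

Let F2_addb (b c : bool) : (b (+) c)%:R = b%:R + c%:R :> F2.
Proof. by case: b; case: c; rewrite ?F2simp. Qed.

Let aHu k : k != u -> adjmx H u k = adjmx G v k + adjmx G w k.
Proof.
move=> ku; rewrite !mxE [u == k]eq_sym (negPf ku) adjHu F2_addb.
have [<-|vk] := eqVneq v k.
  rewrite adj_irr add0r; case: (labG (x := v)) => [|-> _]; last by rewrite neqs add0r.
  by rewrite !inE eqxx orbT.
have [<-|wk] := eqVneq w k => //.
rewrite adj_irr addr0; case: (labG (x := w)) => [|-> _]; last by rewrite addr0.
by rewrite !inE eqxx !orbT.
Qed.

Let aHuu : adjmx H u u = 0.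
Proof. by rewrite mxE eqxx frH; case: (labG (x := u)); rewrite ?inE ?eqxx // => ->. Qed.
Let aHuv : adjmx H u v = a.
Proof. by rewrite aHu // aGvv add0r adjmx_sym. Qed.
Let aHuw : adjmx H u w = a.
Proof. by rewrite aHu // aGww addr0. Qed.

(* alpha is the contribution of the vertices other than u, v, w; L0 describes
   the common Lagrangian of G - u and H - u, with coordinates P, Q at v and w. *)
Let alpha s (y : 'I_n -> F2) j := \sum_(k | rst k) adjmx G j k * ((k \in s)%:R * y k).
Let L0 s y (Pv Pw Qv Qw : F2) :=
  [/\ Qv = a * Pw + alpha s y v, Qw = a * Pv + alpha s y w
    & forall j, rst j -> (j \notin s)%:R * y j =
        adjmx G j v * Pv + (adjmx G j w * Pw + alpha s y j)].

Let p s (y : 'I_n -> F2) k : F2 := (k \in s)%:R * y k.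
Let q s (y : 'I_n -> F2) k : F2 := (k \notin s)%:R * y k.

Let identity_u (b pu pv pw av aw : F2) :
  b * pv + (b * pw + (av + aw)) = b * (pw + pu) + av + (b * (pv + pu) + aw).
Proof. by f2cases. Qed.

Let identity_rest (b d pu pv pw al : F2) :
  (b + d) * pu + (b * pv + (d * pw + al)) = b * (pv + pu) + (d * (pw + pu) + al).
Proof. by f2cases. Qed.

(** In G the vertex u has neighbours v and w only, so p_u merely shifts q_v and q_w, and row u reads
    q_u = p_v + p_w. *)
Let solG s y : sol G s y <->
  L0 s y (p s y v) (p s y w) (q s y v + p s y u) (q s y w + p s y u) /\
  q s y u = p s y v + p s y w.
Proof.
have S0 : \sum_(k | rst k) adjmx G u k * ((k \in s)%:R * y k) = 0.
  by rewrite big1 // => k /aGu ->; rewrite mul0r.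
have rowu : \sum_k adjmx G u k * ((k \in s)%:R * y k) = p s y v + p s y w.
  by rewrite big3 aGuu aGuv aGuw S0 mul0r add0r !mul1r addr0.
have rowv : \sum_k adjmx G v k * ((k \in s)%:R * y k) =
    p s y u + (a * p s y w + alpha s y v).
  by rewrite big3 aGvv [adjmx G v u]adjmx_sym aGuv mul0r add0r mul1r.
have roww : \sum_k adjmx G w k * ((k \in s)%:R * y k) =
    p s y u + (a * p s y v + alpha s y w).
  by rewrite big3 aGww [adjmx G w u]adjmx_sym aGuw mul0r add0r mul1r [adjmx G w v]adjmx_sym.
have rowj j : rst j -> \sum_k adjmx G j k * ((k \in s)%:R * y k) =
    adjmx G j v * p s y v + (adjmx G j w * p s y w + alpha s y j).
  by move=> rj; rewrite big3 [adjmx G j u]adjmx_sym aGu // mul0r add0r.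
split=> [ys|[[Qv Qw Qj] Qu] j].
  split; last by rewrite /q ys rowu.
  split=> [||j rj]; rewrite ?/q ?ys ?rowv ?roww ?rowj //.
    by rewrite addrC addrA addF2 add0r.
  by rewrite addrC addrA addF2 add0r.
have [->|ju] := eqVneq j u; first by rewrite rowu -Qu.
have [->|jv] := eqVneq j v; first by rewrite rowv -Qv addrCA addF2 addr0.
have [->|jw] := eqVneq j w; first by rewrite roww -Qw addrCA addF2 addr0.
by rewrite rowj ?Qj // /rst ju jv jw.
Qed.

(** In H row u of the matrix is the sum of rows v and w. The roles of p and q are exchanged: p_u
    shifts p_v and p_w, and row u becomes q_u = q_v + q_w. *)
Let solH s y : sol H s y <->
  L0 s y (p s y v + p s y u) (p s y w + p s y u) (q s y v) (q s y w) /\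
  q s y u = q s y v + q s y w.
Proof.
have Sj j : j != u -> \sum_(k | rst k) adjmx H j k * ((k \in s)%:R * y k) = alpha s y j.
  by move=> ju; apply: eq_bigr => k /and3P[ku _ _]; rewrite aHE.
have Su : \sum_(k | rst k) adjmx H u k * ((k \in s)%:R * y k) =
    alpha s y v + alpha s y w.
  rewrite -big_split; apply: eq_bigr => k /and3P[ku _ _] /=.
  by rewrite aHu // mulrDl.
have rowv : \sum_k adjmx H v k * ((k \in s)%:R * y k) =
    a * (p s y w + p s y u) + alpha s y v.
  rewrite big3 Sj // [adjmx H v u]adjmx_sym aHuv !aHE // aGvv mul0r add0r.
  by rewrite mulrDr addrA [a * p s y w + _]addrC.
have roww : \sum_k adjmx H w k * ((k \in s)%:R * y k) =
    a * (p s y v + p s y u) + alpha s y w.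
  rewrite big3 Sj // [adjmx H w u]adjmx_sym aHuw !aHE // aGww mul0r add0r.
  by rewrite [adjmx G w v]adjmx_sym mulrDr addrA [a * p s y v + _]addrC.
have rowu : \sum_k adjmx H u k * ((k \in s)%:R * y k) =
    (a * (p s y w + p s y u) + alpha s y v) + (a * (p s y v + p s y u) + alpha s y w).
  rewrite big3 Su aHuu aHuv aHuw mul0r add0r.
  exact: identity_u.
have rowj j : rst j -> \sum_k adjmx H j k * ((k \in s)%:R * y k) =
    adjmx G j v * (p s y v + p s y u) + (adjmx G j w * (p s y w + p s y u) + alpha s y j).
  case/and3P => ju jv jw; rewrite big3 Sj // [adjmx H j u]adjmx_sym aHu // !aHE //.
  rewrite [adjmx G v j]adjmx_sym [adjmx G w j]adjmx_sym.
  exact: identity_rest.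
split=> [ys|[[Qv Qw Qj] Qu] j].
  split; last by rewrite /q !ys rowu rowv roww.
  by split=> [||j rj]; rewrite ?/q ?ys ?rowv ?roww ?rowj.
have [->|ju] := eqVneq j u; first by rewrite rowu -Qv -Qw -Qu.
have [->|jv] := eqVneq j v; first by rewrite rowv -Qv.
have [->|jw] := eqVneq j w; first by rewrite roww -Qw.
by rewrite rowj ?Qj // /rst ju jv jw.
Qed.

Let L0_rest s t y z Pv Pw Qv Qw :
  (forall k, rst k -> (k \in s) = (k \in t)) -> (forall k, rst k -> z k = y k) ->
  L0 s z Pv Pw Qv Qw -> L0 t y Pv Pw Qv Qw.
Proof.
move=> st zy; have alE j : alpha s z j = alpha t y j.
  by apply: eq_bigr => k rk; rewrite st // zy.
by case=> Qv' Qw' Qj; split=> [||j rj]; rewrite -?alE -?st // -?zy // Qj.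
Qed.

(** * The substitutions of x_u, x_v, x_w and the surviving states *)

Let mat3 (ru rv rw : 'rV[F2]_n) : 'M[F2]_n :=
  \matrix_k (if k == u then ru else if k == v then rv else if k == w then rw
             else xgen k).

Let mat3u ru rv rw : row u (mat3 ru rv rw) = ru. Proof. by rewrite rowK eqxx. Qed.
Let mat3v ru rv rw : row v (mat3 ru rv rw) = rv.
Proof. by rewrite rowK neqs eqxx. Qed.
Let mat3w ru rv rw : row w (mat3 ru rv rw) = rw.
Proof. by rewrite rowK !neqs eqxx. Qed.
Let mat3r ru rv rw k : rst k -> row k (mat3 ru rv rw) = xgen k.
Proof. by case/and3P => /negPf ku /negPf kv /negPf kw; rewrite rowK ku kv kw. Qed.
Let mat3E := (mat3u, mat3v, mat3w).

Let xu : 'rV[F2]_n := xgen u.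
Let xv : 'rV[F2]_n := xgen v.
Let xw : 'rV[F2]_n := xgen w.
(** The rows of the three matrices are chosen so that, in each of the five surviving patterns of u,
    v, w, the coordinates of [L0] agree for the two graphs, as [sol_free] verifies. *)
Let Aa := mat3 (xu + xv + xw) xv xw.
Let Ab := mat3 xv (xu + xv + xw) xu.
Let Ac := mat3 xw xu (xu + xv + xw).

Let xmulE (ru rv rw : 'rV[F2]_n) :
  (xu *m mat3 ru rv rw = ru) * (xv *m mat3 ru rv rw = rv) * (xw *m mat3 ru rv rw = rw).
Proof. by rewrite /xu /xv /xw -!rowE !mat3E. Qed.

Let rowP3 (A B : 'M[F2]_n) : row u A = row u B -> row v A = row v B ->
  row w A = row w B -> (forall k, rst k -> row k A = row k B) -> A = B.
Proof.
move=> Au Av Aw Ar; apply/row_matrixP => k.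
have [->//|ku] := eqVneq k u; have [->//|kv] := eqVneq k v.
by have [->//|kw] := eqVneq k w; apply: Ar; rewrite /rst ku kv kw.
Qed.

Let sum3 (V : lmodType F2) (x y z : V) : x + y + z + y + z = x.
Proof.
by rewrite [x + y + z + y]addrAC -[x + y + y]addrA addxx addr0 -addrA addxx addr0.
Qed.

Let sum4 (V : lmodType F2) (x y z : V) : z + x + (x + y + z) = y.
Proof. by rewrite addrC addrA -[x + y + z + z]addrA addxx addr0 addrAC addxx add0r. Qed.

Let sum5 (V : lmodType F2) (x y z : V) : y + (x + y + z) + x = z.
Proof. by rewrite addrAC [x + y]addrC addxK. Qed.

Let AaK : Aa *m Aa = 1%:M.
Proof.
apply: rowP3 => [|||k rk]; rewrite /Aa /Ab /Ac row_mul [row _ 1%:M]rowE mulmx1 ?mat3E ?mulmxDl ?xmulE //.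
  by rewrite sum3.
by rewrite mat3r // -rowE mat3r.
Qed.

Let AbcK : Ab *m Ac = 1%:M.
Proof.
apply: rowP3 => [|||k rk]; rewrite /Aa /Ab /Ac row_mul [row _ 1%:M]rowE mulmx1 ?mat3E ?mulmxDl ?xmulE //.
  exact: sum4.
by rewrite mat3r // -rowE mat3r.
Qed.

Let AcbK : Ac *m Ab = 1%:M.
Proof.
apply: rowP3 => [|||k rk]; rewrite /Aa /Ab /Ac row_mul [row _ 1%:M]rowE mulmx1 ?mat3E ?mulmxDl ?xmulE //.
  exact: sum5.
by rewrite mat3r // -rowE mat3r.
Qed.

(* freeG and freeH are the states left after the cancellation; mixs and locm t
   identify the reduced complexes: exterior polynomials of G at mixs t become
   exterior polynomials of H at t by the substitution locm t of x_u, x_v, x_w. *)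
Let freeH t := (w \notin t) || ((u \notin t) && (v \notin t)).
Let freeG s := (w \in s) || ((u \notin s) && (v \in s)).

Let mixs t :=
  if w \in t then t else if v \in t then (if u \in t then flip (flip t u) w else t)
  else if u \in t then flip (flip t v) w else flip (flip t u) w.
Let mixi s :=
  if w \in s then (if v \in s then (if u \in s then flip (flip s v) w else flip (flip s u) w)
                 else (if u \in s then flip (flip s u) w else s)) else s.
Let locm t := if w \in t then Aa else if v \in t then (if u \in t then Ab else Aa) else Ac.
Let invm t := if w \in t then Aa else if v \in t then (if u \in t then Ac else Aa) else Ab.

Let inE3 t k i : (k \in flip t i) = (k == i) (+) (k \in t). Proof. exact: in_flip. Qed.

Let mixs_rst t k : rst k -> (k \in mixs t) = (k \in t).
Proof.
case/and3P => /negPf ku /negPf kv /negPf kw; rewrite /mixs.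
by repeat case: ifP => _; rewrite ?inE3 ?ku ?kv ?kw ?addFb.
Qed.

Let in_mixs t : freeH t ->
  [/\ (u \in mixs t) = (w \notin t) && (v \notin t),
      (v \in mixs t) = (w \notin t) && ((u \in t) || (v \in t))
    & (w \in mixs t) = [|| w \in t, ~~ (v \in t) | u \in t]].
Proof.
rewrite /freeH /mixs; case: (boolP (u \in t)) => ut; case: (boolP (v \in t)) => vt;
 case: (boolP (w \in t)) => wt //= _; rewrite ?inE3 ?eqxx ?neqs ?ut ?vt ?wt;
 rewrite ?(negPf ut) ?(negPf vt) ?(negPf wt) //.
Qed.

Let loc_inv t : locm t *m invm t = 1%:M.
Proof. by rewrite /locm /invm; repeat case: ifP => _; rewrite ?AaK ?AbcK ?AcbK. Qed.
Let inv_loc t : invm t *m locm t = 1%:M.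
Proof. by rewrite /locm /invm; repeat case: ifP => _; rewrite ?AaK ?AbcK ?AcbK. Qed.

Let row_locm t k : rst k -> row k (locm t) = xgen k.
Proof. by move=> rk; rewrite /locm; repeat case: ifP => _; apply: mat3r. Qed.

Let F2_10 : ((1 : F2) == 0) = false. Proof. exact: oner_eq0. Qed.
Let F2_01 : ((0 : F2) == 1) = false. Proof. by rewrite eq_sym oner_eq0. Qed.

Let sol_free t (y : 'rV[F2]_n) : freeH t ->
  sol G (mixs t) (fun k => pair y (row k (locm t))) <-> sol H t (y 0).
Proof.
move=> ft; have [mu mv mw] := in_mixs ft.
set z := fun k => _.
have zr k : rst k -> z k = y 0 k by move=> rk; rewrite /z row_locm // pair_delta.
have Lz Pv Pw Qv Qw : L0 (mixs t) z Pv Pw Qv Qw <-> L0 t (y 0) Pv Pw Qv Qw.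
  split; apply: L0_rest => k rk; rewrite ?zr ?mixs_rst //.
(* The rest of the graph enters only through [L0]. What remains concerns y at u, v, w: the two
   equations at u are equivalent, and under them the coordinates of [L0] coincide. *)
suff [e1 e2] : (q (mixs t) z u == p (mixs t) z v + p (mixs t) z w) =
       (q t (y 0) u == q t (y 0) v + q t (y 0) w) /\
    (q t (y 0) u == q t (y 0) v + q t (y 0) w ->
      [/\ p (mixs t) z v = p t (y 0) v + p t (y 0) u,
        p (mixs t) z w = p t (y 0) w + p t (y 0) u,
        q (mixs t) z v + p (mixs t) z u = q t (y 0) v &
        q (mixs t) z w + p (mixs t) z u = q t (y 0) w]).
  split=> [/solG [L /eqP]|/solH [L /eqP]].
    rewrite e1 => qe; apply/solH; split; last exact/eqP.
    by have [<- <- <- <-] := e2 qe; apply/Lz.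
  move=> qe; apply/solG; split; last by apply/eqP; rewrite e1.
  by have [-> -> -> ->] := e2 qe; apply/Lz.
rewrite /p /q mu mv mw /z /locm; move: ft; rewrite /freeH.
case: (boolP (u \in t)) => ut; case: (boolP (v \in t)) => vt;
 case: (boolP (w \in t)) => wt //= _; rewrite ?F2simp ?mat3E ?pairD ?pair_delta ?F2simp.
all: case: (F2P (y 0 u)) => ->; case: (F2P (y 0 v)) => ->; case: (F2P (y 0 w)) => ->.
all: by rewrite ?F2simp ?F2_10 ?F2_01; split=> // _; split; rewrite ?F2simp.
Qed.

Let sol_freeP t (y : 'rV[F2]_n) : freeH t -> sol G (mixs t) (y 0) ->
  sol H t (fun k => pair y (row k (invm t))).
Proof.
move=> ft ys; pose y' : 'rV[F2]_n := \row_k pair y (row k (invm t)).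
apply: (@sol_ext _ _ _ (y' 0)) => [k|]; first by rewrite mxE.
apply/sol_free => //; apply: sol_ext ys => k.
by rewrite -pair_mul -row_mul loc_inv rowE mulmx1 pair_delta.
Qed.

Let relspace_free t r : freeH t ->
  (r \in relspace G (mixs t)) = (r *m locm t \in relspace H t).
Proof.
move=> ft; apply/idP/idP; first by apply: relspace_map => y /sol_free; apply.
have : forall r', r' \in relspace H t -> r' *m invm t \in relspace G (mixs t).
  by apply: relspace_map => y; apply: sol_freeP.
by move=> h /h; rewrite -mulmxA loc_inv mulmx1.
Qed.

(** At the corner 10 of either graph all [L0] coordinates of this covector vanish and the equation
    at u holds, so it serves both cancellations. *)
Let phi : 'rV[F2]_n := xu + xv + xw.

Let phi_u : phi 0 u = 1. Proof. by rewrite !mxE !eqxx !neqs !addr0. Qed.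
Let phi_v : phi 0 v = 1. Proof. by rewrite !mxE !eqxx !neqs add0r addr0. Qed.
Let phi_w : phi 0 w = 1. Proof. by rewrite !mxE !eqxx !neqs !add0r. Qed.
Let phi_r k : rst k -> phi 0 k = 0.
Proof. by case/and3P => /negPf ku /negPf kv /negPf kw; rewrite !mxE ku kv kw !addr0. Qed.

Let B := [set w].
Let uB : u \notin B. Proof. by rewrite in_set1. Qed.
Let vB : v \notin B. Proof. by rewrite in_set1. Qed.

Let phi_rest i : rest u v B i -> phi 0 i = 0.
Proof. by rewrite /rest in_set1 => /and3P[iw iu iv]; apply: phi_r; apply/and3P. Qed.

Let offG s : off G B s = (w \notin s).
Proof.
rewrite -onG_w; apply/forall_inP/idP => [|ws i]; first by apply; rewrite in_set1.
by rewrite in_set1 => /eqP ->.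
Qed.
Let offH s : off H B s = (w \in s).
Proof.
rewrite -[w \in s]negbK -onH_w; apply/forall_inP/idP => [|ws i]; first by apply; rewrite in_set1.
by rewrite in_set1 => /eqP ->.
Qed.

Let L0_phi s : L0 s (phi 0) 0 0 0 0.
Proof.
have al0 j : alpha s (phi 0) j = 0.
  by rewrite /alpha big1 // => k rk; rewrite phi_r // !mulr0.
by split=> [||j rj]; rewrite ?al0 ?phi_r // !mulr0 !addr0.
Qed.

Let phi_relG s : on G s u -> ~~ on G s v -> off G B s ->
  forall r, r \in relspace G s -> pair phi r = 0.
Proof.
rewrite onG_u onG_v offG => us vs ws r /relspaceP; apply; apply/solG.
rewrite /p /q us (negPf vs) (negPf ws) phi_u phi_v phi_w !F2simp.
by split; [apply: L0_phi|].
Qed.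

Let phi_relH s : on H s u -> ~~ on H s v -> off H B s ->
  forall r, r \in relspace H s -> pair phi r = 0.
Proof.
rewrite onH_u onH_v negbK offH => us vs ws r /relspaceP; apply; apply/solH.
rewrite /p /q us vs ws phi_u phi_v phi_w !F2simp.
by split; [apply: L0_phi|].
Qed.

Let xz_uG s : ~~ on G s u -> ~~ on G s v -> off G B s -> xz G s u.
Proof.
rewrite onG_u onG_v offG => us vs ws; apply/relspaceP => y /solG [_].
by rewrite /p /q us (negPf vs) (negPf ws) pair_delta !F2simp.
Qed.

Let xz_uH s : ~~ on H s u -> ~~ on H s v -> off H B s -> xz H s u.
Proof.
rewrite onH_u onH_v negbK offH => us vs ws; apply/relspaceP => y /solH [_].
by rewrite /p /q us vs ws pair_delta !F2simp.
Qed.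

Let CG := cancellation uv uB vB phi_u phi_v phi_rest phi_relG xz_uG.
Let CH := cancellation uv uB vB phi_u phi_v phi_rest phi_relH xz_uH.
Let hG := cancel_h uv uB vB phi_v phi_relG xz_uG.
Let hH := cancel_h uv uB vB phi_v phi_relH xz_uH.
Let EG := cancel_E G u v B.
Let EH := cancel_E H u v B.

Let EG_cond s : mcond EG s = freeG s.
Proof. by rewrite /= offG onG_u onG_v negbK. Qed.
Let EH_cond s : mcond EH s = freeH s.
Proof. by rewrite /= offH onH_u onH_v. Qed.

Let M_inJ t r : freeH t -> inJ G (mixs t) r -> inJ H t (Lam (locm t) r).
Proof. by move=> ft; apply: inJ_Lam => r'; rewrite relspace_free. Qed.

Let M : mono G H := @Mono _ _ G H freeH mixs (fun t => Lam (locm t)) M_inJ.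

Let freeG_mixs t : freeH t -> freeG (mixs t).
Proof.
move=> ft; have [mu mv mw] := in_mixs ft; rewrite /freeG mu mv mw; move: ft; rewrite /freeH.
by case: (u \in t); case: (v \in t); case: (w \in t).
Qed.

Let mixiK s : freeG s -> freeH (mixi s) /\ mixs (mixi s) = s.
Proof.
rewrite /freeG /freeH /mixs /mixi.
case: (boolP (u \in s)) => us; case: (boolP (v \in s)) => vs;
 case: (boolP (w \in s)) => ws //= _;
 rewrite ?inE3 ?eqxx ?neqs ?us ?vs ?ws ?(negPf us) ?(negPf vs) ?(negPf ws) /=.
all: split=> //; apply/setP => k; rewrite ?inE3.
all: by case: (k == u); case: (k == v); case: (k == w); case: (k \in s).
Qed.

Let mixsK t : freeH t -> mixi (mixs t) = t.
Proof.
rewrite /freeH /mixs /mixi.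
case: (boolP (u \in t)) => us; case: (boolP (v \in t)) => vs;
 case: (boolP (w \in t)) => ws //= _;
 rewrite ?inE3 ?eqxx ?neqs ?us ?vs ?ws ?(negPf us) ?(negPf vs) ?(negPf ws) /=.
all: apply/setP => k; rewrite ?inE3.
all: by case: (k == u); case: (k == v); case: (k == w); case: (k \in t).
Qed.
(** The sum of the relations of H at u, v, w, dualized: the row sums cancel. The tactic [memH]
    derives every membership from this single relation. *)
Let kapH t y : sol H t y -> (u \notin t)%:R * y u + ((v \notin t)%:R * y v + (w \notin t)%:R * y w) == 0.
Proof. by move=> /solH [_]; rewrite /q => ->; rewrite addF2. Qed.

Ltac memH E :=
  apply/relspaceP; let z := fresh "z" in let zt := fresh "zt" in
  move=> z zt; have := kapH zt; rewrite ?E /=;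
  rewrite /xu /xv /xw ?pairD ?pairZ ?pairD ?pair0 ?pair_delta ?F2simp;
  let e := fresh "e" in
  case: (F2P (z 0 u)) => e; rewrite ?e {e}; case: (F2P (z 0 v)) => e; rewrite ?e {e};
  case: (F2P (z 0 w)) => e; rewrite ?e {e};
  by rewrite ?F2simp ?F2_10 ?F2_01.

Let rows3 (P : 'I_n -> Prop) : P u -> P v -> P w -> (forall k, rst k -> P k) ->
  forall k, P k.
Proof.
move=> Pu Pv Pw Pr k; have [->//|ku] := eqVneq k u; have [->//|kv] := eqVneq k v.
by have [->//|kw] := eqVneq k w; apply: Pr; rewrite /rst ku kv kw.
Qed.

(** By [ct_wd_Lam], the matrix of [ctv], that is, of the backward step of a zigzag. *)
Let T := projmx phi xv.

Let TE k : row k T = xgen k + phi 0 k *: xv.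
Proof. by rewrite rowE projmxE pair_delta. Qed.

Let Tu : row u T = xu + xv. Proof. by rewrite TE phi_u scale1r. Qed.
Let Tv : row v T = 0. Proof. by rewrite TE phi_v scale1r addxx. Qed.
Let Tw : row w T = xw + xv. Proof. by rewrite TE phi_w scale1r. Qed.
Let Tr k : rst k -> row k T = xgen k.
Proof. by move=> rk; rewrite TE phi_r // scale0r addr0. Qed.
Let xmulT : (xu *m T = xu + xv) * (xv *m T = 0) * (xw *m T = xw + xv).
Proof. by rewrite /xu /xv /xw -!rowE Tu Tv Tw. Qed.

Let row_one k : row k (1%:M : 'M[F2]_n) = xgen k.
Proof. by rewrite rowE mulmx1. Qed.

Let xz_free t i j : freeH t -> row i (locm t) + xgen j \in relspace H t ->
  xz G (mixs t) i = xz H t j.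
Proof.
move=> ft ij; rewrite /xz relspace_free // /xgen -rowE -/(xgen j).
rewrite -(relspaceDl (row i (locm t)) ij) addrAC addxx add0r.
by [].
Qed.

Let mixs_id s : w \in s \/ (u \notin s /\ v \in s) -> mixs s = s.
Proof. by rewrite /mixs => -[->//|[/negPf -> ->]]; case: ifP. Qed.
Let locm_a s : w \in s \/ (u \notin s /\ v \in s) -> locm s = Aa.
Proof. by rewrite /locm => -[->//|[/negPf -> ->]]; case: ifP. Qed.

(* The edges of the reduced complexes in the directions u, v, w match. An edge
   that passes through a cancelled pair of states gets composed with T. *)
Section Corners.
Variable t : {set 'I_n}.

Let cmp1 (A A' : 'M[F2]_n) s s' i j r :
  xz G s i = xz H s' j -> row i A' + xgen j \in relspace H (flip s' j) ->
  (exists b : F2, row u A + row u A' + b *: xgen j \in relspace H (flip s' j)) ->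
  (exists b : F2, row v A + row v A' + b *: xgen j \in relspace H (flip s' j)) ->
  (exists b : F2, row w A + row w A' + b *: xgen j \in relspace H (flip s' j)) ->
  (forall k, rst k -> row k A = row k A') ->
  inJ H (flip s' j) (ed H s' j (Lam A r) + Lam A' (ed G s i r)).
Proof.
move=> ss ij Au Av Aw Ar; rewrite -[X in X + _]Lam_id.
apply: ed_compare; rewrite ?row_one ?mulmx1 //; last exact: xz_flip.
apply: rows3 => // k rk; exists 0.
by rewrite Ar // scale0r addr0 addxx mem0v.
Qed.

Section Empty.
Hypotheses (ut : (u \in t) = false) (vt : (v \in t) = false) (wt : (w \in t) = false).

Let t'E := (in_flip, eqxx, neqs, ut, vt, wt, flipK).

(** With states named by their part in {u, v, w}: {w} to {} along w in H corresponds to {w} to {u,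
    w} along u in G. *)
Lemma edge1 r : inJ H t (ed H (flip t w) w (Lam Aa r) + Lam Ac (ed G (flip t w) u r)).
Proof.
rewrite -{1}[t](flipK t w); apply: cmp1.
- rewrite -{1}[flip t w]mixs_id; last by left; rewrite !t'E.
  apply: xz_free; first by rewrite /freeH !t'E.
  rewrite locm_a; last by left; rewrite !t'E.
  by rewrite /Aa mat3E; memH t'E.
- by rewrite /Ac mat3E; memH t'E.
- by exists 1; rewrite /Aa /Ac !mat3E; memH t'E.
- by exists 1; rewrite /Aa /Ac !mat3E; memH t'E.
- by exists 1; rewrite /Aa /Ac !mat3E; memH t'E.
by move=> k rk; rewrite !mat3r.
Qed.

(** The edge {v} to {} of H corresponds to the zigzag of G from {v} to {u, v}, backwards to {u},
    then to {u, w}. *)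
Lemma edge2 r : inJ H t (ed H (flip t v) v (Lam Aa r) +
  Lam (T *m Ac) (ed G (flip t v) u r)).
Proof.
rewrite -{1}[t](flipK t v); apply: cmp1.
- rewrite -{1}[flip t v]mixs_id; last by right; rewrite !t'E.
  apply: xz_free; first by rewrite /freeH !t'E.
  rewrite locm_a; last by right; rewrite !t'E.
  by rewrite /Aa mat3E; memH t'E.
- by rewrite row_mul Tu /Ac mulmxDl !xmulE; memH t'E.
- by exists 1; rewrite row_mul Tu /Aa /Ac mulmxDl !xmulE !mat3E; memH t'E.
- by exists 1; rewrite row_mul Tv mul0mx /Aa !mat3E; memH t'E.
- by exists 1; rewrite row_mul Tw /Aa /Ac mulmxDl !xmulE !mat3E; memH t'E.
by move=> k rk; rewrite row_mul Tr // -rowE !mat3r.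
Qed.
End Empty.

Section UV.
Hypotheses (ut : u \in t) (vt : v \in t) (wt : (w \in t) = false).

Let t'E := (in_flip, eqxx, neqs, ut, vt, wt, flipK).

(** The edge {v} to {u, v} of H corresponds to {v} to {v, w} in G. *)
Lemma edge3 r : inJ H t (ed H (flip t u) u (Lam Aa r) + Lam Ab (ed G (flip t u) w r)).
Proof.
rewrite -{1}[t](flipK t u); apply: cmp1.
- rewrite -{1}[flip t u]mixs_id; last by right; rewrite !t'E.
  apply: xz_free; first by rewrite /freeH !t'E.
  rewrite locm_a; last by right; rewrite !t'E.
  by rewrite /Aa mat3E; memH t'E.
- by rewrite /Ab mat3E; memH t'E.
- by exists 1; rewrite /Aa /Ab !mat3E; memH t'E.
- by exists 1; rewrite /Aa /Ab !mat3E; memH t'E.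
- by exists 1; rewrite /Aa /Ab !mat3E; memH t'E.
by move=> k rk; rewrite !mat3r.
Qed.

Let s := flip (flip (flip t w) v) u.

(** Here the zigzag is in H: {w} to {u, w}, backwards to {u, v, w}, then to {u, v}. It corresponds
    to the edge {w} to {v, w} of G. *)
Lemma edge4 r : inJ H t (Lam T (ed H s u (Lam Aa r)) + Lam Ab (ed G s v r)).
Proof.
have sH : freeH s by rewrite /freeH /s !t'E.
have sw : w \in s \/ (u \notin s /\ v \in s) by left; rewrite /s !t'E.
apply: ed_compare.
- rewrite -{1}[s]mixs_id //; apply: xz_free => //.
  by rewrite locm_a // /Aa mat3E; memH (t'E, erefl s).
- by rewrite /Ab mat3E Tu; memH t'E.
- apply: rows3 => [|||k rk].
  + by exists 1; rewrite row_mul Tu /Aa /Ab !mat3E !mulmxDl !xmulT; memH t'E.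
  + by exists 1; rewrite row_mul Tu /Aa /Ab !mat3E ?mulmxDl !xmulT; memH t'E.
  + by exists 1; rewrite row_mul Tu /Aa /Ab !mat3E ?mulmxDl !xmulT; memH t'E.
  by exists 0; rewrite scale0r addr0 row_mul !mat3r // -rowE Tr // addxx mem0v.
(* If x_u is nonzero at s, it is zero at {u, w}. At {u, v, w} then x_u or x_u + x_v is zero, and
   [phi] excludes x_u. The relation x_u + x_v persists at t, where x_w is zero. *)
move=> nz; rewrite Tu.
have tw_phi : forall r', r' \in relspace H (flip t w) -> pair phi r' = 0.
  by apply: phi_relH; rewrite ?onH_u ?onH_v ?offH !t'E.
have : xz H (flip s u) u by apply: xz_flip.
rewrite /s flipK => /(relspace_flipP v); rewrite flipK => /orP[/tw_phi/eqP|].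
  by rewrite pair_delta phi_u oner_eq0.
suff tw : xz H (flip (flip t w) w) w.
  by move=> /(relspace_flip_xz tw); rewrite flipK.
by apply: xz_flip; apply/negP => /tw_phi/eqP; rewrite pair_delta phi_w oner_eq0.
Qed.
End UV.

Section U.
Hypotheses (ut : u \in t) (vt : (v \in t) = false) (wt : (w \in t) = false).

Let t'E := (in_flip, eqxx, neqs, ut, vt, wt, flipK).

(** The edge {} to {u} of H corresponds to {u, w} to {u, v, w} in G. *)
Lemma edge5 r : inJ H t (ed H (flip t u) u (Lam Ac r) +
  Lam Ac (ed G (flip (mixs t) v) v r)).
Proof.
have e : flip (mixs t) v = mixs (flip t u).
  by rewrite /mixs !t'E /= flipC !flipK.
rewrite -{1}[t](flipK t u) e; apply: cmp1.
- apply: xz_free; first by rewrite /freeH !t'E.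
  by rewrite /locm !t'E /= /Ac mat3E addxx mem0v.
- by rewrite /Ac mat3E; memH t'E.
- by exists 0; rewrite addxx scale0r addr0 mem0v.
- by exists 0; rewrite addxx scale0r addr0 mem0v.
- by exists 0; rewrite addxx scale0r addr0 mem0v.
by [].
Qed.

(** The edge {u, v} to {u} of H corresponds to {v, w} to {u, v, w} in G. *)
Lemma edge6 r : inJ H t (ed H (flip t v) v (Lam Ab r) +
  Lam Ac (ed G (flip (mixs t) u) u r)).
Proof.
have e : flip (mixs t) u = mixs (flip t v).
  by rewrite /mixs !t'E /= [RHS]flipC flipC; congr flip; rewrite flipC.
rewrite -{1}[t](flipK t v) e; apply: cmp1.
- apply: xz_free; first by rewrite /freeH !t'E.
  by rewrite /locm !t'E /= /Ab mat3E addxx mem0v.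
- by rewrite /Ac mat3E; memH t'E.
- by exists 0; rewrite /Ab /Ac !mat3E; memH t'E.
- by exists 0; rewrite /Ab /Ac !mat3E; memH t'E.
- by exists 0; rewrite /Ab /Ac !mat3E; memH t'E.
by move=> k rk; rewrite !mat3r.
Qed.
End U.
End Corners.
Let mixs_flip t i : rst i -> mixs (flip t i) = flip (mixs t) i.
Proof.
move=> /and3P[/negPf iu /negPf iv /negPf iw].
have [eu ev ew] : [/\ (u \in flip t i) = (u \in t), (v \in flip t i) = (v \in t)
  & (w \in flip t i) = (w \in t)] by rewrite !in_flip ![_ == i]eq_sym iu iv iw.
apply/setP => k; rewrite /mixs eu ev ew in_flip.
case: (w \in t); case: (v \in t); case: (u \in t); rewrite !in_flip //.
all: by case: (k == i); case: (k == u); case: (k == v); case: (k == w); case: (k \in t).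
Qed.

Let free_flip t i : rst i -> freeH (flip t i) = freeH t.
Proof.
move=> /and3P[/negPf iu /negPf iv /negPf iw].
by rewrite /freeH !in_flip ![_ == i]eq_sym iu iv iw !addFb.
Qed.

Let locm_flip t i : rst i -> locm (flip t i) = locm t.
Proof.
move=> /and3P[/negPf iu /negPf iv /negPf iw].
by rewrite /locm !in_flip ![_ == i]eq_sym iu iv iw !addFb.
Qed.

(** * Comparison of the two reduced differentials *)

Section Differential.
Variable x : {set 'I_n} -> ext n.
Let z := mapp EG x.
Let Y := mapp M z.
Let ZZ := add_fam z (mapp hG (dP G z)).
Let YY := add_fam Y (mapp hH (dP H Y)).

Let z0 s : ~~ freeG s -> z s = 0.
Proof. by rewrite /z /mapp EG_cond => /negPf ->. Qed.
Let Y0 t : ~~ freeH t -> Y t = 0.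
Proof. by rewrite /Y /mapp /= => /negPf ->. Qed.
Let YE t : freeH t -> Y t = Lam (locm t) (z (mixs t)).
Proof. by rewrite {1}/Y /mapp /= => ->. Qed.

Let Ez s : mapp EG z s = z s.
Proof. by rewrite {1}/mapp EG_cond; case: ifP => // /negbT /z0 ->. Qed.
Let EY t : mapp EH Y t = Y t.
Proof. by rewrite {1}/mapp EH_cond; case: ifP => // /negbT /Y0 ->. Qed.

Let ZZ_free s : freeG s -> ZZ s = z s.
Proof.
move=> fs; rewrite /ZZ /add_fam hd_0 ?addr0 // onG_v offG negbK.
by move: fs; rewrite /freeG; case: (w \in s); case: (v \in s); rewrite ?andbF.
Qed.
Let YY_free t : freeH t -> YY t = Y t.
Proof.
move=> ft; rewrite /YY /add_fam hd_0 ?addr0 // onH_v offH.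
by move: ft; rewrite /freeH; case: (w \in t); case: (v \in t); rewrite ?andbF.
Qed.

Let ZZ_00 s : u \notin s -> v \notin s -> w \notin s -> inJ G s (ZZ s).
Proof.
move=> us vs ws; rewrite /ZZ /add_fam z0 ?add0r.
  by apply: hd_00; rewrite ?onG_u ?onG_v ?offG.
by rewrite /freeG (negPf vs) (negPf ws) andbF.
Qed.
Let YY_00 t : u \notin t -> v \in t -> w \in t -> inJ H t (YY t).
Proof.
move=> us vs ws; rewrite /YY /add_fam Y0 ?add0r.
  by apply: hd_00; rewrite ?onH_u ?onH_v ?offH ?negbK.
by rewrite /freeH vs ws andbF.
Qed.

Let ZZ_10 s : u \in s -> v \notin s -> w \notin s ->
  inJ G s (ZZ s + Lam T (ed G (flip (flip s v) u) u (z (flip (flip s v) u)))).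
Proof.
move=> us vs ws; rewrite /ZZ /add_fam z0 ?add0r.
  rewrite -ct_wd_Lam; last by rewrite pair_delta.
  by apply: hd_10; rewrite ?onG_u ?onG_v ?offG.
by rewrite /freeG (negPf vs) (negPf ws) andbF.
Qed.
Let YY_10 t : u \in t -> v \in t -> w \in t ->
  inJ H t (YY t + Lam T (ed H (flip (flip t v) u) u (Y (flip (flip t v) u)))).
Proof.
move=> us vs ws; rewrite /YY /add_fam Y0 ?add0r.
  rewrite -ct_wd_Lam; last by rewrite pair_delta.
  by apply: hd_10; rewrite ?onH_u ?onH_v ?offH ?negbK.
by rewrite /freeH us ws.
Qed.

Let ZZ_11 s : u \in s -> v \in s -> w \notin s -> ZZ s = 0.
Proof.
move=> us vs ws; rewrite /ZZ /add_fam z0 ?add0r ?hd_0 ?onG_v ?vs //.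
by rewrite /freeG us (negPf ws).
Qed.
Let YY_11 t : u \in t -> v \notin t -> w \in t -> YY t = 0.
Proof.
move=> us vs ws; rewrite /YY /add_fam Y0 ?add0r ?hd_0 ?onH_v ?vs //.
by rewrite /freeH us ws.
Qed.

Let tG i s := if on G s i then ed G (flip s i) i (ZZ (flip s i)) else 0.
Let tH i t := if on H t i then ed H (flip t i) i (YY (flip t i)) else 0.

Let tG_inJ i s : inJ G (flip s i) (ZZ (flip s i)) -> inJ G s (tG i s).
Proof.
by rewrite /tG; case: ifP => _; [move/(inJ_ed i); rewrite flipK|rewrite inJ0].
Qed.
Let tH_inJ i t : inJ H (flip t i) (YY (flip t i)) -> inJ H t (tH i t).
Proof.
by rewrite /tH; case: ifP => _; [move/(inJ_ed i); rewrite flipK|rewrite inJ0].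
Qed.

Let t_rest t i : freeH t -> rst i -> tH i t = Lam (locm t) (tG i (mixs t)).
Proof.
move=> ft ri; rewrite /tH /tG -(on_rst ri (mixs_rst t ri)).
case: ifP => _; last by rewrite linear0.
have ft' : freeH (flip t i) by rewrite free_flip.
rewrite YY_free // YE // locm_flip // -mixs_flip // ZZ_free; last exact: freeG_mixs.
apply/esym/ed_Lam; last exact: row_locm.
by apply: xz_free => //; rewrite row_locm // addxx mem0v.
Qed.

Let Lt t i := Lam (locm t) (tG i (mixs t)).

Let dPH t : dP H YY t = tH u t + (tH v t + (tH w t + \sum_(i | rst i) tH i t)).
Proof. by rewrite -(big3 (tH^~ t)) /dP big_mkcond. Qed.
Let dPG s : dP G ZZ s = tG u s + (tG v s + (tG w s + \sum_(i | rst i) tG i s)).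
Proof. by rewrite -(big3 (tG^~ s)) /dP big_mkcond. Qed.

Let shuffle (V : lmodType F2) (b c d b' c' d' r : V) :
  b + (c + (d + r)) + (b' + (c' + (d' + r))) = b + c + d + (b' + c' + d').
Proof. by rewrite !addrA -!addrA [r + _]addrC -!addrA addxx addr0. Qed.

Let shuffle2 (V : lmodType F2) (b c d e : V) : b + c + (d + e) = (c + d) + (b + e).
Proof. by rewrite [b + c]addrC addrACA. Qed.

Let shuffle3 (V : lmodType F2) (b c d e : V) : b + c + (d + e) = (b + e) + (c + d).
Proof. by rewrite [d + e]addrC addrACA. Qed.

Let shuffle4 (V : lmodType F2) (b c d : V) : (d + c) + (b + d) = b + c.
Proof. by rewrite [d + c]addrC [b + d]addrC -addrA addxK addrC. Qed.

Let split_dP t : freeH t -> dP H YY t + Lam (locm t) (dP G ZZ (mixs t)) =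
  tH u t + tH v t + tH w t + (Lt t u + Lt t v + Lt t w).
Proof.
move=> ft; rewrite dPH dPG 3!(linearD (Lam (locm t))) (linear_sum (Lam (locm t))).
by rewrite (eq_bigr _ (fun i => t_rest ft)) shuffle.
Qed.

Let tHE i t : on H t i -> tH i t = ed H (flip t i) i (YY (flip t i)).
Proof. by rewrite /tH => ->. Qed.
Let tGE i s : on G s i -> tG i s = ed G (flip s i) i (ZZ (flip s i)).
Proof. by rewrite /tG => ->. Qed.
Let tH0 i t : ~~ on H t i -> tH i t = 0.
Proof. by rewrite /tH => /negPf ->. Qed.
Let tG0 i s : ~~ on G s i -> tG i s = 0.
Proof. by rewrite /tG => /negPf ->. Qed.
Let onE := (onG_u, onG_v, onG_w, onH_u, onH_v, onH_w).
Let Lt0 t i : ~~ on G (mixs t) i -> Lt t i = 0.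
Proof. by move=> ti; rewrite /Lt tG0 // linear0. Qed.
Let Lt_inJ t i : freeH t -> inJ G (flip (mixs t) i) (ZZ (flip (mixs t) i)) ->
  inJ H t (Lt t i).
Proof. by move=> ft /tG_inJ; apply: M_inJ. Qed.

Let not_xz_wG s : u \in s -> v \notin s -> w \notin s -> ~~ xz G s w.
Proof.
move=> us vs ws; apply/negP => /phi_relG/eqP.
by rewrite pair_delta phi_w oner_eq0 => e; have := e; rewrite !onE offG us vs ws => /(_ isT isT isT).
Qed.
Let not_xz_wH s : u \in s -> v \in s -> w \in s -> ~~ xz H s w.
Proof.
move=> us vs ws; apply/negP => /phi_relH/eqP.
by rewrite pair_delta phi_w oner_eq0 => e; have := e; rewrite !onE offH negbK us vs ws => /(_ isT isT isT).
Qed.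

(** In either graph only one edge among the directions u, v, w enters, and it comes from a corner
    00, where the corrected family is zero. *)
Let corner_v t : u \notin t -> v \in t -> w \notin t ->
  inJ H t (tH u t + tH v t + tH w t + (Lt t u + Lt t v + Lt t w)).
Proof.
move=> ut vt wt; have ft : freeH t by rewrite /freeH wt.
have mt : mixs t = t by apply: mixs_id; right.
rewrite tH0 ?onE // tH0 ?onE ?negbK // [Lt t u]Lt0 ?mt ?onE // [Lt t w]Lt0 ?mt ?onE //.
rewrite !add0r addr0; apply: inJD; [apply: tH_inJ|apply: Lt_inJ]; rewrite ?mt //.
  by apply: YY_00; rewrite in_flip ?neqs ?eqxx ?(negPf ut) ?vt ?(negPf wt).
by apply: ZZ_00; rewrite in_flip ?neqs ?eqxx ?(negPf ut) ?vt ?(negPf wt).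
Qed.

Let corner_w t : u \notin t -> v \notin t -> w \in t ->
  inJ H t (tH u t + tH v t + tH w t + (Lt t u + Lt t v + Lt t w)).
Proof.
move=> ut vt wt; have ft : freeH t by rewrite /freeH ut vt orbT.
have mt : mixs t = t by apply: mixs_id; left.
rewrite tH0 ?onE // [tH w t]tH0 ?onE ?negbK // [Lt t u]Lt0 ?mt ?onE // [Lt t v]Lt0 ?mt ?onE //.
rewrite !add0r addr0; apply: inJD; [apply: tH_inJ|apply: Lt_inJ]; rewrite ?mt //.
  by apply: YY_00; rewrite in_flip ?neqs ?eqxx ?(negPf ut) ?(negPf vt) ?wt.
by apply: ZZ_00; rewrite in_flip ?neqs ?eqxx ?(negPf ut) ?(negPf vt) ?wt.
Qed.

Let corner_0 t : u \notin t -> v \notin t -> w \notin t ->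
  inJ H t (tH u t + tH v t + tH w t + (Lt t u + Lt t v + Lt t w)).
Proof.
move=> /negPf ut /negPf vt /negPf wt.
have t'E := (in_flip, eqxx, neqs, ut, vt, wt, flipK).
have ft : freeH t by rewrite /freeH wt.
have mt : mixs t = flip (flip t u) w by rewrite /mixs wt vt ut.
have lt : locm t = Ac by rewrite /locm wt vt.
have mu : flip (mixs t) u = flip t w by rewrite mt flipC flipK.
have mw : flip (mixs t) w = flip t u by rewrite mt flipK.
rewrite tH0 ?onE ?ut // [Lt t v]Lt0 ?onE ?mt ?t'E // add0r addr0.
have -> : tH v t + tH w t + (Lt t u + Lt t w) = (tH w t + Lt t u) + (tH v t + Lt t w).
  exact: shuffle2.
rewrite /Lt lt; apply: inJD.
  rewrite tHE ?onE ?wt // tGE ?mu; last by rewrite onE mt !t'E.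
  rewrite YY_free /freeH ?t'E // YE /freeH ?t'E // ZZ_free /freeG ?t'E //.
  by rewrite locm_a ?mixs_id ?t'E; [apply: edge1 | left | left].
rewrite tHE ?onE ?vt // tGE ?mw; last by rewrite onE mt !t'E.
rewrite YY_free /freeH ?t'E // YE /freeH ?t'E // locm_a ?mixs_id ?t'E; try by right.
have := ZZ_10 (s := flip t u); rewrite !t'E => /(_ isT isT isT).
have -> : flip (flip (flip t u) v) u = flip t v by rewrite flipC flipK.
set e := ed G (flip t v) u _ => /(inJ_ed w); rewrite linearD /= -mt.
(* The zigzag ends with the w-edge out of the cancelled state {u}, a quotient map because x_w is
   nonzero there. *)
have edw r : ed G (flip t u) w r = r.
  by rewrite /ed (negPf (not_xz_wG _ _ _)) ?t'E.
rewrite !edw => /(M_inJ ft); rewrite lt (linearD (Lam Ac)) /= Lam_comp => Je.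
by rewrite -(inJDl _ Je) shuffle4; apply: edge2.
Qed.

Let corner_uv t : u \in t -> v \in t -> w \notin t ->
  inJ H t (tH u t + tH v t + tH w t + (Lt t u + Lt t v + Lt t w)).
Proof.
move=> ut vt /negPf wt.
have t'E := (in_flip, eqxx, neqs, ut, vt, wt, flipK).
have ft : freeH t by rewrite /freeH wt.
have mt : mixs t = flip (flip t u) w by rewrite /mixs wt vt ut.
have lt : locm t = Ab by rewrite /locm wt vt ut.
have mv : flip (mixs t) v = flip (flip (flip t w) v) u.
  by rewrite mt [flip (flip t u) w]flipC flipC.
have mw : flip (mixs t) w = flip t u by rewrite mt flipK.
rewrite [tH v t]tH0 ?onE ?vt // [Lt t u]Lt0 ?onE ?mt ?t'E // add0r addr0.
rewrite shuffle3 /Lt lt; apply: inJD.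
  rewrite tHE ?onE ?ut // tGE ?mw; last by rewrite onE mt !t'E.
  rewrite YY_free /freeH ?t'E // YE /freeH ?t'E // ZZ_free /freeG ?t'E //.
  by rewrite locm_a ?mixs_id ?t'E; [apply: edge3 | right | right].
rewrite tHE ?onE ?wt // tGE ?mv; last by rewrite onE mt !t'E.
rewrite ZZ_free /freeG ?t'E //.
have := YY_10 (t := flip t w); rewrite !t'E => /(_ isT isT isT).
rewrite YE /freeH ?t'E // locm_a ?mixs_id ?t'E; try by left.
set s := flip _ u; set e := Lam T _ => /(inJ_ed w); rewrite linearD /= flipK.
(* Likewise in H, at the cancelled state {u, v, w}. *)
have edw r : ed H (flip t w) w r = r.
  by rewrite /ed (negPf (not_xz_wH _ _ _)) ?t'E.
rewrite !edw => Je; by rewrite -(inJDl _ Je) addrA [YY _ + _ + YY _]addrAC addxx add0r; apply: edge4.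
Qed.

Let corner_u t : u \in t -> v \notin t -> w \notin t ->
  inJ H t (tH u t + tH v t + tH w t + (Lt t u + Lt t v + Lt t w)).
Proof.
move=> ut /negPf vt /negPf wt.
have t'E := (in_flip, eqxx, neqs, ut, vt, wt, flipK).
have ft : freeH t by rewrite /freeH wt.
have mt : mixs t = flip (flip t v) w by rewrite /mixs wt vt ut.
have lt : locm t = Ac by rewrite /locm wt vt.
have mv : flip (mixs t) v = mixs (flip t u).
  by rewrite /mixs !t'E /= flipC !flipK.
have mu : flip (mixs t) u = mixs (flip t v).
  by rewrite /mixs !t'E /= [RHS]flipC flipC; congr flip; rewrite flipC.
(* In both graphs the w-edge comes from a corner 11, where the corrected family is exactly zero. *)
have -> : tH w t = 0 by rewrite tHE ?onE ?wt // YY_11 ?t'E // linear0.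
have -> : Lt t w = 0.
  by rewrite /Lt tGE ?onE ?mt ?t'E // ZZ_11 ?t'E // !linear0.
rewrite !addr0 shuffle3 /Lt lt; apply: inJD.
  rewrite tHE ?onE ?ut // tGE ?mv; last by rewrite onE mt !t'E.
  rewrite YY_free /freeH ?t'E // YE /freeH ?t'E // ZZ_free; last first.
    by apply: freeG_mixs; rewrite /freeH !t'E.
  have -> : locm (flip t u) = Ac by rewrite /locm !t'E.
  by rewrite -mv; apply: edge5.
rewrite tHE ?onE ?vt // tGE ?mu; last by rewrite onE mt !t'E.
rewrite YY_free /freeH ?t'E // YE /freeH ?t'E // ZZ_free; last first.
  by apply: freeG_mixs; rewrite /freeH !t'E.
have -> : locm (flip t v) = Ab by rewrite /locm !t'E.
by rewrite -mu; apply: edge6.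
Qed.

Lemma transfer_dP t : freeH t ->
  inJ H t (dP H YY t + Lam (locm t) (dP G ZZ (mixs t))).
Proof.
move=> ft; rewrite split_dP //; move: ft; rewrite /freeH.
have [wt /andP[ut vt]|wt _] := boolP (w \in t); first exact: corner_w.
have [ut|ut] := boolP (u \in t); have [vt|vt] := boolP (v \in t).
- exact: corner_uv.
- exact: corner_u.
- exact: corner_v.
exact: corner_0.
Qed.
End Differential.

Lemma kh_Omega3_reduction : kh_iso G H.
Proof.
apply: (@kh_reduction _ _ G H hG EG hH EH M).
- exact: CG.
- exact: CH.
- move=> x t; suff -> : mapp EH (mapp M (mapp EG x)) t = mapp M (mapp EG x) t.
    by rewrite addxx inJ0.
  rewrite {1}/mapp EH_cond; case: ifP => // ft.
  by rewrite {1}/mapp /= ft.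
- move=> x x0 s; rewrite addr0.
  have [fs|fs] := boolP (freeG s); last first.
    by rewrite /mapp EG_cond (negPf fs) inJ0.
  have [ft ms] := mixiK fs; have := x0 (mixi s).
  rewrite addr0 {1}/mapp /= ft ms; apply: (inJ_Lam_inv (B := invm (mixi s))) => [r rt|i].
    by rewrite -[X in relspace G X]ms relspace_free // -mulmxA inv_loc mulmx1.
  by rewrite loc_inv row_one addxx mem0v.
- move=> y; exists (fun s => Lam (invm (mixi s)) (y (mixi s))) => t.
  rewrite {1}/mapp EH_cond {1}/mapp /=; case: ifP => ft; last by rewrite addxx inJ0.
  rewrite {1}/mapp EG_cond freeG_mixs // mixsK // Lam_comp inv_loc Lam_id.
  by rewrite addxx inJ0.
move=> x y z t; rewrite {1}/mapp EH_cond {2}/mapp /=.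
case: ifP => ft; last by rewrite addxx inJ0.
by rewrite {2}/mapp EG_cond freeG_mixs //; apply: transfer_dP.
Qed.

End Omega3.

Lemma kh_Omega3 n (G H : lgraph n) : Omega3 G H -> kh_iso G H.
Proof.
case=> u [v [w [[uvw labG adjGu] [adjHu adjH frH sgnH]]]].
move: uvw; rewrite /= !inE negb_or !andbT => /andP[/andP[uv uw] vw].
exact: (kh_Omega3_reduction uv uw vw).
Qed.

Theorem theorem1 (m n : nat) (G : lgraph m) (H : lgraph n)
    (move_GH : reidemeister G H) :
  exists phi : {linear Kh H -> Kh G}, bijective phi.
Proof.
rewrite -/(kh_iso H G); case: move_GH => {n m G H} n G H.
- by move/kh_Omega1/lin_iso_sym.
- exact: kh_Omega1.
- by move/kh_Omega2/lin_iso_sym.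
- exact: kh_Omega2.
- by move/kh_Omega3/lin_iso_sym.
- exact: kh_Omega3.
- by move/kh_Omega4/lin_iso_sym.
by move/kh_Omega4'/lin_iso_sym.
Qed.
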